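(* Let $p,q,a,b$ be even positive integers. Then $K(p,q)=K(a,b)$ if and only if $\{p,q\}=\{a,b\}$.
   Context: Twist regions. Let $e$ be an arc (an edge) in $S^2$ with two disjoint strands running parallel to $e$, one on each side. To put the integer label $n$ on $e$ means to twist these two strands about $e$ by $|n|$ half twists, producing a row of $|n|$ crossings along $e$ (none if $n=0$), all of sign $\operatorname{sign}(n)$ relative to $e$. A crossing is positive relative to $e$ if, when the picture (with $S^2$ viewed from a fixed side) is rotated locally so that $e$ is vertical, the overcrossing strand runs from upper left to lower right; it is negative if the overcrossing strand runs from lower left to upper right. The double twist knot (or link) $K(p,q)$, for $p,q\in\mathbb Z$. Divide a circle $C\subset S^2$ into four arcs $A_1,B_1,A_2,B_2$ in this cyclic order. In one complementary disk of $C$ (the inside) take an edge $e$ joining an interior point of $A_1$ to an interior point of $A_2$, and two strands parallel to $e$, one joining the two endpoints of $B_1$ and the other joining the two endpoints of $B_2$; put label $p$ on $e$. In the other disk (the outside) take an edge $e'$ joining an interior point of $B_1$ to an interior point of $B_2$, and two strands parallel to $e'$, one joining the two endpoints of $A_1$ and the other the two endpoints of $A_2$; put label $q$ on $e'$. The union of inside and outside is the link diagram $K(p,q)$; it presents a knot when $p,q$ are both even. Equality of knots means ambient isotopy in $S^3$ (as unoriented knots, mirror images not identified). *)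

(* Defs.v *)
From mathcomp Require Import all_boot all_order all_algebra.
From mathcomp Require Import all_classical all_reals all_analysis.
From mathcomp Require Import ring.
Import Order.TTheory GRing.Theory Num.Theory.
Import numFieldNormedType.Exports.

Set Implicit Arguments.
Unset Strict Implicit.
Unset Printing Implicit Defensive.

Local Open Scope classical_set_scope.
Local Open Scope ring_scope.

Definition vec4 (R : realType) (x y w h : R) : 'rV[R]_4 :=
  \row_i [:: x; y; w; h]`_i.

Definition S3 (R : realType) : set 'rV[R]_4 :=
  [set u | \sum_(i < 4) u 0 i ^+ 2 = 1].

Definition homeo_on (T : topologicalType) (A : set T) (f : T -> T) : Prop :=
  exists g : T -> T,
    [/\ set_fun A A f, set_fun A A g,
        {in A, cancel f g}, {in A, cancel g f} &
        {within A, continuous f} /\ {within A, continuous g}].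

(* Only the restriction of each H t to the unit sphere matters.  A knot is a
   subset of S3, hence unoriented; as H 0 is the identity, all H t preserve the
   orientation of the sphere, so mirror images are not identified. *)
Definition ambient_isotopic (R : realType) (K L : set 'rV[R]_4) : Prop :=
  exists H : R -> 'rV[R]_4 -> 'rV[R]_4,
    [/\ {within `[0, 1] `*` @S3 R,
           continuous (fun z : R * 'rV[R]_4 => H z.1 z.2)},
        forall t : R, t \in `[0, 1] -> homeo_on (@S3 R) (H t),
        forall u, u \in @S3 R -> H 0 u = u &
        H 1 @` K = L].

(* Coordinates on the 3-sphere are (x, y, w, h).  The diagram lives on the
   2-sphere S2 = {h = 0} and is seen from the side h > 0: a point of the
   3-sphere other than (0, 0, 0, 1) and (0, 0, 0, -1) projects to
   (x, y, w) / |(x, y, w)|, and at a double point the larger h is over.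

   The circle C is {w = h = 0}, the inside is w < 0 and the outside w > 0.  The
   points (x, y) = (+-a, +-a), a = 1 / sqrt 2, divide C into
     A1 = {y > |x|},  B1 = {x < -|y|},  A2 = {y < -|x|},  B2 = {x > |y|},
   in this cyclic order.

   Inside, the edge e is the great semicircle (0, cos t, - sin t, 0) with t in
   [0, pi], from the middle of A1 (t = 0) to the middle of A2 (t = pi).  The
   two strands (s = 1 and s = -1) are the curves
     a (- s cos (n t), cos t, - sin t, s sin (n t)),
   of norm 1, which advance along e at unit rate while the pair turns about e
   through the angle n pi, that is, |n| half twists.  For n = 0 they are
   parallel to e, s = 1 joining the endpoints of B1 and s = -1 those of B2.
   In projection the strands cross, on e, exactly when cos (n t) = 0, which
   happens |n| times for t in [0, pi].
   Sign: draw e downwards as t grows, with x increasing to the right.  Near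
   n t = pi / 2, for n > 0, the strand s = 1 is over (h = a) and its
   x-coordinate - a cos (n t) goes from negative to positive as t grows, so
   the overstrand runs from upper left to lower right: the crossing is
   positive.  The other crossings are obtained by t |-> t + pi / n, which
   exchanges the strands, and n |-> -n reverses all signs.  (Looking at S2
   from the side h < 0 instead gives the same signs.) *)
Definition strand (R : realType) (n : int) (s t : R) : 'rV[R]_4 :=
  let a := (Num.sqrt 2)^-1 in
  vec4 (a * - (s * cos (n%:~R * t))) (a * cos t)
       (a * - sin t) (a * (s * sin (n%:~R * t))).

Definition twist_region (R : realType) (n : int) : set 'rV[R]_4 :=
  strand n 1 @` `[0, pi] `|` strand n (-1) @` `[0, pi].

(* Rotation by pi of S2 about the axis x = y, w = 0, extended by the identity
   on h (so it preserves the side from which S2 is viewed).  It maps C to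
   itself, exchanges inside and outside, A1 and B2, and A2 and B1; the image of
   e is the outside edge e', the strands around e' join for n = 0 the
   endpoints of A2 and those of A1, and crossing signs relative to the edge are
   unchanged. *)
Definition flip (R : realType) (u : 'rV[R]_4) : 'rV[R]_4 :=
  vec4 (u 0 1) (u 0 0) (- u 0 2) (u 0 3).

(* The inside and the outside meet exactly in the four division points of C. *)
Definition double_twist (R : realType) (p q : int) : set 'rV[R]_4 :=
  twist_region p `|` @flip R @` twist_region q.
Arguments double_twist : clear implicits.

Lemma flip_vec4 (R : realType) (x y w h : R) :
  flip (vec4 x y w h) = vec4 y x (- w) h.
Proof.
rewrite /flip; apply/rowP => i; rewrite !mxE.
by case: i => [[|[|[|[|//]]]]].
Qed.

Lemma vec4_S3 (R : realType) (x y w h : R) :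
  @S3 R (vec4 x y w h) <-> x ^+ 2 + y ^+ 2 + w ^+ 2 + h ^+ 2 = 1.
Proof.
by rewrite /S3 /= !big_ord_recl big_ord0 !mxE /= addr0 !addrA.
Qed.

Lemma double_twist_S3 (R : realType) (p q : int) :
  double_twist R p q `<=` @S3 R.
Proof.
have norm1 (a s c1 s1 c2 s2 : R) : a ^+ 2 = 2^-1 -> s ^+ 2 = 1 ->
    c1 ^+ 2 + s1 ^+ 2 = 1 -> c2 ^+ 2 + s2 ^+ 2 = 1 ->
    (a * - (s * c1)) ^+ 2 + (a * c2) ^+ 2 + (a * - s2) ^+ 2 +
      (a * (s * s1)) ^+ 2 = 1.
  move=> a2 s2E e1 e2.
  transitivity (a ^+ 2 * (s ^+ 2 * (c1 ^+ 2 + s1 ^+ 2) + (c2 ^+ 2 + s2 ^+ 2))).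
    by ring.
  by rewrite e1 e2 s2E a2 mulr1 mulVf.
have a2 : (Num.sqrt 2)^-1 ^+ 2 = 2^-1 :> R by rewrite exprVn sqr_sqrtr.
have strandS3 n (s t : R) : s ^+ 2 = 1 -> @S3 R (strand n s t).
  by move=> s2; apply/vec4_S3; apply: norm1 => //; exact: cos2Dsin2.
have flipS3 (u : 'rV[R]_4) : @S3 R u -> @S3 R (flip u).
  rewrite /flip => Su; apply/vec4_S3; rewrite -Su !big_ord_recl big_ord0 addr0.
  rewrite sqrrN [X in X + _ + _]addrC -!addrA.
  by congr (u 0 _ ^+ 2 + (u 0 _ ^+ 2 + (u 0 _ ^+ 2 + u 0 _ ^+ 2))); exact/val_inj.
have sN1 : (-1 : R) ^+ 2 = 1 by rewrite sqrrN expr1n.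
have s1 : (1 : R) ^+ 2 = 1 by rewrite expr1n.
by move=> u [[|] [t _ <-]|[v [|] [t _ <-] <-]];
  try apply: flipS3; apply: strandS3.
Qed.

(* Main.v *)
(** A gauge-theoretic version of the fundamental group is used: a local system
   on a set A with values in a group G is a family of transition elements c x y,
   of which only the germ along the diagonal matters, and a reduction of c to a
   subgroup Q is a gauge F bringing all of them into Q.

   For K = K(2m, 2l) the sphere w = 0 meets the knot in four points and cuts the
   complement into two pieces.  Untwisting retracts each piece onto half of the
   punctured sphere, so that local systems correspond to triples (g, U, V) in G
   with U = [V^l, g] and V = [U^m, g^-1].  Here g is a meridian and
   [U^-m, V^-l] the longitude commuting with it: the system reduces to any
   subgroup containing them near the knot, and conversely, if it reduces to Q
   near the knot, then Q contains conjugates of both, as one sees by pushing the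
   knot off itself.  A homeomorphism of the sphere carrying one knot to another
   therefore matches these data.

   Take for G the group of maps z |-> a conj^k z + b with |a| = 1.  Let g be a
   glide reflection; then U has a rotation part u with u^N = 1, N = 4ml - 1, and
   the translation lengths of the longitude and of g^2 have the ratio
   |tan(x/2) tan(y/2)|, where exp(ix) = u^m and exp(iy) = u^(2ml).  The orders of
   the rotation parts of V show that N, hence ml, depends on the knot only, and
   the least nonzero ratio is tan(pi/N) tan(2 min(m, l) pi/N), which gives
   min(m, l).  Conversely K(p, q) and K(q, p) differ by a rotation of S3. *)

Require Import Defs.
From mathcomp Require Import all_boot all_order all_algebra.
From mathcomp Require Import all_classical all_reals all_analysis.
From HB Require Import structures.
From mathcomp Require Import ring lra zify complex.
Import Order.TTheory GRing.Theory Num.Theory.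
Import numFieldNormedType.Exports.

Set Implicit Arguments.
Unset Strict Implicit.
Unset Printing Implicit Defensive.

Local Open Scope classical_set_scope.
Local Open Scope ring_scope.

(** * Local systems and their reductions *)

Section LocalSystems.
Variable G : groupType.
Implicit Types (T : topologicalType).
Local Open Scope group_scope.

(** A homeomorphism of the sphere respects neighbourhoods of the knot but no tube, framing or base
    point; so the peripheral structure is recovered only from the subgroups to which a system
    reduces near the knot, and only up to conjugators that are not controlled. With [Q] cyclic,
    generated by [g'], or peripheral, generated by [g'] and its longitude, [g] becomes a power of
    [g'] and the longitude a product of powers of both. The integer [k] of a glide reflection leaves
    only [g'] and its inverse in the first case and removes the factor [g'] in the second. What
    stays unknown is an exponent [d >= 1] of the longitude, and this is why the least ratio is
    compared and not the set of all ratios.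

    The linear parts of the chosen systems are the dihedral representations of the knot group, with
    rotations satisfying u^N = 1: there a meridian is a reflection and the longitude is trivial.
    Replacing the reflection by a glide reflection turns the longitude into a translation, and the
    quotient of its length by that of g^2 does not depend on the scale. *)

Definition subgroup (Q : set G) : Prop :=
  [/\ Q 1, forall x y, Q x -> Q y -> Q (x * y) & forall x, Q x -> Q x^-1].

(* c is a coboundary near each point; c x y is junk unless y is near x. *)
Definition locsys T (A : set T) (c : T -> T -> G) : Prop :=
  forall x, A x -> exists m : T -> G, \forall y \near x, A y ->
    \forall z \near y, A z -> c y z = (m y)^-1 * m z.

(** Pointwise, so that a reduction can be demanded only near the knot, or only near one of its
    points. The gauge [F] may be discontinuous as long as its jumps lie in [Q]. *)
Definition red_at T (A : set T) (c : T -> T -> G) (Q : set G) (F : T -> G) x :=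
  \forall y \near x, A y -> Q (F x * c x y * (F y)^-1).

Definition red T (A : set T) (c : T -> T -> G) (Q : set G) (F : T -> G) :=
  forall x, A x -> red_at A c Q F x.

Definition triv T (A : set T) (c : T -> T -> G) (m : T -> G) : Prop :=
  red A c [set 1] m.

Definition cont_on T (U : topologicalType) (A : set T) (f : T -> U) : Prop :=
  forall x, A x -> forall W : set U, nbhs (f x) W ->
    \forall y \near x, A y -> W (f y).

Lemma subgroup1 : subgroup [set 1].
Proof. by split=> [//|x y -> ->|x ->]; rewrite /= ?mulg1 ?invg1. Qed.

Lemma trivE T (A : set T) c m x : triv A c m -> A x ->
  \forall y \near x, A y -> c x y = (m x)^-1 * m y.
Proof.
move=> tm Ax; apply: filterS (tm x Ax) => y + Ay => /(_ Ay) /= h.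
by apply: (mulgI (m x)); rewrite mulVKg; apply/eqP; rewrite -divg_eq1 h.
Qed.

Lemma trivP T (A : set T) c m :
  (forall x, A x -> \forall y \near x, A y -> c x y = (m x)^-1 * m y) ->
  triv A c m.
Proof.
move=> h x Ax; apply: filterS (h x Ax) => y + Ay => /(_ Ay) /= ->.
by rewrite mulVKg mulgV.
Qed.

Lemma locsys_refl T (A : set T) c x : locsys A c -> A x -> c x x = 1.
Proof.
move=> lc Ax; have [m /nbhs_singleton /(_ Ax) /nbhs_singleton /(_ Ax) ->] := lc x Ax.
by rewrite mulVg.
Qed.

Lemma red_sub T (A B : set T) c Q F : B `<=` A -> red A c Q F -> red B c Q F.
Proof.
by move=> BA r x Bx; apply: filterS (r x (BA _ Bx)) => y h By; apply: h; exact: BA.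
Qed.

Lemma locsys_sub T (A B : set T) c : B `<=` A -> locsys A c -> locsys B c.
Proof.
move=> BA lc x Bx; have [m hm] := lc x (BA _ Bx); exists m.
apply: filterS hm => y h By; apply: filterS (h (BA _ By)) => z k Bz.
exact: k (BA _ Bz).
Qed.

Lemma cont_on_sub T (U : topologicalType) (A B : set T) (f : T -> U) :
  B `<=` A -> cont_on A f -> cont_on B f.
Proof.
move=> BA cf x Bx W hW; apply: filterS (cf x (BA _ Bx) W hW) => y h By.
exact: h (BA _ By).
Qed.

Section Pullback.
Variables (T U : topologicalType) (A : set T) (B : set U) (f : T -> U).
Hypotheses (fAB : forall x, A x -> B (f x)) (cf : cont_on A f).

Lemma locsys_pull c : locsys B c -> locsys A (fun x y => c (f x) (f y)).
Proof.
move=> lc x Ax; have [m hm] := lc _ (fAB Ax); exists (m \o f).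
apply: filterS (cf Ax hm) => y h Ay.
apply: filterS (cf Ay (h Ay (fAB Ay))) => z k Az; exact: k Az (fAB Az).
Qed.

Lemma red_at_pull c Q F x : A x -> red_at B c Q F (f x) ->
  red_at A (fun x y => c (f x) (f y)) Q (F \o f) x.
Proof.
move=> Ax r; apply: filterS (cf Ax r) => y h Ay.
exact: h Ay (fAB Ay).
Qed.

Lemma red_pull c Q F : red B c Q F ->
  red A (fun x y => c (f x) (f y)) Q (F \o f).
Proof. by move=> r x Ax; apply: red_at_pull => //; apply: r; exact: fAB. Qed.

End Pullback.

End LocalSystems.

(** * Parallel transport along intervals and homotopies *)

Section Interval.
Variables (R : realType) (a b : R).
Hypothesis ab : a <= b.

(** Connectedness of the segment: the part where [P] holds and the part where it fails are both
    relatively open. *)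
Lemma itv_locally_constant (P : R -> Prop) :
  (forall s, a <= s <= b -> \forall s' \near s, a <= s' <= b -> (P s <-> P s')) ->
  P a -> forall s, a <= s <= b -> P s.
Proof.
move=> hP Pa s sab.
have conn : connected `[a, b] by exact: segment_connected.
pose B := `[a, b] `&` P.
suff BE : B = [set` `[a, b]] by have : [set` `[a, b]] s by []; rewrite -BE => -[].
apply: conn.
- by exists a; split => //=; rewrite in_itv /= lexx.
- exists [set x | \forall y \near x, a <= y <= b -> P y].
    rewrite openE => x /= hx.
    exact: (nbhs_interior hx).
  rewrite eqEsubset; split => x [] xab.
    move=> Px; split => //=; move: xab; rewrite /= in_itv /= => xab.
    by apply: filterS (hP x xab) => y /[apply] -[h _]; exact: h.
  move=> /= hx; split => //; move: xab; rewrite /= in_itv /= => xab.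
  exact: (nbhs_singleton hx) xab.
- exists (~` [set x | \forall y \near x, a <= y <= b -> ~ P y]).
    rewrite closedC openE => x /= hx.
    exact: (nbhs_interior hx).
  rewrite eqEsubset; split => x [] xab.
    move=> Px; split => //= /nbhs_singleton; apply => //.
  move: (xab); rewrite /= in_itv /= => xab' hx; split => //.
  apply: contrapT => nPx; apply: hx.
  by apply: filterS (hP x xab') => y /[apply] -[_ h] /h.
Qed.

End Interval.

Section Homotopy.
Variables (G : groupType) (R : realType).
Local Open Scope group_scope.

Local Notation itv a b := [set s : R | (a <= s <= b)%R].

Lemma mulVgM (z x y : G) : (z * x)^-1 * (z * y) = x^-1 * y.
Proof. by rewrite invgM -mulgA mulKg. Qed.

(** A trivialisation over [[a, s]] extends past [s] by a rescaled local potential, so that being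
    trivial over [[a, s]] is a locally constant property of [s]. *)
Lemma itv_triv (a b : R) (C : R -> R -> G) : (a <= b)%R ->
  locsys (itv a b) C -> exists m, triv (itv a b) C m.
Proof.
move=> ab lC.
(* The left factor makes the potential [M] agree with [m] at [s1]. For [s2 < s1] the statement is a
   restriction; it is included because local constancy is shown in both directions. *)
have glue (s1 s2 : R) m M : (a <= s1 <= b)%R -> (a <= s2 <= b)%R ->
    triv (itv a s1) C m ->
    (forall x, (s1 <= x <= s2)%R -> \forall y \near x, (a <= y <= b)%R ->
       C x y = (M x)^-1 * M y) ->
    triv (itv a s2) C
      (fun x => if (x <= s1)%R then m x else m s1 * (M s1)^-1 * M x).
  move=> /andP[as1 s1b] /andP[as2 s2b] tm hM; apply: trivP => x /andP[ax xs2].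
  have [xs1|xs1|->] := ltgtP x s1.
  - have := trivE tm (x := x); rewrite /= ax ltW// => /(_ isT) hx.
    near=> y => /andP[ay ys2].
    have ys1 : (y <= s1)%R by apply: ltW; near: y; exact: lt_nbhsl.
    rewrite ys1; apply: (near hx y) => //=; by rewrite ay ys1.
  - have /hM hx : (s1 <= x <= s2)%R by rewrite (ltW xs1).
    near=> y => /andP[ay ys2].
    have ys1 : (s1 < y)%R by near: y; exact: lt_nbhsr.
    rewrite leNgt ys1 /= mulVgM.
    by apply: (near hx y) => //; rewrite ay (le_trans ys2).
  - have [s12|s21] := leP s1 s2; last first.
      have := trivE tm (x := s1); rewrite /= as1 lexx => /(_ isT) hx.
      near=> y => /andP[ay ys2]; rewrite (le_trans ys2 (ltW s21)).
      by apply: (near hx y) => //=; rewrite ay (le_trans ys2 (ltW s21)).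
    have := trivE tm (x := s1); rewrite /= as1 lexx => /(_ isT) hx.
    have /hM hx' : (s1 <= s1 <= s2)%R by rewrite lexx.
    near=> y => /andP[ay ys2]; have [ys1|ys1] := leP y s1.
      by apply: (near hx y) => //=; rewrite ay.
    rewrite -!mulgA mulKg; apply: (near hx' y) => //.
    by rewrite ay (le_trans ys2).
pose P s := exists m, triv (itv a s) C m.
suff : forall s, (a <= s <= b)%R -> P s.
  by apply; rewrite ab lexx.
apply: itv_locally_constant => //.
  move=> s sab; have [M /nbhs_ballP[/= e e0 hM]] := lC s sab.
  have key s1 s2 : (a <= s1 <= b)%R -> (a <= s2 <= b)%R -> ball s e s1 ->
      ball s e s2 -> P s1 -> P s2.
    move=> s1ab s2ab s1e s2e [m tm]; eexists.
    apply: (glue s1 s2 m M) => // x /andP[s1x xs2].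
    apply: hM => /=.
      move: s1e s2e; rewrite /ball /= !ltr_distlC => /andP[h1 h2] /andP[h3 h4].
      by rewrite (lt_le_trans h1 s1x) (le_lt_trans xs2 h4).
    move: s1ab s2ab => /andP[h1 h2] /andP[h3 h4].
    by rewrite (le_trans h1 s1x) (le_trans xs2 h4).
  near=> s' => s'ab; have s'e : ball s e s' by near: s'; exact: nbhsx_ballx.
  by split; apply: key => //; exact: ballxx.
exists (fun=> 1); apply: trivP => x /= xaa.
have xa : x = a by apply/eqP; rewrite eq_le andbC.
near=> y => yaa; have -> : y = a by apply/eqP; rewrite eq_le andbC.
by rewrite xa (locsys_refl lC) ?mulVg//= lexx.
Unshelve. all: by end_near. Qed.

(** The double coset of F1 F2^-1 modulo [Q1] and [Q2] is locally constant along the interval. Every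
    later comparison of two gauges comes down to this, mostly with [Q1] trivial. *)
Lemma itv_red2 (a b : R) (C : R -> R -> G) Q1 Q2 F1 F2 : (a <= b)%R ->
  subgroup Q1 -> subgroup Q2 ->
  red (itv a b) C Q1 F1 -> red (itv a b) C Q2 F2 ->
  exists q1 q2, [/\ Q1 q1, Q2 q2 &
    F1 b * (F2 b)^-1 = q1 * (F1 a * (F2 a)^-1) * q2].
Proof.
move=> ab [Q11 Q1M Q1V] [Q21 Q2M Q2V] r1 r2.
pose P s := exists q1 q2, [/\ Q1 q1, Q2 q2 &
    F1 s * (F2 s)^-1 = q1 * (F1 a * (F2 a)^-1) * q2].
suff : forall s, (a <= s <= b)%R -> P s by apply; rewrite ab lexx.
apply: itv_locally_constant => //; last by exists 1, 1; rewrite mul1g mulg1.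
move=> s sab; apply: filterS2 (r1 s sab) (r2 s sab) => y h1 h2 yab.
have {h1} := h1 yab; have {h2} := h2 yab.
set p2 := F2 s * _ * _; set p1 := F1 s * _ * _ => Qp2 Qp1.
have E : F1 s * (F2 s)^-1 = p1 * (F1 y * (F2 y)^-1) * p2^-1.
  by rewrite /p1 /p2 !invgM invgK !mulgA !mulgVK mulgK.
clearbody p1 p2; split=> -[q1 [q2 [Qq1 Qq2 e]]].
  exists (p1^-1 * q1), (q2 * p2); split; [exact/Q1M/Qq1/Q1V|exact/Q2M|].
  have -> : F1 y * (F2 y)^-1 = p1^-1 * (F1 s * (F2 s)^-1) * p2.
    by rewrite E !mulgA mulVg mul1g mulgVK.
  by rewrite e !mulgA.
exists (p1 * q1), (q2 * p2^-1); split; [exact/Q1M|exact/Q2M/Q2V|].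
by rewrite E e !mulgA.
Qed.

Variables (T U : topologicalType) (A : set T) (B : set U) (Phi : U * R -> T).
Hypothesis PhiA : forall z, B z.1 -> (0 <= z.2 <= 1)%R -> A (Phi z).
Hypothesis Phi_cont :
  cont_on [set z : U * R | B z.1 /\ (0 <= z.2 <= 1)%R] Phi.

(** [nu y] is the parallel transport of [c] along [s |-> Phi (y, s)], and the formula says that
    transport around a thin square is trivial. The second clause is used where the homotopy is
    stationary. *)
Lemma homotopy_locsys (c : T -> T -> G) : locsys A c ->
  exists nu : U -> G,
    (forall y, B y -> \forall y' \near y, B y' ->
       c (Phi (y, 1%R)) (Phi (y', 1%R)) =
       (nu y)^-1 * c (Phi (y, 0%R)) (Phi (y', 0%R)) * nu y') /\
    forall y, B y -> (forall s, (0 <= s <= 1)%R -> Phi (y, s) = Phi (y, 0%R)) ->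
      nu y = 1.
Proof.
move=> lc; pose D := [set z : U * R | B z.1 /\ (0 <= z.2 <= 1)%R].
pose C z z' := c (Phi z) (Phi z').
have lC : locsys D C by apply: (locsys_pull _ Phi_cont lc) => z [] /PhiA.
have slice y : B y -> cont_on (itv 0 1) (fun s : R => (y, s)).
  by move=> By s s01 W [[/= V W'] [/= /nbhs_singleton Vy hW'] sub];
    apply: filterS hW' => s' ? _; exact: sub.
have ex y : exists m, B y -> triv (itv 0 1) (fun s s' => C (y, s) (y, s')) m.
  have [By|nBy] := pselect (B y); last by exists (fun=> 1).
  have [||m hm] := @itv_triv 0%R 1%R (fun s s' => C (y, s) (y, s')) => //.
    by apply: (locsys_pull _ (slice y By) lC) => s s01; split.
  by exists m.
have [m hm] := choice ex; exists (fun y => (m y 0%R)^-1 * m y 1%R).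
(* A potential of the slice and a potential on a product neighbourhood differ by a left constant
   over a common segment. *)
have mconst y (M : U * R -> G) (s1 s2 : R) : B y -> (0 <= s1)%R -> (s1 <= s2)%R ->
    (s2 <= 1)%R ->
    (forall s, (s1 <= s <= s2)%R -> \forall z \near (y, s), D z ->
       C (y, s) z = (M (y, s))^-1 * M z) ->
    (m y s1)^-1 * m y s2 = (M (y, s1))^-1 * M (y, s2).
  move=> By s10 s12 s21 hM.
  have sub : itv s1 s2 `<=` itv 0 1.
    by move=> s /= /andP[h1 h2]; rewrite (le_trans s10 h1) (le_trans h2 s21).
  have [|q1 [q2 [-> ->]]] := @itv_red2 s1 s2 (fun s s' => C (y, s) (y, s'))
      _ _ _ (fun s => M (y, s)) s12 (@subgroup1 G) (@subgroup1 G)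
      (red_sub sub (hm y By)).
    apply: trivP => s ss; have := slice y By s (sub _ ss) _ (hM s ss).
    apply: filterS => s' h s's; apply: h; first exact: sub.
    by split => //; exact: sub.
  rewrite mul1g mulg1 => E.
  have -> : m y s2 = m y s1 * (M (y, s1))^-1 * M (y, s2).
    by rewrite -E mulgVK.
  by rewrite !mulgA mulVg mul1g.
split=> [y0 By0|y By cst]; last first.
  have [||q1 [q2 [-> ->]]] := @itv_red2 0%R 1%R (fun s s' => C (y, s) (y, s'))
      _ _ _ (fun=> 1) _ (@subgroup1 G) (@subgroup1 G) (hm y By) => //.
    apply: trivP => s s01; near=> s' => s'01.
    rewrite /C !cst// (locsys_refl lc) ?mulVg//.
    by apply: PhiA => //=; rewrite lexx ler01.
  by rewrite mul1g mulg1 invg1 !mulg1 => ->; rewrite mulVg.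
(* The square between heights 0 and [s] commutes near [y0]. The neighbourhood may shrink with [s],
   which is harmless because only its existence is propagated. *)
pose P s := \forall y \near y0, B y ->
  C (y0, s) (y, s) = (m y0 s)^-1 * m y0 0%R * C (y0, 0%R) (y, 0%R) *
    ((m y 0%R)^-1 * m y s).
suff /(_ 1%R) : forall s, (0 <= s <= 1)%R -> P s.
  rewrite ler01 lexx => /(_ isT); apply: filterS => y h By.
  by move: (h By); rewrite /C => ->; rewrite invgM invgK !mulgA.
apply: itv_locally_constant => //; last first.
  by rewrite /P; near=> y => By; rewrite mulVg mul1g mulVg mulg1.
move=> s s01; have [M] := lC (y0, s) (conj By0 s01).
move=> -[[/= V I] [/= hV /nbhs_ballP[/= e e0 hI]] sub].
have key s1 s2 : (0 <= s1 <= 1)%R -> (0 <= s2 <= 1)%R -> ball s e s1 ->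
    ball s e s2 -> P s1 -> P s2.
  move=> s101 s201 s1e s2e; rewrite /P.
  have ME y s' : B y -> V y -> (0 <= s' <= 1)%R -> ball s e s' ->
      \forall z \near (y, s'), D z -> C (y, s') z = (M (y, s'))^-1 * M z.
    by move=> By Vy s'01 s'e; apply: (sub (y, s')) => //; split => //; exact: hI.
  have Mslice s' : (0 <= s' <= 1)%R -> ball s e s' -> \forall y \near y0, B y ->
      C (y0, s') (y, s') = (M (y0, s'))^-1 * M (y, s').
    move=> s'01 s'e; have := ME y0 s' By0 (nbhs_singleton hV) s'01 s'e.
    move=> [[/= V' I'] [/= hV' /nbhs_singleton I's] sub'].
    by apply: filterS hV' => y V'y By; apply: sub' => //; split.
  have mM y : B y -> V y ->
      (m y s1)^-1 * m y s2 = (M (y, s1))^-1 * M (y, s2).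
    move=> By Vy; move: s101 s201 => /andP[s10 s11] /andP[s20 s21].
    have inball s3 s4 x : ball s e s3 -> ball s e s4 -> (s3 <= x <= s4)%R ->
        ball s e x.
      rewrite /ball /= !ltr_distlC => /andP[h1 h2] /andP[h3 h4] /andP[h5 h6].
      by rewrite (lt_le_trans h1 h5) (le_lt_trans h6 h4).
    have [s12|/ltW s21'] := leP s1 s2.
      apply: mconst => // x xs; apply: ME => //; last exact: inball xs.
      by case/andP: xs => h1 h2; rewrite (le_trans s10 h1) (le_trans h2 s21).
    apply: invg_inj; rewrite !invgM !invgK.
    apply: mconst => // x xs; apply: ME => //; last exact: inball xs.
    by case/andP: xs => h1 h2; rewrite (le_trans s20 h1) (le_trans h2 s11).
  move=> Ps1; near=> y => By.
  have Vy : V y by near: y.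
  have e1 := mM y By Vy; have e0' := mM y0 By0 (nbhs_singleton hV).
  have -> : C (y0, s2) (y, s2) = (M (y0, s2))^-1 * M (y, s2).
    by move: By; near: y; exact: Mslice.
  have Cs1 : C (y0, s1) (y, s1) = (M (y0, s1))^-1 * M (y, s1).
    by move: By; near: y; exact: Mslice.
  have {}Cs1 : (M (y0, s1))^-1 * M (y, s1) =
      (m y0 s1)^-1 * m y0 0%R * C (y0, 0%R) (y, 0%R) * ((m y 0%R)^-1 * m y s1).
    by rewrite -Cs1; move: By; near: y; exact: Ps1.
  have -> : M (y, s2) = M (y, s1) * ((m y s1)^-1 * m y s2).
    by rewrite e1 mulVKg.
  have -> : (M (y0, s2))^-1 = ((m y0 s2)^-1 * m y0 s1) * (M (y0, s1))^-1.
    by apply: invg_inj; rewrite !invgM !invgK e0' mulVKg.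
  rewrite mulgA -[X in X * _ = _]mulgA Cs1 !mulgA.
  by rewrite !mulgK.
near=> s' => s'01; have s'e : ball s e s' by near: s'; exact: nbhsx_ballx.
by split; apply: key => //; exact: ballxx.
Unshelve. all: by end_near. Qed.

End Homotopy.

(** * Continuity relative to a set *)

Section Continuity.
Variable R : realType.
Implicit Types T : topologicalType.

Lemma cont_onP T (U : topologicalType) (A : set T) (f : T -> U) :
  cont_on A f <-> (forall x, A x -> f y @[y --> within A (nbhs x)] --> f x).
Proof. by split=> h x Ax; [move=> W /(h x Ax) | move=> W /(h x Ax)]. Qed.

Lemma cont_on_comp T (U V : topologicalType) (A : set T) (B : set U)
    (f : T -> U) (g : U -> V) :
  (forall x, A x -> B (f x)) -> cont_on A f -> cont_on B g ->
  cont_on A (fun x => g (f x)).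
Proof.
move=> fAB cf cg x Ax W hW.
have /= := cf x Ax _ (cg _ (fAB _ Ax) W hW).
by apply: filterS => y h Ay; exact: h Ay (fAB _ Ay).
Qed.

Lemma continuous_cont_on T (U : topologicalType) (A : set T) (f : T -> U) :
  continuous f -> cont_on A f.
Proof.
move=> cf x Ax W hW; have h : nbhs x (f @^-1` W) by exact: cf x W hW.
by apply: filterS h => y.
Qed.

Lemma cont_on_cst T (U : topologicalType) (A : set T) (k : U) :
  cont_on A (fun=> k).
Proof. by apply: continuous_cont_on; exact: cst_continuous. Qed.

Lemma cont_on_pair T (U V : topologicalType) (A : set T) (f : T -> U)
    (g : T -> V) :
  cont_on A f -> cont_on A g -> cont_on A (fun x => (f x, g x)).
Proof.
move=> cf cg x Ax W [[/= W1 W2] [/= h1 h2] sub].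
apply: filterS2 (cf x Ax _ h1) (cg x Ax _ h2) => y a b Ay.
by apply: sub; split; [exact: a|exact: b].
Qed.

Lemma cont_on_eq T (U : topologicalType) (A : set T) (f g : T -> U) :
  (forall x, A x -> f x = g x) -> cont_on A f -> cont_on A g.
Proof.
move=> fg cf x Ax W; rewrite -fg// => hW.
by apply: filterS (cf x Ax W hW) => y h Ay; rewrite -fg//; exact: h.
Qed.

Section RealValued.
Variables (T : topologicalType) (A : set T).
Implicit Types f g : T -> R.

Lemma cont_onD f g : cont_on A f -> cont_on A g ->
  cont_on A (fun x => f x + g x).
Proof. by move=> /cont_onP cf /cont_onP cg; apply/cont_onP => x Ax; apply: cvgD; [exact: cf|exact: cg]. Qed.

Lemma cont_onN f : cont_on A f -> cont_on A (fun x => - f x).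
Proof. by move=> /cont_onP cf; apply/cont_onP => x Ax; apply: cvgN; exact: cf. Qed.

Lemma cont_onM f g : cont_on A f -> cont_on A g ->
  cont_on A (fun x => f x * g x).
Proof. by move=> /cont_onP cf /cont_onP cg; apply/cont_onP => x Ax; apply: cvgM; [exact: cf|exact: cg]. Qed.

Lemma cont_onV f : (forall x, A x -> f x != 0) -> cont_on A f ->
  cont_on A (fun x => (f x)^-1).
Proof. by move=> f0 /cont_onP cf; apply/cont_onP => x Ax; apply: cvgV; [exact: f0|exact: cf]. Qed.

Lemma cont_on_comp1 f (g : R -> R) : cont_on A f -> continuous g ->
  cont_on A (fun x => g (f x)).
Proof. by move=> cf cg; apply: (@cont_on_comp _ _ _ _ setT) => //; exact: continuous_cont_on. Qed.

Lemma cont_on_sqr f : cont_on A f -> cont_on A (fun x => f x ^+ 2).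
Proof. by move=> cf; apply: cont_onM. Qed.

(** For points where polar coordinates break down: the angle jumps there, but it is accompanied by a
    factor tending to 0. *)
Lemma cont_at_squeeze f g x : A x -> (forall y, A y -> `|f y| <= g y) ->
  cont_on A g -> g x = 0 ->
  forall W, nbhs (f x) W -> \forall y \near x, A y -> W (f y).
Proof.
move=> Ax fg /cont_onP /(_ x Ax) cg gx0 W.
have fx0 : f x = 0.
  by apply/eqP; rewrite -normr_le0 (le_trans (fg _ Ax))// gx0.
suff : f y @[y --> within A (nbhs x)] --> f x by move=> /[apply].
rewrite fx0; apply/norm_cvg0P.
apply: (@squeeze_cvgr _ _ _ _ (fun=> 0) g _ _ 0).
- by rewrite near_withinE; apply: nearW => y Ay; rewrite normr_ge0 fg.
- exact: cvg_cst.
- by rewrite -gx0.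
Unshelve. all: by end_near. Qed.

Lemma near_gt f x (k : R) : cont_on A f -> A x -> k < f x ->
  \forall y \near x, A y -> k < f y.
Proof. by move=> cf Ax kf; apply: (cf x Ax [set z | k < z]); exact: lt_nbhsr. Qed.

Lemma near_lt f x (k : R) : cont_on A f -> A x -> f x < k ->
  \forall y \near x, A y -> f y < k.
Proof. by move=> cf Ax kf; apply: (cf x Ax [set z | z < k]); exact: lt_nbhsl. Qed.

End RealValued.

(** A decreasing surjection between segments is continuous, also at the end points, where [acos] has
    no derivative. *)
Lemma acos_cont : cont_on [set x : R | -1 <= x <= 1] acos.
Proof.
have : {within `[(-1)%R, 1%R], continuous (@acos R)}.
  apply: segment_dec_surj_continuous.
    move=> x y xI yI.
    have aI (z : R) : z \in `[(-1)%R, 1%R] -> acos z \in `[0, pi].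
      by rewrite !in_itv /= => zI; rewrite acos_ge0 ?acos_lepi.
    by rewrite !leNgt -(ltr_cos (aI _ yI) (aI _ xI)) !acosK.
  move=> y /=; rewrite acos1 acosN1 in_itv /= => y0pi.
  exists (cos y); first by rewrite in_itv /= cos_geN1 cos_le1.
  by apply: cosK; rewrite in_itv.
move=> /subspace_continuousP h x xI W hW.
have xI' : `[(-1)%R, 1%R]%classic x by rewrite /= in_itv.
have hh : nbhs x (fun y => `[(-1)%R, 1%R]%classic y -> W (acos y)).
  exact: h x xI' W hW.
apply: filterS hh => y k yI.
by apply: k; rewrite /= in_itv.
Qed.

End Continuity.

(** * Coordinates on the 3-sphere *)

Section Coordinates.
Variable R : realType.
Local Notation V4 := 'rV[R]_4.

Definition cx (v : V4) : R := v 0 0.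
Definition cy (v : V4) : R := v 0 1.
Definition cw (v : V4) : R := v 0 2.
Definition ch (v : V4) : R := v 0 3.

Lemma cxE x y w h : cx (vec4 x y w h) = x. Proof. by rewrite /cx mxE. Qed.
Lemma cyE x y w h : cy (vec4 x y w h) = y. Proof. by rewrite /cy mxE. Qed.
Lemma cwE x y w h : cw (vec4 x y w h) = w. Proof. by rewrite /cw mxE. Qed.
Lemma chE x y w h : ch (vec4 x y w h) = h. Proof. by rewrite /ch mxE. Qed.
Definition cE := (cxE, cyE, cwE, chE).

Lemma vec4K (v : V4) : vec4 (cx v) (cy v) (cw v) (ch v) = v.
Proof.
apply/rowP => i; rewrite !mxE /cx /cy /cw /ch.
by case: i => [[|[|[|[|//]]]] Hi] /=; congr (v _ _); exact/val_inj.
Qed.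

Lemma vec4P (u v : V4) : cx u = cx v -> cy u = cy v -> cw u = cw v ->
  ch u = ch v -> u = v.
Proof. by move=> e1 e2 e3 e4; rewrite -(vec4K u) e1 e2 e3 e4 vec4K. Qed.

Lemma S3E (v : V4) :
  @S3 R v <-> cx v ^+ 2 + cy v ^+ 2 + cw v ^+ 2 + ch v ^+ 2 = 1.
Proof. by rewrite -{1}(vec4K v) vec4_S3. Qed.

Lemma flipE (v : V4) : flip v = vec4 (cy v) (cx v) (- cw v) (ch v).
Proof. by []. Qed.

Lemma flipK : involutive (@flip R).
Proof. by move=> v; rewrite -(vec4K v) !flip_vec4 opprK. Qed.

Lemma flip_S3 (v : V4) : @S3 R v -> @S3 R (flip v).
Proof. by rewrite flipE vec4_S3 S3E sqrrN [_ + cx v ^+ 2]addrC. Qed.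

Lemma cx_cont : continuous cx. Proof. exact: coord_continuous. Qed.
Lemma cy_cont : continuous cy. Proof. exact: coord_continuous. Qed.
Lemma cw_cont : continuous cw. Proof. exact: coord_continuous. Qed.
Lemma ch_cont : continuous ch. Proof. exact: coord_continuous. Qed.

Lemma cont_on_vec4 (T : topologicalType) (A : set T) (f1 f2 f3 f4 : T -> R) :
  cont_on A f1 -> cont_on A f2 -> cont_on A f3 -> cont_on A f4 ->
  cont_on A (fun x => vec4 (f1 x) (f2 x) (f3 x) (f4 x)).
Proof.
move=> c1 c2 c3 c4 x Ax W [P hP sub].
have h i : nbhs (vec4 (f1 x) (f2 x) (f3 x) (f4 x) 0 i) (P 0 i) by exact: hP.
have := h (Ordinal (isT : (0 < 4)%N)); have := h (Ordinal (isT : (1 < 4)%N)).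
have := h (Ordinal (isT : (2 < 4)%N)); have := h (Ordinal (isT : (3 < 4)%N)).
rewrite !mxE /= => h4 h3 h2 h1.
near=> y => Ay; apply: sub => i j; rewrite mxE (ord1 i).
case: j => [[|[|[|[|//]]]] Hj] /=.
- have -> : Ordinal Hj = Ordinal (isT : (0 < 4)%N) by exact/val_inj.
  by move: Ay; near: y; exact: c1.
- have -> : Ordinal Hj = Ordinal (isT : (1 < 4)%N) by exact/val_inj.
  by move: Ay; near: y; exact: c2.
- have -> : Ordinal Hj = Ordinal (isT : (2 < 4)%N) by exact/val_inj.
  by move: Ay; near: y; exact: c3.
- have -> : Ordinal Hj = Ordinal (isT : (3 < 4)%N) by exact/val_inj.
  by move: Ay; near: y; exact: c4.
Unshelve. all: by end_near. Qed.

Lemma flip_cont (A : set V4) : cont_on A (@flip R).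
Proof.
apply: (@cont_on_eq _ _ _ (fun v => vec4 (cy v) (cx v) (- cw v) (ch v))) => //.
by apply: cont_on_vec4; [| |apply: cont_onN|]; apply: continuous_cont_on;
  [exact: cy_cont|exact: cx_cont|exact: cw_cont|exact: ch_cont].
Qed.

End Coordinates.

(** * Untwisting *)

Lemma cont_on_continuous (T U : topologicalType) (f : T -> U) :
  cont_on setT f -> continuous f.
Proof.
move=> cf x W hW; have h : nbhs x (f @^-1` W).
  by apply: filterS (cf x I W hW) => y; exact.
exact: h.
Qed.

Section Polar.
Variable R : realType.
Local Notation V4 := 'rV[R]_4.
Implicit Types v : V4.

(** Polar coordinates in the (y, w) plane: for w <= 0 a point is (x, r cos t, - r sin t, h), so the
    page of angle t meets the edge at its parameter t. *)
Definition rad v : R := Num.sqrt (cy v ^+ 2 + cw v ^+ 2).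
Definition ang v : R := acos (cy v / rad v).

Lemma rad_ge0 v : 0 <= rad v. Proof. exact: sqrtr_ge0. Qed.

Lemma rad2 v : rad v ^+ 2 = cy v ^+ 2 + cw v ^+ 2.
Proof. by rewrite sqr_sqrtr// addr_ge0// sqr_ge0. Qed.

Lemma S3_rad v : @S3 R v -> cx v ^+ 2 + ch v ^+ 2 = 1 - rad v ^+ 2.
Proof. by move=> /S3E <-; rewrite rad2; ring. Qed.

Lemma cyrad_bound v : -1 <= cy v / rad v <= 1.
Proof.
rewrite -ler_norml normrM normfV (ger0_norm (rad_ge0 v)).
have [->|r0] := eqVneq (rad v) 0; first by rewrite invr0 mulr0.
rewrite ler_pdivrMr ?lt_neqAle 1?eq_sym ?r0 ?rad_ge0// mul1r.
by rewrite -sqrtr_sqr ler_wsqrtr// lerDl sqr_ge0.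
Qed.

Lemma ang_bound v : 0 <= ang v <= pi.
Proof. by rewrite acos_ge0 ?acos_lepi// cyrad_bound. Qed.

Lemma cy_polar v : cy v = rad v * cos (ang v).
Proof.
rewrite acosK ?in_itv/= ?cyrad_bound//.
have [r0|r0] := eqVneq (rad v) 0; last by rewrite mulrCA divff// mulr1.
rewrite r0 mul0r; have := rad2 v; rewrite r0 expr0n /=.
by move/esym/eqP; rewrite paddr_eq0 ?sqr_ge0// => /andP[/eqP/eqP]; rewrite sqrf_eq0 => /eqP.
Qed.

Lemma cw_polar v : cw v <= 0 -> cw v = - (rad v * sin (ang v)).
Proof.
move=> w0; have s0 : 0 <= sin (ang v) by apply: sin_ge0_pi; exact: ang_bound.
apply: oppr_inj; rewrite opprK; apply/eqP.
rewrite -(@eqrXn2 _ 2)// ?oppr_ge0// ?mulr_ge0 ?rad_ge0//.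
rewrite sqrrN exprMn sin2cos2 mulrBr mulr1 -exprMn -cy_polar rad2.
by rewrite addrAC subrr add0r.
Qed.

Lemma polar_uniq v (r t : R) : 0 < r -> 0 <= t <= pi ->
  cy v = r * cos t -> cw v = - (r * sin t) -> rad v = r /\ ang v = t.
Proof.
move=> r0 tpi ey ew.
have er : rad v = r.
  rewrite /rad ey ew sqrrN !exprMn -mulrDr cos2Dsin2 mulr1 sqrtr_sqr.
  by rewrite ger0_norm// ltW.
split=> //; rewrite /ang er ey mulrAC divff ?gt_eqF// mul1r.
by rewrite cosK// in_itv.
Qed.

Lemma rad_cont : continuous rad.
Proof.
apply: cont_on_continuous; apply: cont_on_comp1; last exact: sqrt_continuous.
by apply: cont_onD; apply: cont_on_sqr; apply: continuous_cont_on;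
  [exact: cy_cont|exact: cw_cont].
Qed.

Lemma ang_cont : cont_on [set v | rad v != 0] ang.
Proof.
apply: (@cont_on_comp _ _ _ _ [set x : R | -1 <= x <= 1]
  (fun v => cy v / rad v)).
- by move=> v _; exact: cyrad_bound.
- apply: cont_onM; first exact/continuous_cont_on/cy_cont.
  by apply: cont_onV => //; exact/continuous_cont_on/rad_cont.
- exact: acos_cont.
Qed.

(* Cuts the untwisting off at rad = 0, where ang is the junk value acos (0 / 0). *)
Definition chi (r : R) : R := Num.min 1 (2 * r).
Definition twa v : R := ang v * chi (rad v).

Lemma chi_cont : continuous chi.
Proof.
move=> x; apply: (@continuous_min R R (fun=> 1) (fun r => 2 * r)).
  exact: cst_continuous.
exact: mulrl_continuous.
Qed.

Lemma chi0 : chi 0 = 0. Proof. by rewrite /chi mulr0 minElt ltr10. Qed.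

Lemma chi1 r : 2^-1 <= r -> chi r = 1.
Proof. by move=> r2; rewrite /chi; apply: min_l; rewrite mulrC -ler_pdivrMr// div1r. Qed.

Lemma chi_bound r : 0 <= r -> 0 <= chi r <= 2 * r.
Proof.
by move=> r0; rewrite /chi le_min ler01 mulr_ge0//= ge_min lexx orbT.
Qed.

Lemma twa_cont : cont_on setT twa.
Proof.
move=> v _; have [r0|r0] := eqVneq (rad v) 0.
  apply: (@cont_at_squeeze _ _ setT twa (fun v => pi * (2 * rad v))) => //.
  - move=> y _; rewrite normrM ler_pM//.
      by have /andP[h1 h2] := ang_bound y; rewrite ger0_norm.
    by have /andP[h1 h2] := chi_bound (rad_ge0 y); rewrite ger0_norm.
  - apply: cont_onM; first exact: cont_on_cst.
    by apply: cont_onM; [exact: cont_on_cst|exact/continuous_cont_on/rad_cont].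
  - by rewrite r0 !mulr0.
move=> W hW.
have c : cont_on [set v | rad v != 0] twa.
  apply: cont_onM; first exact: ang_cont.
  apply: cont_on_comp1; last exact: chi_cont.
  exact/continuous_cont_on/rad_cont.
have o : \forall y \near v, rad y != 0.
  have := @near_gt _ _ setT rad v 0 (continuous_cont_on (A := setT) rad_cont) I.
  rewrite lt_neqAle eq_sym r0 rad_ge0 => /(_ isT).
  by apply: filterS => y /(_ I); rewrite lt_neqAle eq_sym => /andP[].
by apply: filterS2 (c v r0 W hW) o => y h1 h2 _; exact: h1.
Qed.

(* Slides the page of angle ang towards the page of angle 0 while undoing the
   corresponding part of the n half twists. *)
Definition Phi (n : nat) (z : V4 * R) : V4 :=
  let v := z.1 in let th := n%:R * ((1 - z.2) * twa v) in
  vec4 (cx v * cos th - ch v * sin th) (rad v * cos (z.2 * ang v))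
    (- (rad v * sin (z.2 * ang v))) (cx v * sin th + ch v * cos th).

Lemma Phi_cont (n : nat) (A : set (V4 * R)) : cont_on A (Phi n).
Proof.
have c1 (f : V4 -> R) : cont_on setT f -> cont_on A (fun z => f z.1).
  move=> cf; apply: (@cont_on_comp _ _ _ _ setT) => //.
  by apply: continuous_cont_on => z; exact: cvg_fst.
have c2 : cont_on A (fun z : V4 * R => z.2).
  by apply: continuous_cont_on => z; exact: cvg_snd.
have cth : cont_on A (fun z : V4 * R => n%:R * ((1 - z.2) * twa z.1)).
  apply: cont_onM; first exact: cont_on_cst.
  apply: cont_onM; last exact/c1/twa_cont.
  by apply: cont_onD; [exact: cont_on_cst|exact: cont_onN].
have cX : cont_on A (fun z => cx z.1) by apply: c1; exact/continuous_cont_on/cx_cont.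
have cH : cont_on A (fun z => ch z.1) by apply: c1; exact/continuous_cont_on/ch_cont.
have crad : cont_on A (fun z => rad z.1) by apply: c1; exact/continuous_cont_on/rad_cont.
(* The factor [rad] absorbs the discontinuity of [ang] at [rad = 0]. *)
have trig (f : R -> R) : continuous f -> (forall x, `|f x| <= 1) ->
    cont_on A (fun z => rad z.1 * f (z.2 * ang z.1)).
  move=> fc fb z Az; have [r0|r0] := eqVneq (rad z.1) 0.
    apply: (@cont_at_squeeze _ _ A _ (fun z => rad z.1)) => //.
    move=> y _; rewrite normrM (ger0_norm (rad_ge0 _)).
    by rewrite -[leRHS]mulr1 ler_wpM2l// rad_ge0.
  move=> W hW.
  have c : cont_on [set z : V4 * R | rad z.1 != 0]
      (fun z => rad z.1 * f (z.2 * ang z.1)).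
    apply: cont_onM.
      apply: (@cont_on_comp _ _ _ _ setT) => //.
        by apply: continuous_cont_on => y; exact: cvg_fst.
      exact/continuous_cont_on/rad_cont.
    apply: cont_on_comp1 => //; apply: cont_onM.
      by apply: continuous_cont_on => y; exact: cvg_snd.
    apply: (cont_on_comp _ _ ang_cont) => //.
    by apply: continuous_cont_on => y; exact: cvg_fst.
  have o : \forall y \near z, A y -> rad y.1 != 0.
    have := near_gt crad Az (k := 0).
    rewrite lt_neqAle eq_sym r0 rad_ge0 => /(_ isT).
    by apply: filterS => y + Ay => /(_ Ay); rewrite lt_neqAle eq_sym => /andP[].
  by apply: filterS2 (c z r0 W hW) o => y h1 h2 Ay; apply: h1; exact: h2.
have cc := @continuous_cos R; have cs := @continuous_sin R.
have cb (x : R) : `|cos x| <= 1 by rewrite ler_norml cos_geN1 cos_le1.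
have sb (x : R) : `|sin x| <= 1 by rewrite ler_norml sin_geN1 sin_le1.
apply: cont_on_vec4.
- apply: cont_onD; first by apply: cont_onM => //; exact: cont_on_comp1.
  by apply: cont_onN; apply: cont_onM => //; exact: cont_on_comp1.
- exact: trig.
- by apply: cont_onN; exact: trig.
- by apply: cont_onD; apply: cont_onM => //; exact: cont_on_comp1.
Qed.

End Polar.

(** * The knot and the pieces of its complement in polar coordinates *)

Section Sets.
Variable R : realType.
Local Notation V4 := 'rV[R]_4.
Implicit Types v : V4.

Lemma cos_sin_npi (n : nat) : ~~ odd n ->
  cos (n%:R * pi) = 1 :> R /\ sin (n%:R * pi) = 0 :> R.
Proof.
move=> en; have -> : n = (n./2).*2 by rewrite -{1}(odd_double_half n) (negPf en).
elim: (n./2) => [|k [c s]]; first by rewrite mul0r cos0 sin0.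
rewrite doubleS -addn2 natrD mulrDl cosD sinD c s.
have -> : 2%:R * pi = pi *+ 2 :> R by rewrite mulr_natl.
by rewrite cos2pi sin2pi; split; ring.
Qed.

(* The strands of a twist region in polar coordinates around its edge. *)
Definition core (n : nat) v : Prop := rad v ^+ 2 = 2^-1 /\
  cx v * sin (n%:R * ang v) + ch v * cos (n%:R * ang v) = 0.

Local Notation a := ((Num.sqrt 2)^-1 : R).

Lemma sqr_a : a ^+ 2 = 2^-1. Proof. by rewrite exprVn sqr_sqrtr. Qed.
Lemma a_gt0 : 0 < a. Proof. by rewrite invr_gt0 sqrtr_gt0. Qed.

Lemma strandE (n : nat) (s t : R) : strand n s t =
  vec4 (a * - (s * cos (n%:R * t))) (a * cos t) (- (a * sin t))
    (a * (s * sin (n%:R * t))).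
Proof. by rewrite /strand -pmulrn [_ * - sin t]mulrN. Qed.

Lemma strand_core (n : nat) (s t : R) : 0 <= t <= pi ->
  core n (strand n s t) /\ cw (strand n s t) <= 0.
Proof.
move=> tpi; rewrite strandE.
have [] := @polar_uniq R (vec4 (a * - (s * cos (n%:R * t))) (a * cos t)
  (- (a * sin t)) (a * (s * sin (n%:R * t)))) a t a_gt0 tpi.
- by rewrite cyE. - by rewrite cwE.
move=> er et; split; first split.
- by rewrite er sqr_a.
- by rewrite et !cE; ring.
by rewrite cwE oppr_le0 mulr_ge0 ?(ltW a_gt0)// sin_ge0_pi.
Qed.

(** Rotating (x, h) back by the angle [n * ang v] turns the second equation of [core] into h = 0;
    the norm then leaves two values of x, one for each strand. *)
Lemma twist_regionP (n : nat) v : @S3 R v -> cw v <= 0 ->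
  twist_region n v <-> core n v.
Proof.
move=> Sv w0; split.
  by move=> [] [t /=]; rewrite in_itv /= => tpi <-; exact: (strand_core n _ tpi).1.
move=> [r2 e].
set c := cos (n%:R * ang v) in e; set s := sin (n%:R * ang v) in e.
have cs : c ^+ 2 + s ^+ 2 = 1 by exact: cos2Dsin2.
have er : rad v = a.
  by apply/eqP; rewrite -(@eqrXn2 _ 2)// ?rad_ge0 ?(ltW a_gt0)// r2 sqr_a.
(* The x-coordinate after untwisting; its sign selects the strand. *)
pose x' := cx v * c - ch v * s.
have ex : cx v = x' * c.
  rewrite /x'; apply/eqP; rewrite -subr_eq0.
  have -> : cx v - (cx v * c - ch v * s) * c =
     cx v * (1 - (c ^+ 2 + s ^+ 2)) + s * (cx v * s + ch v * c) by ring.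
  by rewrite e cs subrr !mulr0 addr0.
have eh : ch v = - (x' * s).
  rewrite /x'; apply/eqP; rewrite -subr_eq0.
  have -> : ch v - - ((cx v * c - ch v * s) * s) =
     ch v * (1 - (c ^+ 2 + s ^+ 2)) + c * (cx v * s + ch v * c) by ring.
  by rewrite e cs subrr !mulr0 addr0.
have x'2 : x' ^+ 2 = a ^+ 2.
  have := S3_rad Sv; rewrite r2 ex eh sqrrN !exprMn -mulrDr cs mulr1 => ->.
  by rewrite sqr_a; field.
have mem : `[0, pi]%classic (ang v) by rewrite /= in_itv /= ang_bound.
move/eqP: x'2; rewrite eqf_sqr => /orP[] /eqP x'E.
  right; exists (ang v) => //; rewrite strandE.
  apply: vec4P; rewrite !cE.
  - by rewrite ex x'E -/c; ring.
  - by rewrite -er cy_polar.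
  - by rewrite -er cw_polar.
  - by rewrite eh x'E -/s; ring.
left; exists (ang v) => //; rewrite strandE.
apply: vec4P; rewrite !cE.
- by rewrite ex x'E -/c; ring.
- by rewrite -er cy_polar.
- by rewrite -er cw_polar.
- by rewrite eh x'E -/s; ring.
Qed.

Lemma twist_region_cw (n : nat) v : twist_region n v -> cw v <= 0.
Proof.
by move=> [] [t /=]; rewrite in_itv /= => tpi <-; exact: (strand_core n _ tpi).2.
Qed.

Lemma flip_image (A : set V4) v : (@flip R @` A) v <-> A (flip v).
Proof.
by split=> [[u Au <-]|Av]; [rewrite flipK|exists (flip v); rewrite ?flipK].
Qed.

Lemma double_twist_flip (p q : int) v :
  double_twist R p q (flip v) <-> double_twist R q p v.
Proof.
have E p' q' u : double_twist R p' q' u <->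
    twist_region p' u \/ twist_region q' (flip u).
  by split=> [[|/flip_image]|[|/flip_image]]; by [left|right].
by rewrite !E flipK; split=> -[]; by [left|right].
Qed.

(** On w = 0 the angle is 0 or pi, and an even number of half twists rotates trivially there; hence
    the four end points do not depend on [n]. *)
Lemma core_eq (n : nat) v : ~~ odd n -> @S3 R v -> cw v = 0 ->
  core n v <-> ch v = 0 /\ cx v ^+ 2 = cy v ^+ 2.
Proof.
move=> en Sv w0; have := S3E v => -[/(_ Sv)]; rewrite w0 expr0n addr0 => S1 _.
have r2 : rad v ^+ 2 = cy v ^+ 2 by rewrite rad2 w0 expr0n addr0.
have key : rad v ^+ 2 = 2^-1 ->
    cx v * sin (n%:R * ang v) + ch v * cos (n%:R * ang v) = ch v.
  move=> rE; have ra : rad v != 0.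
    by apply: contra_eq_neq rE => ->; rewrite expr0n eq_sym invr_eq0 pnatr_eq0.
  have s0 : sin (ang v) = 0.
    apply/eqP; have := cw_polar (v := v); rewrite w0 => /(_ (lexx _))/esym/eqP.
    by rewrite oppr_eq0 mulf_eq0 (negPf ra).
  have c1 : cos (ang v) ^+ 2 = 1.
    by rewrite -(cos2Dsin2 (ang v)) s0 expr0n addr0.
  have [-> ->] : cos (n%:R * ang v) = 1 /\ sin (n%:R * ang v) = 0.
    have [e|e] : ang v = 0 \/ ang v = pi.
      move/eqP: c1; rewrite sqrf_eq1 => /orP[] /eqP c1; [left|right].
        by rewrite -[LHS](@cosK R) ?in_itv /= ?ang_bound// c1 acos1.
      by rewrite -[LHS](@cosK R) ?in_itv /= ?ang_bound// c1 acosN1.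
    by rewrite e mulr0 cos0 sin0.
    by rewrite e; exact: cos_sin_npi.
  by rewrite mulr0 add0r mulr1.
split=> [[rE]|[h0 xy]].
  rewrite (key rE) => h0; split=> //; move: S1 r2; rewrite rE h0 expr0n /=.
  by lra.
have rE : rad v ^+ 2 = 2^-1.
  by rewrite r2; move: S1; rewrite xy h0 expr0n /=; lra.
by split=> //; rewrite key.
Qed.

Section Knot.
Variables (n k : nat).
Hypotheses (en : ~~ odd n) (ek : ~~ odd k).

Definition knot_compl : set V4 := @S3 R `\` double_twist R n k.

Definition lower : set V4 := [set v | [/\ @S3 R v, cw v <= 0 & ~ core n v]].

Definition sphere4 : set V4 :=
  [set v | [/\ @S3 R v, cw v = 0 & ~ (ch v = 0 /\ cx v ^+ 2 = cy v ^+ 2)]].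

(** The outside region meets w <= 0 only in w = 0, where both regions have the same four points. *)
Lemma double_twist_lower v : @S3 R v -> cw v <= 0 ->
  double_twist R n k v <-> core n v.
Proof.
move=> Sv w0; rewrite -twist_regionP//; split=> [|h]; last by left.
move=> [//|/flip_image tf].
have := twist_region_cw tf; rewrite flipE cwE oppr_le0 => w0'.
have w00 : cw v = 0 by apply/eqP; rewrite eq_le w0 w0'.
move: tf; rewrite !twist_regionP//.
- rewrite !core_eq//; last by rewrite flipE cwE w00 oppr0.
    by rewrite flipE !cE => -[-> ->].
  exact: flip_S3.
- exact: flip_S3.
- by rewrite flipE cwE w00 oppr0.
Qed.

Lemma lowerP v : cw v <= 0 -> knot_compl v <-> lower v.
Proof.
move=> w0; split=> [[Sv nK]|[Sv _ nc]].
  by split=> // c; apply: nK; apply/double_twist_lower.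
by split=> // /(double_twist_lower Sv w0).
Qed.

Lemma sphere4_lower : sphere4 `<=` lower.
Proof.
move=> v [Sv w0 h]; split=> //; first by rewrite w0.
by rewrite core_eq.
Qed.

Lemma lower_sphere4 v : lower v -> cw v = 0 -> sphere4 v.
Proof. by move=> [Sv _ h] w0; split=> // /(core_eq en Sv w0). Qed.

End Knot.

Lemma sphere4_flip v : sphere4 v -> sphere4 (flip v).
Proof.
move=> [Sv w0 h]; split; first exact: flip_S3.
  by rewrite flipE cwE w0 oppr0.
by rewrite flipE !cE => -[h0 xy]; apply: h.
Qed.

Lemma knot_compl_flip n k v : knot_compl n k v -> knot_compl k n (flip v).
Proof. by move=> [Sv nK]; split; [exact: flip_S3|rewrite double_twist_flip]. Qed.

(** * Retraction of the inside piece onto the page of angle 0 *)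

Section Retraction.
Variable n : nat.
Hypothesis en : ~~ odd n.

Definition ret v : V4 := Phi n (v, 0).

Lemma retE v : let th := n%:R * twa v in
  ret v = vec4 (cx v * cos th - ch v * sin th) (rad v) 0
    (cx v * sin th + ch v * cos th).
Proof.
by rewrite /ret /Phi /= subr0 mul1r mul0r cos0 sin0 mulr1 mulr0 oppr0.
Qed.

Lemma Phi1 v : cw v <= 0 -> Phi n (v, 1) = v.
Proof.
move=> w0; rewrite /Phi /= subrr mul0r mulr0 cos0 sin0 mul1r.
by rewrite -cy_polar -cw_polar// !mulr0 !mulr1 subr0 add0r vec4K.
Qed.

Lemma rot_sqr (x h c s : R) : c ^+ 2 + s ^+ 2 = 1 ->
  (x * c - h * s) ^+ 2 + (x * s + h * c) ^+ 2 = x ^+ 2 + h ^+ 2.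
Proof.
move=> cs; transitivity ((x ^+ 2 + h ^+ 2) * (c ^+ 2 + s ^+ 2)); first by ring.
by rewrite cs mulr1.
Qed.

Lemma Phi_S3 v s : @S3 R v -> @S3 R (Phi n (v, s)).
Proof.
move=> Sv; apply/S3E; rewrite /Phi /= !cE.
set th := n%:R * _; set t := s * _.
have e1 := rot_sqr (cx v) (ch v) (cos2Dsin2 th).
have e2 : (rad v * cos t) ^+ 2 + (- (rad v * sin t)) ^+ 2 = rad v ^+ 2.
  by rewrite sqrrN !exprMn -mulrDr cos2Dsin2 mulr1.
rewrite (S3_rad Sv) in e1; rewrite -[RHS](subrK (rad v ^+ 2)) -e1 -[in RHS]e2.
by ring.
Qed.

Lemma Phi_polar v s : 0 <= s <= 1 -> rad v != 0 ->
  rad (Phi n (v, s)) = rad v /\ ang (Phi n (v, s)) = s * ang v.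
Proof.
move=> /andP[s0 s1] r0; apply: polar_uniq.
- by rewrite lt_neqAle eq_sym r0 rad_ge0.
- have /andP[t0 t1] := ang_bound v; rewrite mulr_ge0//=.
  by apply: le_trans t1; rewrite -[leRHS]mul1r ler_wpM2r.
- by rewrite /Phi /= cyE.
- by rewrite /Phi /= cwE.
Qed.

(** On the strands [rad] exceeds 1/2, so the cut-off is 1 and the rotation matches the change of
    page: the [core] equation at time [s] is the one at the start. *)
Lemma Phi_lower v s : lower n v -> 0 <= s <= 1 -> lower n (Phi n (v, s)).
Proof.
move=> [Sv w0 nc] s01; split; first exact: Phi_S3.
  rewrite /Phi /= cwE oppr_le0 mulr_ge0 ?rad_ge0// sin_ge0_pi//.
  have /andP[t0 t1] := ang_bound v; case/andP: s01 => s0 s1; rewrite mulr_ge0//=.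
  by apply: le_trans t1; rewrite -[leRHS]mul1r ler_wpM2r.
have [r0|r0] := eqVneq (rad v) 0.
  move=> [+ _]; have -> : rad (Phi n (v, s)) = 0.
    apply/eqP; rewrite -sqrf_eq0 rad2 /Phi /= cyE cwE r0 !mul0r oppr0.
    by rewrite !expr0n /= addr0.
  by move/eqP; rewrite expr0n eq_sym invr_eq0 pnatr_eq0.
have [er et] := Phi_polar s01 r0; rewrite /core er et => -[r2]; apply: contra_not nc => e.
have c1 : twa v = ang v.
  rewrite /twa chi1 ?mulr1//.
  rewrite -(@ler_pXn2r _ 2) ?nnegrE ?rad_ge0 ?invr_ge0// r2 expr2.
  by rewrite -[leRHS]mulr1 ler_wpM2l ?invr_ge0// invf_le1// ler1n.
split=> //; move: e; rewrite /Phi /= !cE c1.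
set t1 := n%:R * ((1 - s) * _); set t2 := n%:R * (s * _).
have -> : n%:R * ang v = t1 + t2 by rewrite /t1 /t2; ring.
by rewrite sinD cosD => <-; ring.
Qed.

Lemma ret_sphere4 v : lower n v -> sphere4 (ret v) /\ 0 <= cy (ret v).
Proof.
move=> lv; have l0 : lower n (ret v) by apply: Phi_lower; rewrite ?lexx ?ler01.
by split; [apply: (lower_sphere4 en l0)|]; rewrite retE cE ?rad_ge0.
Qed.

Lemma Phi_fix v s : cw v = 0 -> 0 <= cy v \/ rad v = 0 -> 0 <= s <= 1 ->
  Phi n (v, s) = v.
Proof.
move=> w0 yr s01.
have rE : rad v = `|cy v| by rewrite /rad w0 expr0n addr0 sqrtr_sqr.
have [t0 e2] : twa v = 0 /\ rad v * cos (s * ang v) = cy v /\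
    rad v * sin (s * ang v) = 0.
  have [r0|r0] := eqVneq (rad v) 0.
    rewrite /twa r0 chi0 mulr0 !mul0r; split=> //; split=> //.
    by move/eqP: r0; rewrite rE normr_eq0 => /eqP.
  case: yr => [y0|/eqP]; last by rewrite (negPf r0).
  have -> : rad v = cy v by rewrite rE ger0_norm.
  have a0 : ang v = 0.
    rewrite /ang rE ger0_norm// divff ?acos1//.
    by move: r0; rewrite rE normr_eq0.
  by rewrite /twa a0 mul0r mulr0 cos0 sin0 mulr1 mulr0.
case: e2 => e2 e3; rewrite /Phi /= t0 !mulr0 cos0 sin0 !mulr1 !mulr0 e2 e3.
by rewrite subr0 add0r oppr0 -w0 vec4K.
Qed.

Lemma ret_fix v : cw v = 0 -> 0 <= cy v \/ rad v = 0 -> ret v = v.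
Proof. by move=> w0 yr; apply: Phi_fix; rewrite ?lexx ?ler01. Qed.

(** For y <= -1/2 the cut-off is 1 and the angle is pi, so (x, h) is rotated by n pi, that is, not
    at all, and [ret] reflects y. The twisting is concentrated in -1/2 < y < 0. *)
Lemma ret_far v : cw v = 0 -> cy v <= - 2^-1 ->
  ret v = vec4 (cx v) (- cy v) 0 (ch v).
Proof.
move=> w0 y0; have yn : cy v < 0.
  by apply: le_lt_trans y0 _; rewrite oppr_lt0 invr_gt0.
have rE : rad v = - cy v by rewrite /rad w0 expr0n addr0 sqrtr_sqr ltr0_norm.
have tE : twa v = pi.
  rewrite /twa chi1 ?mulr1; last by rewrite rE lerNr.
  by rewrite /ang rE invrN mulrN divff ?lt_eqF// acosN1.
have [c1 s0] := cos_sin_npi en.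
by rewrite retE tE c1 s0 rE; congr vec4; ring.
Qed.

Lemma ret_cont (A : set V4) : cont_on A ret.
Proof.
apply: (@cont_on_comp _ _ _ _ setT (fun v => (v, 0 : R)) (Phi n)) => //.
  by apply: cont_on_pair; [apply: continuous_cont_on => x; exact: cvg_id|exact: cont_on_cst].
exact: Phi_cont.
Qed.

End Retraction.

End Sets.

(** * Charts on the four-punctured sphere *)

Section Charts.
Variables (R : realType) (G : groupType).
Local Notation V4 := 'rV[R]_4.
Local Notation itv a b := [set s : R | a <= s <= b].
Implicit Types (v : V4) (c : V4 -> V4 -> G).

Lemma itv_triv2 (a b : R) (C : R -> R -> G) m1 m2 : a <= b ->
  triv (itv a b) C m1 -> triv (itv a b) C m2 ->
  (m1 b * (m2 b)^-1 = m1 a * (m2 a)^-1)%g.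
Proof.
move=> ab t1 t2.
have [q1 [q2 [-> ->]]] := itv_red2 ab (@subgroup1 G) (@subgroup1 G) t1 t2.
by rewrite mul1g mulg1.
Qed.

Definition half (e : R) : set V4 := [set v | sphere4 v /\ 0 <= e * ch v].

Definition pole (e : R) : V4 := vec4 0 0 0 e.

Definition contr (e : R) (z : V4 * R) : V4 :=
  vec4 (z.2 * cx z.1) (z.2 * cy z.1) 0
    (e * Num.sqrt (1 - z.2 ^+ 2 * (cx z.1 ^+ 2 + cy z.1 ^+ 2))).

Lemma sphere4E v : sphere4 v -> ch v ^+ 2 = 1 - (cx v ^+ 2 + cy v ^+ 2).
Proof. by move=> [/S3E + w0 _]; rewrite w0 expr0n /= => <-; ring. Qed.

Lemma contr_cont (e : R) (A : set (V4 * R)) : cont_on A (contr e).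
Proof.
have c1 (f : V4 -> R) : continuous f -> cont_on A (fun z => f z.1).
  move=> cf; apply: (@cont_on_comp _ _ _ _ setT) => //.
    by apply: continuous_cont_on => z; exact: cvg_fst.
  exact: continuous_cont_on.
have c2 : cont_on A (fun z : V4 * R => z.2).
  by apply: continuous_cont_on => z; exact: cvg_snd.
apply: cont_on_vec4.
- by apply: cont_onM => //; apply: c1; exact: cx_cont.
- by apply: cont_onM => //; apply: c1; exact: cy_cont.
- exact: cont_on_cst.
apply: cont_onM; first exact: cont_on_cst.
apply: cont_on_comp1; last exact: sqrt_continuous.
apply: cont_onD; first exact: cont_on_cst.
apply: cont_onN; apply: cont_onM; first exact: cont_on_sqr.
by apply: cont_onD; apply: cont_on_sqr; apply: c1; [exact: cx_cont|exact: cy_cont].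
Qed.

Variable e : R.
Hypothesis e2 : e ^+ 2 = 1.

Lemma e_neq0 : e != 0.
Proof. by rewrite -sqrf_eq0 e2 oner_eq0. Qed.

Lemma contr_half v s : half e v -> 0 <= s <= 1 -> half e (contr e (v, s)).
Proof.
move=> [sv hv] /andP[s0 s1].
have hE := sphere4E sv; set q := cx v ^+ 2 + cy v ^+ 2 in hE.
have q0 : 0 <= q by rewrite addr_ge0 ?sqr_ge0.
have q1 : q <= 1 by have := sqr_ge0 (ch v); rewrite hE subr_ge0.
have s2 : s ^+ 2 <= 1 by rewrite expr_le1.
have sq : s ^+ 2 * q <= 1.
  by rewrite -[leRHS]mulr1; apply: ler_pM => //; rewrite sqr_ge0.
split; last by rewrite /contr chE mulrA -expr2 e2 mul1r sqrtr_ge0.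
rewrite /contr /=; split.
- apply/S3E; rewrite !cE -/q !exprMn e2 mul1r sqr_sqrtr ?subr_ge0//.
  by rewrite /q; ring.
- by rewrite cwE.
rewrite !cE -/q => -[/eqP]; rewrite mulf_eq0 (negPf e_neq0) /= sqrtr_eq0 subr_le0.
move=> sq1; have {}sq1 : s ^+ 2 * q = 1 by apply/eqP; rewrite eq_le sq sq1.
have qE : q = 1.
  apply/eqP; rewrite eq_le q1 -sq1 /= -[leRHS]mul1r ler_wpM2r//.
have s1E : s ^+ 2 = 1 by rewrite -sq1 qE mulr1.
case: sv => _ _ nv; rewrite !exprMn s1E !mul1r => xy; apply: nv; split=> //.
by apply/eqP; rewrite -sqrf_eq0 hE qE subrr.
Qed.

Lemma contr1 v : half e v -> contr e (v, 1) = v.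
Proof.
move=> [sv hv]; rewrite /contr /= !mul1r expr1n mul1r -(sphere4E sv) sqrtr_sqr.
have -> : `|ch v| = e * ch v.
  by rewrite -(ger0_norm hv) normrM; have /eqP := e2; rewrite sqrf_eq1 => /orP[] /eqP ->; rewrite ?normrN normr1 mul1r.
rewrite mulrA -expr2 e2 mul1r; case: sv => _ w0 _.
by rewrite -w0 vec4K.
Qed.

Lemma contr0 v : contr e (v, 0) = pole e.
Proof. by rewrite /contr /= !mul0r expr0n mul0r subr0 sqrtr1 mulr1. Qed.

(** Contraction to the pole: the pull-back by a constant map has trivial transitions, so the
    transport [nu] is a potential. *)
Lemma half_triv c : locsys (@sphere4 R) c -> exists m, triv (half e) c m.
Proof.
move=> lc; have lch : locsys (half e) c by apply: locsys_sub lc => v [].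
have [|nu [hnu _]] := homotopy_locsys _ (@contr_cont e _) lch (B := half e).
  by move=> [v s] /= hv s01; exact: contr_half.
exists nu; apply: trivP => v hv; apply: filterS (hnu v hv) => v' + hv' => /(_ hv').
rewrite !contr1// !contr0 (locsys_refl lch) ?mulg1// -(contr0 v).
by apply: contr_half => //; rewrite lexx ler01.
Qed.

(** [B] is a part of the hemisphere containing the path from the pole to [v] on which both
    reductions are known: the whole hemisphere in most uses, the half disk [cy >= 0] in
    [half_normalise]. *)
Lemma half_red2 c (B : set V4) Q1 Q2 F1 F2 v :
  subgroup Q1 -> subgroup Q2 -> B `<=` half e ->
  (forall s, 0 <= s <= 1 -> B (contr e (v, s))) ->
  red B c Q1 F1 -> red B c Q2 F2 -> half e v ->
  exists q1 q2, [/\ Q1 q1, Q2 q2 & (F1 v * (F2 v)^-1 =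
    q1 * (F1 (pole e) * (F2 (pole e))^-1) * q2)%g].
Proof.
move=> sQ1 sQ2 BA Bv r1 r2 hv.
have cv : cont_on (itv 0 1) (fun s => contr e (v, s)).
  apply: (@cont_on_comp _ _ _ _ setT (fun s : R => (v, s)) (contr e)) => //.
    by apply: cont_on_pair; [exact: cont_on_cst|apply: continuous_cont_on => s; exact: cvg_id].
  exact: contr_cont.
have [||q1 [q2 []]] := @itv_red2 _ _ 0 1
   (fun s s' => c (contr e (v, s)) (contr e (v, s'))) Q1 Q2
   (F1 \o (fun s => contr e (v, s))) (F2 \o (fun s => contr e (v, s)))
   ler01 sQ1 sQ2.
- by apply: (red_pull _ cv r1) => s; exact: Bv.
- by apply: (red_pull _ cv r2) => s; exact: Bv.
by rewrite /= contr1// contr0 => h1 h2 h3; exists q1, q2.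
Qed.

End Charts.

(** * The four arcs of the equator *)

Section Arcs.
Variables (R : realType) (G : groupType).
Local Notation V4 := 'rV[R]_4.
Local Notation itv a b := [set s : R | a <= s <= b].
Implicit Types (v : V4) (c : V4 -> V4 -> G).

Definition arcY (e : R) : set V4 :=
  [set v | [/\ sphere4 v, ch v = 0 & `|cx v| < e * cy v]].
Definition arcX (e : R) : set V4 :=
  [set v | [/\ sphere4 v, ch v = 0 & `|cy v| < e * cx v]].

Lemma arcX_flip (e : R) v : arcX e v -> arcY e (flip v).
Proof.
by move=> [sv h0 lt]; split; [exact: sphere4_flip|rewrite flipE chE|rewrite flipE !cE].
Qed.

Lemma half_flip (e : R) v : half e v -> half e (flip v).
Proof. by move=> [sv h0]; split; [exact: sphere4_flip|rewrite flipE chE]. Qed.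

(** Along the arc both charts are potentials of the same system, and the arc is joined to its middle
    by s |-> (s x, e sqrt(1 - s^2 x^2)). *)
Lemma arcY_const c mp mm (e : R) v : e ^+ 2 = 1 ->
  triv (half 1) c mp -> triv (half (-1)) c mm -> arcY e v ->
  (mp v * (mm v)^-1 = mp (vec4 0 e 0 0) * (mm (vec4 0 e 0 0))^-1)%g.
Proof.
move=> e2 tp tm [sv h0 xy].
have hE := sphere4E sv; rewrite h0 expr0n /= in hE.
have {hE} S1 : cx v ^+ 2 + cy v ^+ 2 = 1.
  by apply/esym/eqP; rewrite -subr_eq0 -hE.
have ey0 : 0 < e * cy v by apply: le_lt_trans xy.
have x2 : cx v ^+ 2 < cy v ^+ 2.
  have -> : cy v ^+ 2 = (e * cy v) ^+ 2 by rewrite exprMn e2 mul1r.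
  by rewrite -(real_normK (num_real (cx v))) ltr_pXn2r// nnegrE ltW.
have x2h : cx v ^+ 2 < 2^-1 by lra.
pose p (s : R) := vec4 (s * cx v) (e * Num.sqrt (1 - s ^+ 2 * cx v ^+ 2)) 0 0.
have s2 s : 0 <= s <= 1 -> s ^+ 2 * cx v ^+ 2 <= cx v ^+ 2.
  move=> /andP[s0 s1]; rewrite -[leRHS]mul1r ler_wpM2r ?sqr_ge0//.
  by rewrite expr_le1.
have ps s : itv 0 1 s -> sphere4 (p s) /\ ch (p s) = 0.
  move=> s01; have s2s := s2 s s01; split; last by rewrite chE.
  have pos : 0 <= 1 - s ^+ 2 * cx v ^+ 2 by lra.
  split.
  - by apply/S3E; rewrite !cE !exprMn e2 mul1r sqr_sqrtr//; ring.
  - by rewrite cwE.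
  by rewrite !cE !exprMn e2 mul1r sqr_sqrtr// => -[_]; lra.
have cp : cont_on (itv 0 1) p.
  have cid : cont_on (itv 0 1) (fun s : R => s).
    by apply: continuous_cont_on => s; exact: cvg_id.
  apply: cont_on_vec4.
  - by apply: cont_onM => //; exact: cont_on_cst.
  - apply: cont_onM; first exact: cont_on_cst.
    apply: cont_on_comp1; last exact: sqrt_continuous.
    apply: cont_onD; first exact: cont_on_cst.
    apply: cont_onN; apply: cont_onM; first exact: cont_on_sqr.
    exact: cont_on_cst.
  - exact: cont_on_cst.
  - exact: cont_on_cst.
have p0 : p 0 = vec4 0 e 0 0.
  by rewrite /p !mul0r expr0n mul0r subr0 sqrtr1 mulr1.
have p1 : p 1 = v.
  apply: vec4P; rewrite !cE ?mul1r//; last by case: sv.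
  rewrite expr1n mul1r; have -> : 1 - cx v ^+ 2 = cy v ^+ 2 by rewrite -S1; ring.
  rewrite sqrtr_sqr; have -> : `|cy v| = e * cy v.
    rewrite -(ger0_norm (ltW ey0)) normrM.
    by move/eqP: e2; rewrite sqrf_eq1 => /orP[] /eqP ->; rewrite ?normrN normr1 mul1r.
  by rewrite mulrA -expr2 e2 mul1r.
have hp (f : R) s : itv 0 1 s -> half f (p s).
  by move=> s01; have [a b] := ps s s01; split; rewrite ?b ?mulr0.
have := itv_triv2 ler01 (red_pull (hp 1) cp tp) (red_pull (hp (-1)) cp tm).
by rewrite /= p0 p1.
Qed.

Lemma arcX_const c mp mm (e : R) v : e ^+ 2 = 1 ->
  triv (half 1) c mp -> triv (half (-1)) c mm -> arcX e v ->
  (mp v * (mm v)^-1 = mp (vec4 e 0 0 0) * (mm (vec4 e 0 0 0))^-1)%g.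
Proof.
move=> e2 tp tm av.
have := arcY_const e2
  (red_pull (@half_flip 1) (@flip_cont R _) tp)
  (red_pull (@half_flip (-1)) (@flip_cont R _) tm) (arcX_flip av).
by rewrite /= !flipK !flip_vec4 oppr0.
Qed.

(* mp and mm trivialise c on the two hemispheres; the four constants compare
   them on the arcs A1, B1, A2, B2 of the equator. *)
Definition charts c (mp mm : V4 -> G) (gA1 gB1 gA2 gB2 : G) : Prop :=
  [/\ triv (half 1) c mp, triv (half (-1)) c mm &
    [/\ forall v, arcY 1 v -> mp v = (gA1 * mm v)%g,
        forall v, arcX (-1) v -> mp v = (gB1 * mm v)%g,
        forall v, arcY (-1) v -> mp v = (gA2 * mm v)%g &
        forall v, arcX 1 v -> mp v = (gB2 * mm v)%g]].

Lemma charts_triv c mp mm :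
  triv (half 1) c mp -> triv (half (-1)) c mm ->
  exists gA1 gB1 gA2 gB2, charts c mp mm gA1 gB1 gA2 gB2.
Proof.
move=> tp tm.
have n1 : (-1) ^+ 2 = 1 :> R by rewrite sqrrN expr1n.
have p1 : 1 ^+ 2 = 1 :> R by rewrite expr1n.
pose gam v := (mp v * (mm v)^-1)%g.
exists (gam (vec4 0 1 0 0)), (gam (vec4 (-1) 0 0 0)), (gam (vec4 0 (-1) 0 0)),
  (gam (vec4 1 0 0 0)).
split=> //; split=> v av; rewrite /gam.
- by rewrite -(arcY_const p1 tp tm av) mulgVK.
- by rewrite -(arcX_const n1 tp tm av) mulgVK.
- by rewrite -(arcY_const n1 tp tm av) mulgVK.
- by rewrite -(arcX_const p1 tp tm av) mulgVK.
Qed.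

(** The lower chart is free up to a left constant, which is spent on making the constant of A1
    trivial. *)
Lemma charts_exist c : locsys (@sphere4 R) c ->
  exists mp mm gB1 gA2 gB2, charts c mp mm 1%g gB1 gA2 gB2.
Proof.
move=> lc.
have n1 : (-1) ^+ 2 = 1 :> R by rewrite sqrrN expr1n.
have p1 : 1 ^+ 2 = 1 :> R by rewrite expr1n.
have [mp tp] := half_triv p1 lc; have [mm tm] := half_triv n1 lc.
have [gA1 [gB1 [gA2 [gB2 [_ _ [h1 h2 h3 h4]]]]]] := charts_triv tp tm.
exists mp, (fun v => gA1 * mm v)%g, (gB1 * gA1^-1)%g, (gA2 * gA1^-1)%g, (gB2 * gA1^-1)%g.
split=> //; last by split=> v av; rewrite ?mul1g ?mulgA ?mulgVK; auto.
apply: trivP => v hv; apply: filterS (trivE tm hv) => w + hw => /(_ hw) ->.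
by rewrite mulVgM.
Qed.

Lemma charts_flip c mp mm gA1 gB1 gA2 gB2 :
  charts c mp mm gA1 gB1 gA2 gB2 ->
  charts (fun u v => c (flip u) (flip v)) (mp \o @flip R) (mm \o @flip R)
    gB2 gA2 gB1 gA1.
Proof.
move=> [tp tm [h1 h2 h3 h4]]; split.
- exact: (red_pull (@half_flip 1) (@flip_cont R _) tp).
- exact: (red_pull (@half_flip (-1)) (@flip_cont R _) tm).
have YX e v : arcY e v -> arcX e (flip v).
  by move=> [sv h0 lt]; split; [exact: sphere4_flip|rewrite flipE chE|rewrite flipE !cE].
split=> v av /=.
- by apply: h4; apply: YX.
- by apply: h3; apply: arcX_flip.
- by apply: h2; apply: YX.
- by apply: h1; apply: arcX_flip.
Qed.

End Arcs.

(** * Effect of untwisting on the charts *)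

Lemma quarter_le (R : realType) : (4^-1 : R) <= 3 / 4 /\ 3 / 4 <= (1 : R).
Proof. by split; lra. Qed.

Lemma cos_quarters (R : realType) (x : R) :
  [/\ 0 <= x <= 4^-1 -> 0 <= cos (2 * pi * x),
      4^-1 <= x <= 3 / 4 -> cos (2 * pi * x) <= 0 &
      3 / 4 <= x <= 1 -> 0 <= cos (2 * pi * x)].
Proof.
have p0 := pi_ge0 R.
have mono (a b : R) : a <= b -> pi * a <= pi * b by move=> ab; rewrite ler_wpM2l.
have -> : 2 * pi * x = 2 * (pi * x) by rewrite mulrA.
split=> /andP[/mono h1 /mono h2].
- by apply: cos_ge0_pihalf; lra.
- have -> : 2 * (pi * x) = (2 * (pi * x) - pi) + pi by ring.
  by rewrite cosDpi oppr_le0; apply: cos_ge0_pihalf; lra.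
- have -> : 2 * (pi * x) = (2 * (pi * x) - 2 * pi) + pi + pi by ring.
  by rewrite !cosDpi opprK; apply: cos_ge0_pihalf; lra.
Qed.

Section Twist.
Variables (R : realType) (G : groupType).
Local Notation V4 := 'rV[R]_4.
Local Notation itv a b := [set s : R | a <= s <= b].
Implicit Types (v : V4) (c : V4 -> V4 -> G).

Variables (m : nat).
Hypothesis m_gt0 : (0 < m)%N.
Local Notation n := (2 * m)%N.

Lemma even_n : ~~ odd n. Proof. by rewrite oddM. Qed.

(** Runs down the page of angle pi from the pole to y = -1/2, at such a speed that [twa] is exactly
    [pi * s]. Its image under [ret] therefore turns [m] times in the (x, h) plane, at constant
    angular speed, around the middle of A1. *)
Definition delta (s : R) : V4 := vec4 0 (- (s / 2)) 0 (Num.sqrt (1 - (s / 2) ^+ 2)).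

Lemma delta_h (s : R) : 0 <= s <= 1 -> 4^-1 <= 1 - (s / 2) ^+ 2 - 2^-1.
Proof.
move=> /andP[s0 s1]; have : (s / 2) ^+ 2 <= 2^-1 ^+ 2.
  by rewrite ler_pXn2r ?nnegrE ?divr_ge0 ?invr_ge0// ler_pdivrMr// mulVf.
by rewrite (expr2 2^-1); lra.
Qed.

Lemma delta_half s : 0 <= s <= 1 -> half 1 (delta s).
Proof.
move=> s01; have h := delta_h s01; split; last by rewrite mul1r chE sqrtr_ge0.
split.
- by apply/S3E; rewrite !cE sqr_sqrtr; [ring|lra].
- by rewrite cwE.
by rewrite !cE => -[/eqP]; rewrite sqrtr_eq0; lra.
Qed.

Lemma delta_twa s : 0 <= s <= 1 -> twa (delta s) = pi * s /\ rad (delta s) = s / 2.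
Proof.
move=> /andP[s0 s1]; have rE : rad (delta s) = s / 2.
  by rewrite /rad !cE expr0n addr0 sqrtr_sqr normrN ger0_norm// divr_ge0.
split=> //; rewrite /twa rE.
have -> : chi (s / 2) = s.
  by rewrite /chi mulrCA divff// mulr1; exact: min_r.
have [->|sn0] := eqVneq s 0; first by rewrite !mulr0.
by rewrite /ang rE cyE mulNr divff ?acosN1// mulf_neq0// invr_neq0.
Qed.

Lemma ret_delta s : 0 <= s <= 1 -> let r := Num.sqrt (1 - (s / 2) ^+ 2) in
  let th := n%:R * (pi * s) in
  ret n (delta s) = vec4 (- (r * sin th)) (s / 2) 0 (r * cos th).
Proof.
move=> s01 r th; have [e1 e2] := delta_twa s01.
by rewrite retE e1 e2 !cE -/r -/th !mul0r sub0r add0r.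
Qed.

Lemma delta_cont (A : set R) : cont_on A delta.
Proof.
have cs : cont_on A (fun s : R => s / 2).
  apply: cont_onM; last exact: cont_on_cst.
  by apply: continuous_cont_on => s; exact: cvg_id.
apply: cont_on_vec4; try exact: cont_on_cst.
  exact: cont_onN.
apply: cont_on_comp1; last exact: sqrt_continuous.
apply: cont_onD; first exact: cont_on_cst.
by apply: cont_onN; exact: cont_on_sqr.
Qed.

Lemma lower_half e v : half e v -> lower n v.
Proof. by move=> [/(sphere4_lower even_n)]. Qed.

Variables (c : V4 -> V4 -> G) (mp mm mu : V4 -> G) (gA1 gB1 gA2 gB2 : G).
Hypothesis chc : charts c mp mm gA1 gB1 gA2 gB2.
Local Notation c' := (fun u v => c (ret n u) (ret n v)).
Hypothesis tmu : triv (half 1) c' mu.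

Let tp : triv (half 1) c mp. Proof. by case: chc. Qed.
Let tm : triv (half (-1)) c mm. Proof. by case: chc. Qed.

Lemma spiral_piece (a b e : R) me : 0 <= a -> a <= b -> b <= 1 ->
  e ^+ 2 = 1 -> triv (half e) c me ->
  (forall s, a <= s <= b -> 0 <= e * cos (n%:R * (pi * s))) ->
  (mu (delta b) * (me (ret n (delta b)))^-1 =
   mu (delta a) * (me (ret n (delta a)))^-1)%g.
Proof.
move=> a0 ab b1 e2 te hc.
have sub s : itv a b s -> 0 <= s <= 1.
  by move=> /andP[h1 h2]; rewrite (le_trans a0 h1) (le_trans h2 b1).
have h1 s : itv a b s -> half 1 (delta s) by move=> /sub /delta_half.
have h2 s : itv a b s -> half e (ret n (delta s)).
  move=> si; split.
    by have [] := ret_sphere4 even_n (lower_half (h1 s si)).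
  rewrite (ret_delta (sub s si)) chE mulrCA mulr_ge0 ?sqrtr_ge0//.
  exact: hc.
have cr : cont_on (itv a b) (fun s => ret n (delta s)).
  by apply: (cont_on_comp (B := setT)) => //; [exact: delta_cont|exact: ret_cont].
exact: itv_triv2 ab (red_pull h1 (@delta_cont _) tmu) (red_pull h2 cr te).
Qed.

(** In each turn the image crosses B1 on its way down and B2 on its way up, which contributes one
    factor gB1 gB2^-1. *)
Lemma spiral k : (k <= m)%N -> mu (delta 0) = mp (delta 0) ->
  (mu (delta (k%:R / m%:R)) =
   (gB1 * gB2^-1) ^+ k * mp (ret n (delta (k%:R / m%:R))))%g.
Proof.
move=> + mu0; elim: k => [_|k IH km].
  rewrite mul0r expg0 mul1g mu0 ret_fix//.
    by rewrite cwE.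
  by left; rewrite cyE mul0r oppr0.
have m0 : 0 < m%:R :> R by rewrite ltr0n.
have m0' : m%:R != 0 :> R by rewrite gt_eqF.
(* The parameter after [k + x] turns. The image lies in the upper hemisphere for x <= 1/4 and x >=
   3/4, in the lower one in between. *)
pose s (x : R) := (k%:R + x) / m%:R.
have s_mono x y : x <= y -> s x <= s y by move=> xy; rewrite ler_pM2r ?invr_gt0// lerD2l.
have s01 x : 0 <= x <= 1 -> 0 <= s x <= 1.
  move=> /andP[x0 x1]; rewrite divr_ge0 ?addr_ge0 ?ler0n ?(ltW m0)//=.
  by rewrite ler_pdivrMr// mul1r -(ler_nat R) in km *; move: km; rewrite -natr1; lra.
have sinv y a b : s a <= y <= s b -> exists2 x, y = s x & a <= x <= b.
  move=> yab; exists (y * m%:R - k%:R).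
    by rewrite /s addrC subrK mulfK.
  by move: yab; rewrite /s ler_pdivrMr// ler_pdivlMr//; lra.
have th x : cos (n%:R * (pi * s x)) = cos (2 * pi * x) /\
            sin (n%:R * (pi * s x)) = sin (2 * pi * x).
  have -> : n%:R * (pi * s x) = (2 * k)%N%:R * pi + 2 * pi * x.
    by rewrite /s !natrM; field.
  have [|h1 h2] := @cos_sin_npi R (2 * k); first by rewrite oddM.
  by rewrite cosD sinD h1 h2 !mul0r !mul1r subr0 add0r.
have s0E : s 0 = k%:R / m%:R by rewrite /s addr0.
have s1E : s 1 = k.+1%:R / m%:R by rewrite /s natr1.
have pi0 := pi_gt0 R.
have n1 : (-1) ^+ 2 = 1 :> R by rewrite sqrrN expr1n.
have p1 : 1 ^+ 2 = 1 :> R by rewrite expr1n.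
have q01 : (0 : R) <= 4^-1 by rewrite invr_ge0.
have [q13 q31] := quarter_le R.
have s0 x : 0 <= x <= 1 -> 0 <= s x by move/s01/andP => [].
have s1 x : 0 <= x <= 1 -> s x <= 1 by move/s01/andP => [].
have arc (e x : R) : e ^+ 2 = 1 -> 0 <= x <= 1 -> cos (2 * pi * x) = 0 ->
    sin (2 * pi * x) = - e -> arcX e (ret n (delta (s x))).
  move=> e2 x01 c0 se; have sx := s01 x x01; have [h1 h2] := th x.
  split.
  - by have [] := ret_sphere4 even_n (lower_half (delta_half sx)).
  - by rewrite (ret_delta sx) chE h1 c0 mulr0.
  rewrite (ret_delta sx) !cE h2 se.
  have -> (r : R) : e * - (r * - e) = e ^+ 2 * r by ring.
  rewrite e2 mul1r.
  have hd := delta_h sx; have /andP[sx0 sx1] := sx.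
  have h0 : 0 <= s x / 2 by rewrite divr_ge0.
  rewrite (ger0_norm h0) -[ltLHS](ger0_norm h0) -sqrtr_sqr ltr_sqrt; lra.
have [_ _ [_ hB1 _ hB2]] := chc.
have c14 : cos (2 * pi * 4^-1) = 0 :> R /\ sin (2 * pi * 4^-1) = 1 :> R.
  have -> : 2 * pi * 4^-1 = pi / 2 :> R by field.
  by rewrite cos_pihalf sin_pihalf.
have c34 : cos (2 * pi * (3 / 4)) = 0 :> R /\ sin (2 * pi * (3 / 4)) = - 1 :> R.
  have -> : 2 * pi * (3 / 4) = pi / 2 + pi :> R by field.
  by rewrite cosDpi sinDpi cos_pihalf sin_pihalf oppr0.
have P1 := @spiral_piece (s 0) (s 4^-1) 1 mp (s0 _ _) (s_mono _ _ q01) (s1 _ _) p1 tp.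
have P2 := @spiral_piece (s 4^-1) (s (3 / 4)) (-1) mm (s0 _ _) (s_mono _ _ q13) (s1 _ _) n1 tm.
have P3 := @spiral_piece (s (3 / 4)) (s 1) 1 mp (s0 _ _) (s_mono _ _ q31) (s1 _ _) p1 tp.
have {}P1 : (mu (delta (s (4^-1)%R)) =
    (gB1 * gB2^-1) ^+ k * mp (ret n (delta (s (4^-1)%R))))%g.
  rewrite -[LHS](mulgVK (mp (ret n (delta (s (4^-1)%R))))) P1 ?lexx ?ler01 ?q01//=.
  - by rewrite s0E IH ?mulgK//; exact: ltnW.
  - exact: le_trans q31.
  by move=> y /sinv[x -> x01]; rewrite mul1r (th x).1; have [h _ _] := cos_quarters x; exact: h.
have {}P2 : (mu (delta (s (3 / 4)%R)) =
    (gB1 * gB2^-1) ^+ k * gB1 * mm (ret n (delta (s (3 / 4)%R))))%g.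
  rewrite -[LHS](mulgVK (mm (ret n (delta (s (3 / 4)%R))))) P2//; last first.
  - move=> y /sinv[x -> x01]; rewrite (th x).1 mulN1r oppr_ge0.
    by have [_ h _] := cos_quarters x; exact: h.
  - by rewrite q31 (le_trans q01).
  - by rewrite q01 (le_trans q13).
  rewrite P1 hB1 ?mulgA ?mulgK//; apply: arc => //; rewrite ?c14.1 ?c14.2 ?opprK//.
  by rewrite q01 (le_trans q13).
have {}P3 := P3.
rewrite -s1E -[LHS](mulgVK (mp (ret n (delta (s 1%R))))) P3; last first.
- by move=> y /sinv[x -> x01]; rewrite mul1r (th x).1; have [_ _ h] := cos_quarters x; exact: h.
- by rewrite lexx ler01.
- by rewrite q31 (le_trans q01).
congr (_ * _)%g; rewrite P2 hB2; last first.
  by apply: arc => //; rewrite ?c34.1 ?c34.2//; lra.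
by rewrite invgM !mulgA mulgK expgSr mulgA.
Qed.

End Twist.

Section TwistCharts.
Variables (R : realType) (G : groupType).
Local Notation V4 := 'rV[R]_4.
Local Notation itv a b := [set s : R | a <= s <= b].
Implicit Types (v : V4) (c : V4 -> V4 -> G).

Definition far (e : R) : set V4 := [set v | half e v /\ cy v <= - 2^-1].
Definition far_base (e : R) : V4 :=
  vec4 0 (- 2^-1) 0 (e * Num.sqrt (1 - 2^-1 ^+ 2)).

(** The far region is connected: moving (x, h) linearly to the base point stays in the disk x^2 +
    h^2 <= 3/4, over which y = - sqrt(1 - x^2 - h^2) is at most -1/2. *)
Lemma far_const c (e : R) m1 m2 v : e ^+ 2 = 1 ->
  triv (far e) c m1 -> triv (far e) c m2 -> far e v ->
  (m1 v * (m2 v)^-1 = m1 (far_base e) * (m2 (far_base e))^-1)%g.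
Proof.
move=> e2 t1 t2 [[sv h0] y0].
have hE := sphere4E sv; have /S3E := (let: And3 a _ _ := sv in a).
have w0 : cw v = 0 by case: sv.
pose r : R := Num.sqrt (1 - 2^-1 ^+ 2).
have r0 : 0 < r by rewrite sqrtr_gt0 expr2; lra.
have r2 : r ^+ 2 = 3 / 4 by rewrite sqr_sqrtr expr2; lra.
have y2 : 4^-1 <= cy v ^+ 2 by rewrite expr2; nra.
move=> S1; rewrite w0 expr0n /= addr0 in S1.
pose H s := (1 - s) * (e * r) + s * ch v.
pose q s := (s * cx v) ^+ 2 + H s ^+ 2.
pose p s := vec4 (s * cx v) (- Num.sqrt (1 - q s)) 0 (H s).
have qle s : 0 <= s <= 1 -> q s <= 3 / 4.
  move=> /andP[s0 s1].
  have -> : q s = (1 - s) ^+ 2 * (e ^+ 2 * r ^+ 2) + (2 * s * (1 - s)) * (e * r * ch v)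
      + s ^+ 2 * (cx v ^+ 2 + ch v ^+ 2) by rewrite /q /H; ring.
  have -> : cx v ^+ 2 + ch v ^+ 2 = 1 - cy v ^+ 2 by rewrite -S1; ring.
  rewrite e2 r2 mul1r.
  have am : e * r * ch v <= 3 / 4.
    have : 0 <= (e * r - ch v) ^+ 2 by exact: sqr_ge0.
    have -> : (e * r - ch v) ^+ 2 = e ^+ 2 * r ^+ 2 - 2 * (e * r * ch v) + ch v ^+ 2 by ring.
    rewrite e2 r2 mul1r; have : ch v ^+ 2 <= 3 / 4.
      by have := sqr_ge0 (cx v); lra.
    by lra.
  have k1 : (2 * s * (1 - s)) * (e * r * ch v) <= (2 * s * (1 - s)) * (3 / 4).
    by rewrite ler_wpM2l// !mulr_ge0// subr_ge0.
  have k2 : s ^+ 2 * (1 - cy v ^+ 2) <= s ^+ 2 * (3 / 4).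
    by rewrite ler_wpM2l ?sqr_ge0//; lra.
  have : (1 - s) ^+ 2 * (3 / 4) + (2 * s * (1 - s)) * (3 / 4) + s ^+ 2 * (3 / 4) = 3 / 4 :> R by ring.
  by lra.
have p1 : p 1 = v.
  have H1 : H 1 = ch v by rewrite /H; ring.
  rewrite /p /q H1 !mul1r; apply: vec4P; rewrite !cE//.
  have -> : 1 - (cx v ^+ 2 + ch v ^+ 2) = cy v ^+ 2 by rewrite -S1; ring.
  by rewrite sqrtr_sqr ler0_norm ?opprK//; lra.
have p0 : p 0 = far_base e.
  have H0 : H 0 = e * r by rewrite /H; ring.
  rewrite /p /q H0 !mul0r expr0n add0r exprMn e2 mul1r r2.
  have -> : (1 - 3 / 4 : R) = 2^-1 ^+ 2 by rewrite expr2; lra.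
  by rewrite sqrtr_sqr ger0_norm// invr_ge0.
have pA s : itv 0 1 s -> far e (p s).
  move=> s01; have /andP[s0 s1] := s01; have qs := qle s s01.
  have eH : 0 <= e * H s.
    have -> : e * H s = (1 - s) * (e ^+ 2 * r) + s * (e * ch v) by rewrite /H; ring.
    by rewrite e2 mul1r addr_ge0// mulr_ge0 ?subr_ge0 ?(ltW r0).
  split; last first.
    rewrite cyE lerN2; have -> : 2^-1 = Num.sqrt (2^-1 ^+ 2) :> R.
      by rewrite sqrtr_sqr ger0_norm// invr_ge0.
    by rewrite ler_wsqrtr// expr2; lra.
  split; last by rewrite chE.
  split.
  - by apply/S3E; rewrite !cE sqrrN sqr_sqrtr; [rewrite /q; ring|lra].
  - by rewrite cwE.
  have [->|s1N] := eqVneq s 1; first by rewrite p1; case: sv.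
  rewrite chE => -[Hs0 _].
  have : 0 < e * H s.
    have -> : e * H s = (1 - s) * (e ^+ 2 * r) + s * (e * ch v) by rewrite /H; ring.
    rewrite e2 mul1r; apply: ltr_wpDr; first by rewrite mulr_ge0.
    by rewrite mulr_gt0// subr_gt0 lt_neqAle s1N.
  by rewrite Hs0 mulr0 ltxx.
have cid : cont_on (itv 0 1) (fun s : R => s).
  by apply: continuous_cont_on => s; exact: cvg_id.
have cX : cont_on (itv 0 1) (fun s : R => s * cx v).
  by apply: cont_onM => //; exact: cont_on_cst.
have cH : cont_on (itv 0 1) H.
  apply: cont_onD; apply: cont_onM => //; try exact: cont_on_cst.
  by apply: cont_onD; [exact: cont_on_cst|exact: cont_onN].
have cp : cont_on (itv 0 1) p.
  apply: cont_on_vec4 => //; last exact: cont_on_cst.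
  apply: cont_onN; apply: cont_on_comp1; last exact: sqrt_continuous.
  apply: cont_onD; first exact: cont_on_cst.
  by apply: cont_onN; apply: cont_onD; exact: cont_on_sqr.
have := itv_triv2 ler01 (red_pull pA cp t1) (red_pull pA cp t2).
by rewrite /= p0 p1.
Qed.

Variables (m : nat).
Hypothesis m_gt0 : (0 < m)%N.
Local Notation n := (2 * m)%N.
Variables (c : V4 -> V4 -> G) (mp mm mup mum : V4 -> G) (gA1 gB1 gA2 gB2 : G).
Hypothesis chc : charts c mp mm gA1 gB1 gA2 gB2.
Local Notation c' := (fun u v => c (ret n u) (ret n v)).
Hypotheses (tmup : triv (half 1) c' mup) (tmum : triv (half (-1)) c' mum).
Hypothesis mupE : forall v, half 1 v -> 0 <= cy v -> mup v = mp v.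
Hypothesis mumE : forall v, half (-1) v -> 0 <= cy v -> mum v = mm v.

Let n1 : (-1) ^+ 2 = 1 :> R. Proof. by rewrite sqrrN expr1n. Qed.
Let p1 : 1 ^+ 2 = 1 :> R. Proof. by rewrite expr1n. Qed.
Let en : ~~ odd n. Proof. exact: even_n. Qed.

Lemma ret_far_half e v : far e v -> half e (ret n v).
Proof.
move=> [[sv h0] y0]; have [_ w0 _] := sv; split.
  by have [] := ret_sphere4 en (sphere4_lower en sv).
by rewrite ret_far// chE.
Qed.

(** The factor at the end of the spiral spreads over the far region, because [far_base 1] is
    [delta 1]. *)
Lemma twist_up v : far 1 v -> (mup v = (gB1 * gB2^-1) ^+ m * mp (ret n v))%g.
Proof.
move=> fv; have [tp tm _] := chc.
have t1 : triv (far 1) c' mup by apply: red_sub tmup => u [].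
have t2 : triv (far 1) c' (mp \o ret n).
  by apply: (red_pull (@ret_far_half 1) (@ret_cont _ _ _) tp).
have := far_const p1 t1 t2 fv.
have -> : far_base 1 = delta 1 :> V4 by rewrite /delta /far_base !mul1r.
have e1 : m%:R / m%:R = 1 :> R by rewrite divff// pnatr_eq0 -lt0n.
have := spiral m_gt0 chc tmup (leqnn m); rewrite e1 => ->; last first.
  have d0 : half 1 (delta (0 : R)) by apply: delta_half; rewrite lexx ler01.
  by apply: mupE => //; rewrite cyE mul0r oppr0.
by rewrite /= mulgK => <-; rewrite mulgVK.
Qed.

(** The constant can be read at the middle of the arc, where y = 0 and the new charts coincide with
    the old ones. *)
Lemma twist_B1 v : arcX (-1) v -> mup v = (gB1 * mum v)%g.
Proof.
move=> av; have := arcX_const n1 tmup tmum av.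
set u := vec4 (-1) 0 0 0 => e.
have au : arcX (-1) u.
  split; [split| |].
  - by apply/S3E; rewrite !cE; ring.
  - by rewrite cwE.
  - by rewrite !cE => -[_ /eqP]; rewrite sqrrN expr1n expr0n oner_eq0.
  - by rewrite chE.
  - by rewrite !cE normr0 mulrNN mul1r.
have hu f : half f u by case: au => su hu _; split; rewrite ?hu ?mulr0.
move: e; rewrite (mupE (hu 1)) ?cyE// (mumE (hu (-1))) ?cyE//.
have [_ _ [_ h _ _]] := chc; rewrite (h u au) mulgK => <-.
by rewrite mulgVK.
Qed.

Lemma twist_B2 v : arcX 1 v -> mup v = (gB2 * mum v)%g.
Proof.
move=> av; have := arcX_const p1 tmup tmum av.
set u := vec4 1 0 0 0 => e.
have au : arcX 1 u.
  split; [split| |].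
  - by apply/S3E; rewrite !cE; ring.
  - by rewrite cwE.
  - by rewrite !cE => -[_ /eqP]; rewrite expr1n expr0n oner_eq0.
  - by rewrite chE.
  - by rewrite !cE normr0 mul1r.
have hu f : half f u by case: au => su hu _; split; rewrite ?hu ?mulr0.
move: e; rewrite (mupE (hu 1)) ?cyE// (mumE (hu (-1))) ?cyE//.
have [_ _ [_ _ _ h]] := chc; rewrite (h u au) mulgK => <-.
by rewrite mulgVK.
Qed.

Lemma twist_A1 v : arcY 1 v -> mup v = (gA1 * mum v)%g.
Proof.
move=> av; have [sv h0 lt] := av.
have y0 : 0 <= cy v.
  by rewrite -[cy v]mul1r; apply: ltW; apply: le_lt_trans lt; exact: normr_ge0.
have hv f : half f v by split; rewrite ?h0 ?mulr0.
by rewrite mupE ?mumE//; have [_ _ [h _ _ _]] := chc; exact: h.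
Qed.

(** Deduced from the upper side: the point [u] of B1 lies in both far regions and satisfies mup =
    gB1 mum, and conjugating the power of gB1 gB2^-1 by gB1 gives the power of gB2^-1 gB1. *)
Lemma twist_down v : far (-1) v ->
  (mum v = (gB2^-1 * gB1) ^+ m * mm (ret n v))%g.
Proof.
move=> fv; have [tp tm [_ hB1 _ _]] := chc.
have t1 : triv (far (-1)) c' mum by apply: red_sub tmum => u [].
have t2 : triv (far (-1)) c' (mm \o ret n).
  by apply: (red_pull (@ret_far_half (-1)) (@ret_cont _ _ _) tm).
have r2 : Num.sqrt (1 - 2^-1 ^+ 2) ^+ 2 = 3 / 4 :> R.
  by rewrite sqr_sqrtr expr2; lra.
pose u : V4 := vec4 (- Num.sqrt (1 - 2^-1 ^+ 2)) (- 2^-1) 0 0.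
have au : arcX (-1) u.
  split; [split| |].
  - by apply/S3E; rewrite !cE sqrrN r2 sqrrN !expr2; lra.
  - by rewrite cwE.
  - by rewrite !cE => -[_]; rewrite sqrrN r2 sqrrN expr2; lra.
  - by rewrite chE.
  - rewrite !cE mulrNN mul1r normrN ger0_norm ?invr_ge0//.
    rewrite -[ltLHS]ger0_norm ?invr_ge0// -sqrtr_sqr ltr_sqrt !expr2; lra.
have hu f : half f u by case: au => su hu _; split; rewrite ?hu ?mulr0.
have fu f : far f u by split; [exact: hu|rewrite cyE].
have ru : arcX (-1) (ret n u).
  have [su h0 lt] := au; have [_ w0 _] := su; split.
  - by have [] := ret_far_half (fu 1).
  - by rewrite (ret_far en w0) ?cyE// chE.
  - by move: lt; rewrite (ret_far en w0) ?cyE// !cE !normrN.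
have e1 := far_const n1 t1 t2 fv.
have e2 := far_const n1 t1 t2 (fu (-1)).
rewrite -e1 /= in e2.
have e3 := twist_B1 au; rewrite twist_up// hB1// in e3.
have {}e3 : (mum u = gB1^-1 * (gB1 * gB2^-1) ^+ m * gB1 * mm (ret n u))%g.
  by rewrite -[LHS](mulKg gB1) -e3 !mulgA.
rewrite e3 mulgK in e2.
rewrite -[LHS](mulgVK (mm (ret n v))) -e2; congr (_ * _)%g.
have := conjXg (gB1 * gB2^-1)%g gB1 m; rewrite !conjgE !mulgA => ->.
by rewrite mulVg mul1g.
Qed.

(** Only the constant of A2 changes: [ret] reflects A2 onto A1, so the constant is [gA1] framed by
    the spiral factors of the two hemispheres. *)
Lemma twist_charts : charts c' mup mum gA1 gB1
  ((gB1 * gB2^-1) ^+ m * gA1 * (gB2^-1 * gB1) ^- m)%g gB2.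
Proof.
split=> //; split; [exact: twist_A1|exact: twist_B1| |exact: twist_B2].
move=> v [sv h0 lt]; have [/S3E S1 w0 _] := sv.
have hv f : half f v by split; rewrite ?h0 ?mulr0.
have y0 : cy v <= - 2^-1.
  rewrite h0 w0 !expr0n /= !addr0 in S1.
  have yn : 0 < - cy v by rewrite -mulN1r; apply: le_lt_trans lt; exact: normr_ge0.
  have : cx v ^+ 2 < cy v ^+ 2.
    rewrite -(sqrrN (cy v)) -(real_normK (num_real (cx v))) ltr_pXn2r ?nnegrE ?(ltW yn)//.
    by rewrite -mulN1r.
  move=> xy; rewrite lerNr -[leLHS]ger0_norm ?invr_ge0// -[leRHS](ger0_norm (ltW yn)).
  by rewrite -!sqrtr_sqr ler_sqrt ?sqr_ge0// sqrrN (expr2 2^-1); lra.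
have fv f : far f v by [].
rewrite twist_up// twist_down//.
have [_ _ [hA1 _ _ _]] := chc; rewrite hA1; first by rewrite -!mulgA mulKg.
split.
- by have [] := ret_far_half (fv 1).
- by rewrite ret_far// chE.
- by rewrite ret_far// !cE mul1r -mulN1r.
Qed.

End TwistCharts.

(** * Structure of local systems on the complement *)

Section Inside.
Variables (R : realType) (G : groupType).
Local Notation V4 := 'rV[R]_4.
Implicit Types (v : V4) (c : V4 -> V4 -> G).

Section Tag.
Variables (c : V4 -> V4 -> G) (mp mm : V4 -> G) (gA1 gB1 gA2 gB2 : G).
Hypothesis chc : charts c mp mm gA1 gB1 gA2 gB2.

(** The two charts joined without a jump across A1; in y >= 0 only the jumps across B1 and B2
    remain. *)
Definition tag v : G := if 0 <= ch v then mp v else (gA1 * mm v)%g.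

Lemma tag_red Q v : subgroup Q -> sphere4 v -> 0 <= cy v ->
  (ch v = 0 -> 0 < cx v -> Q (gB2 * gA1^-1)%g) ->
  (ch v = 0 -> cx v < 0 -> Q (gB1 * gA1^-1)%g) ->
  red_at (@sphere4 R) c Q tag v.
Proof.
move=> [Q1 QM QV] sv y0 hB2 hB1; have [tp tm [cA1 cB1 _ cB2]] := chc.
have cch := @continuous_cont_on _ _ (@sphere4 R) _ (@ch_cont R).
have [h0|h0|h0] := ltgtP 0 (ch v).
- have hv : half 1 v by split=> //; rewrite mul1r ltW.
  apply: filterS2 (near_gt cch sv h0) (trivE tp hv) => w hw ew s4w.
  have := hw s4w => hw'; have -> := ew.
    rewrite /tag (ltW h0) (ltW hw') mulVKg mulgV; exact: Q1.
  by split=> //; rewrite mul1r ltW.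
- have hv : half (-1) v by split=> //; rewrite mulN1r oppr_ge0 ltW.
  apply: filterS2 (near_lt cch sv h0) (trivE tm hv) => w hw ew s4w.
  have := hw s4w => hw'; have -> := ew.
    rewrite /tag leNgt h0 leNgt hw' /= invgM -!mulgA mulVKg.
    rewrite [X in (_ * X)%g]mulgA mulgV mul1g mulgV; exact: Q1.
  by split=> //; rewrite mulN1r oppr_ge0 ltW.
have hv1 : half 1 v by split=> //; rewrite -h0 mulr0.
have hv2 : half (-1) v by split=> //; rewrite -h0 mulr0.
apply: filterS2 (trivE tp hv1) (trivE tm hv2) => w e1 e2 s4w.
have [h1|h1] := leP 0 (ch w).
  rewrite e1; last by split; rewrite ?mul1r.
  by rewrite /tag h1 -h0 lexx mulVKg mulgV.
rewrite e2; last by split=> //; rewrite mulN1r oppr_ge0 ltW.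
rewrite /tag -h0 lexx leNgt h1 /= invgM !mulgA mulgK.
have [_ _ nv] := sv; have xy : cx v ^+ 2 <> cy v ^+ 2 by move=> xy; exact: nv.
have [xy1|xy1] := ltP (`|cx v|) (cy v).
  by rewrite (cA1 v) ?mulgK ?mulgV//; split; rewrite ?mul1r.
have {xy1} xy1 : `|cy v| < `|cx v|.
  rewrite (ger0_norm y0) lt_neqAle xy1 andbT; apply/eqP => e; apply: xy.
  by rewrite e real_normK ?num_real.
have [x0|x0|x0] := ltgtP 0 (cx v).
- rewrite (cB2 v) ?mulgK; first exact: hB2.
  by split=> //; rewrite mul1r; rewrite (gtr0_norm x0) in xy1.
- rewrite (cB1 v) ?mulgK; first exact: hB1.
  by split=> //; rewrite mulN1r; rewrite (ltr0_norm x0) in xy1.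
by move: xy1; rewrite -x0 normr0 ltNge normr_ge0.
Qed.

End Tag.

Variables (m : nat).
Hypothesis m_gt0 : (0 < m)%N.
Local Notation n := (2 * m)%N.

(** On the inside [c] is gauge equivalent, through the transport [nu], to its pull-back by [ret].
    [twist_charts] computes the constant of A2 for the pull-back, and this is the relation; the
    gauge [f] is [tag] after [ret], corrected by [nu]. *)
Lemma inside_struct c mp mm gA1 gB1 gA2 gB2 :
  locsys (lower n) c -> charts c mp mm gA1 gB1 gA2 gB2 ->
  gA2 = ((gB1 * gB2^-1) ^+ m * gA1 * (gB2^-1 * gB1) ^- m)%g /\
  exists f : V4 -> G,
  [/\ forall Q v, subgroup Q -> lower n v ->
        (ch (ret n v) = 0 -> 0 < cx (ret n v) -> Q (gB2 * gA1^-1)%g) ->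
        (ch (ret n v) = 0 -> cx (ret n v) < 0 -> Q (gB1 * gA1^-1)%g) ->
        red_at (lower n) c Q f v,
      forall v, sphere4 v -> 0 <= cy v -> f v = tag mp mm gA1 v,
      forall v, sphere4 v -> cy v <= - 2^-1 -> 0 <= ch v ->
        f v = ((gB1 * gB2^-1) ^- m * mp v)%g &
      forall v, sphere4 v -> cy v <= - 2^-1 -> ch v < 0 ->
        f v = (gA1 * (gB2^-1 * gB1) ^- m * mm v)%g].
Proof.
move=> lc chc; have en := even_n m.
have [|nu [hnu nu1]] := homotopy_locsys _ (@Phi_cont R n _) lc (B := lower n).
  by move=> [v s] /= lv s01; exact: Phi_lower.
have {}hnu v : lower n v -> \forall v' \near v, lower n v' ->
    c v v' = ((nu v)^-1 * c (ret n v) (ret n v') * nu v')%g.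
  move=> lv; apply: filterS (hnu v lv) => v' + lv' => /(_ lv').
  by rewrite !Phi1//; [case: lv'|case: lv].
have {}nu1 v : sphere4 v -> 0 <= cy v -> nu v = 1%g.
  move=> sv y0; have [_ w0 _] := sv; apply: nu1; first exact: sphere4_lower.
  by move=> s s01; rewrite !Phi_fix ?lexx ?ler01//; left.
have [tp tm [cA1 cB1 cA2 cB2]] := chc.
pose c' u v := c (ret n u) (ret n v).
have half_lower e v : half e v -> lower n v by move=> [/(sphere4_lower en)].
have tmu e me : triv (half e) c me ->
    triv (half e) c' (fun v => me v * (nu v)^-1)%g.
  move=> te; apply: trivP => v hv.
  apply: filterS2 (trivE te hv) (hnu v (half_lower e v hv)) => w e1 e2 hw.
  have := e1 hw; rewrite e2 /c'; last exact: half_lower hw.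
  move=> E; rewrite invgM invgK mulgA -[(nu v * (me v)^-1 * me w)%g]mulgA -E.
  by rewrite !mulgA mulgV mul1g mulgK.
have muE e me v : half e v -> 0 <= cy v -> (me v * (nu v)^-1 = me v)%g.
  by move=> [sv _] y0; rewrite nu1// invg1 mulg1.
have up v : half 1 v -> cy v <= - 2^-1 ->
    (mp v * (nu v)^-1 = (gB1 * gB2^-1) ^+ m * mp (ret n v))%g.
  by move=> hv y0; exact: (twist_up m_gt0 chc (tmu _ _ tp) (muE 1 mp)).
have down v : half (-1) v -> cy v <= - 2^-1 ->
    (mm v * (nu v)^-1 = (gB2^-1 * gB1) ^+ m * mm (ret n v))%g.
  move=> hv y0; exact: (twist_down m_gt0 chc (tmu _ _ tp) (tmu _ _ tm)
    (muE 1 mp) (muE (-1) mm)).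
have retS v : lower n v -> sphere4 (ret n v) /\ 0 <= cy (ret n v).
  by move=> lv; exact: ret_sphere4.
split.
  have [_ _ [_ _ tA2 _]] := twist_charts m_gt0 chc (tmu _ _ tp) (tmu _ _ tm)
    (muE 1 mp) (muE (-1) mm).
  pose u : V4 := vec4 0 (-1) 0 0.
  have au : arcY (-1) u.
    split; [split| |]; rewrite ?chE ?cwE//.
    - by apply/S3E; rewrite !cE; ring.
    - by rewrite !cE => -[_ /eqP]; rewrite sqrrN expr1n expr0n eq_sym oner_eq0.
    - by rewrite !cE normr0 mulrNN mul1r.
  by have := tA2 u au; rewrite cA2// !mulgA => /mulIg /mulIg.
exists (fun v => tag mp mm gA1 (ret n v) * nu v)%g; split.
- move=> Q v sQ lv h2 h1; have [s4 y0] := retS v lv.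
  have r := tag_red chc sQ s4 y0 h2 h1.
  have cr := @ret_cont R n (lower n).
  apply: filterS2 (hnu v lv) (cr v lv _ r) => w e1 e2 lw.
  have := e2 lw (retS w lw).1; rewrite e1//; congr Q.
  by rewrite invgM !mulgA mulgK mulgK.
- by move=> v sv y0; have [_ w0 _] := sv; rewrite nu1// mulg1 ret_fix//; left.
- move=> v sv y0 h0; have [_ w0 _] := sv.
  have hv : half 1 v by split; rewrite ?mul1r.
  have := up v hv y0; rewrite /tag ret_far// chE h0 => E.
  by rewrite -[mp v](mulgVK (nu v)) E !mulgA mulVg mul1g.
- move=> v sv y0 h0; have [_ w0 _] := sv.
  have hv : half (-1) v by split=> //; rewrite mulN1r oppr_ge0 ltW.
  have := down v hv y0; rewrite /tag ret_far// chE leNgt h0 /= => E.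
  by rewrite -[mm v](mulgVK (nu v)) E !mulgA mulgVK.
Qed.

End Inside.

Section Global.
Variables (R : realType) (G : groupType).
Local Notation V4 := 'rV[R]_4.
Implicit Types (v : V4) (c : V4 -> V4 -> G).
Variables (m l : nat).
Hypotheses (m_gt0 : (0 < m)%N) (l_gt0 : (0 < l)%N).
Local Notation n := (2 * m)%N.
Local Notation k := (2 * l)%N.
Local Notation X := (@knot_compl R n k).
Local Notation K := (double_twist R n k).

Let en : ~~ odd n := even_n m.
Let ek : ~~ odd k := even_n l.

Lemma lower_compl : lower n `<=` X.
Proof. by move=> v lv; have [_ w0 _] := lv; apply/lowerP. Qed.

Lemma compl_lower v : X v -> cw v <= 0 -> lower n v.
Proof. by move=> Xv w0; apply/(lowerP en ek w0). Qed.

Lemma compl_upper v : X v -> 0 <= cw v -> lower k (flip v).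
Proof.
move=> Xv w0; apply/(lowerP ek en); last exact: knot_compl_flip.
by rewrite flipE cwE oppr_le0.
Qed.

Lemma upper_compl v : lower k (flip v) -> X v.
Proof.
move=> lv; have [_ w0 _] := lv; rewrite -[v]flipK; apply: knot_compl_flip.
by apply/(lowerP ek en w0).
Qed.

Lemma sphere4_compl : @sphere4 R `<=` X.
Proof. by move=> v sv; apply: lower_compl; exact: sphere4_lower. Qed.

(** With the constants 1, U g, V, g on A1, B1, A2, B2, the first equation is the outside relation
    for B1 and the second the inside relation for A2. *)
Definition rels (g U V : G) : Prop :=
  U = (V ^+ l * g * V ^- l * g^-1)%g /\ V = (U ^+ m * g^-1 * U ^- m * g)%g.

(* fi and fo are gauges on the inside and on the outside; on the sphere they differ
   from the charts by the effect of untwisting, which acts on cy < 0 resp. cx < 0. *)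
Lemma global_struct c mp mm gB1 V g :
  locsys X c -> charts c mp mm 1%g gB1 V g ->
  let U := (gB1 * g^-1)%g in
  rels g U V /\ exists fi fo : V4 -> G,
  [/\ forall Q v, subgroup Q -> lower n v ->
        (ch (ret n v) = 0 -> 0 < cx (ret n v) -> Q g) ->
        (ch (ret n v) = 0 -> cx (ret n v) < 0 -> Q gB1) ->
        red_at (lower n) c Q fi v,
      forall Q v, subgroup Q -> lower k (flip v) ->
        (ch (ret k (flip v)) = 0 -> 0 < cx (ret k (flip v)) -> Q g) ->
        (ch (ret k (flip v)) = 0 -> cx (ret k (flip v)) < 0 -> Q (V * g^-1)%g) ->
        red_at (lower k \o @flip R) c Q fo v,
      forall v, sphere4 v ->
        [/\ 0 <= cy v -> fi v = if 0 <= ch v then mp v else mm v,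
            cy v <= - 2^-1 -> 0 <= ch v -> fi v = (U ^- m * mp v)%g &
            cy v <= - 2^-1 -> ch v < 0 -> fi v = (g^-1 * U ^- m * g * mm v)%g] &
      forall v, sphere4 v ->
        [/\ 0 <= cx v -> fo v = if 0 <= ch v then mp v else (g * mm v)%g,
            cx v <= - 2^-1 -> 0 <= ch v -> fo v = (V ^- l * mp v)%g &
            cx v <= - 2^-1 -> ch v < 0 -> fo v = (g * V ^- l * mm v)%g]].
Proof.
move=> lc chc U.
have li : locsys (lower n) c by apply: locsys_sub lc; exact: lower_compl.
have [rV [fi [f1 f2 f3 f4]]] := inside_struct m_gt0 li chc.
have lo : locsys (lower k) (fun u v => c (flip u) (flip v)).
  apply: (locsys_pull _ (@flip_cont R _) lc) => v lv.
  by apply: upper_compl; rewrite flipK.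
have [rB [fo [p1 p2 p3 p4]]] := inside_struct l_gt0 lo (charts_flip chc).
rewrite invg1 mulg1 mul1g in rB p3 p4; rewrite mulg1 in rV.
have Um : ((g^-1 * gB1) ^+ m = g^-1 * U ^+ m * g)%g.
  have := conjXg U g m; rewrite !conjgE /U !mulgA mulgVK.
  by move=> <-.
split.
  split; first by rewrite /U -rB.
  by rewrite rV Um !invgM invgK !mulgA.
exists fi, (fo \o @flip R); split.
- move=> Q v sQ lv h1 h2; apply: f1 => //; rewrite invg1 mulg1//.
- move=> Q v sQ lv h1 h2.
  have r : red_at (lower k) (fun u v => c (flip u) (flip v)) Q fo (flip v).
    apply: p1 => // h0 x0.
    by rewrite mul1g; have [_ _ QV] := sQ; apply: QV; exact: h1.
  have r' := red_at_pull (A := lower k \o @flip R) (f := @flip R)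
    (fun _ h => h) (@flip_cont R _) lv r.
  by apply: filterS r' => w; rewrite !flipK.
- move=> v sv; split.
  + by move=> y0; rewrite f2// /tag mul1g.
  + by move=> y0 h0; rewrite f3.
  + by move=> y0 h0; rewrite f4// mul1g Um !invgM invgK !mulgA.
- move=> v sv; have s' := sphere4_flip sv.
  have [e1 e2] : cy (flip v) = cx v /\ ch (flip v) = ch v by rewrite flipE !cE.
  split.
  + by move=> y0; rewrite /= p2 ?e1// /tag e2 /= flipK.
  + by move=> y0 h0; rewrite /= p3 ?e1 ?e2//= flipK.
  + by move=> y0 h0; rewrite /= p4 ?e1 ?e2//= flipK.
Qed.

Lemma red_at_conj (T : topologicalType) (A : set T) (c : T -> T -> G) Q f x h :
  red_at A c [set y | Q (h * y * h^-1)%g] f x ->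
  red_at A c Q (fun y => h * f y)%g x.
Proof.
by apply: filterS => y H Ay; have := H Ay; rewrite /= invgM !mulgA.
Qed.

Lemma subgroup_conj (Q : set G) h : subgroup Q ->
  subgroup [set y | Q (h * y * h^-1)%g].
Proof.
move=> [Q1 QM QV]; split=> /=.
- by rewrite mulg1 mulgV.
- move=> x y hx hy; have := QM _ _ hx hy; congr Q.
  by rewrite -!mulgA mulKg.
- move=> x /QV; congr Q; by rewrite !invgM invgK !mulgA.
Qed.

(** Points of the sphere w = 0 carry the inside gauge. At such a point [v] an outside neighbour is
    compared with [F1 v] instead of [F2 v], and the seam condition at [v] makes up for it. *)
Lemma red_at_glue c Q (F1 F2 F : V4 -> G) v :
  subgroup Q -> X v ->
  (cw v <= 0 -> red_at (lower n) c Q F1 v) ->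
  (0 <= cw v -> red_at (lower k \o @flip R) c Q F2 v) ->
  (cw v = 0 -> Q (F1 v * (F2 v)^-1)%g) ->
  (\forall w \near v, X w -> F w = if cw w <= 0 then F1 w else F2 w) ->
  red_at X c Q F v.
Proof.
move=> [Q1 QM QV] Xv r1 r2 seam FE.
have ccw := @continuous_cont_on _ _ X _ (@cw_cont R).
have Fv := nbhs_singleton FE Xv.
have [w0|w0|w0] := ltgtP (cw v) 0.
- apply: filterS3 (r1 (ltW w0)) FE (near_lt ccw Xv w0) => w h1 h2 h3 Xw.
  have w1 := ltW (h3 Xw); rewrite Fv h2// (ltW w0) w1.
  by apply: h1; exact: compl_lower.
- apply: filterS3 (r2 (ltW w0)) FE (near_gt ccw Xv w0) => w h1 h2 h3 Xw.
  have w1 := h3 Xw; rewrite Fv h2// leNgt w0 leNgt w1 /=.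
  by apply: h1; exact/compl_upper/ltW.
have Q0 := seam w0.
have {}r1 : red_at (lower n) c Q F1 v by apply: r1; rewrite w0.
have {}r2 : red_at (lower k \o @flip R) c Q F2 v by apply: r2; rewrite w0.
apply: filterS3 r1 r2 FE => w h1 h2 h3 Xw.
rewrite Fv h3// w0 lexx; have [w1|w1] := leP (cw w) 0.
  by apply: h1; exact: compl_lower.
have := QM _ _ Q0 (h2 (compl_upper Xw (ltW w1))).
by rewrite !mulgA mulgVK.
Qed.

End Global.

(** * The longitude commutes with the meridian *)

Section GroupIdentities.
Variables (G : groupType) (m l : nat) (g U V : G).
Local Open Scope group_scope.
Hypothesis rel : rels m l g U V.

(** Transport along a closed parallel of the knot, which runs inside, outside, inside, outside; see
    [extract_longitude]. *)
Definition longitude : G := U ^- m * V ^- l * U ^+ m * V ^+ l.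

Lemma rel_gV : g * V ^- l * g^-1 = V ^- l * U.
Proof. by case: rel => -> _; rewrite !mulgA mulVg mul1g. Qed.

Lemma rel_gVl : g * V ^+ l * g^-1 = U^-1 * V ^+ l.
Proof. by apply: invg_inj; rewrite !invgM !invgK !mulgA rel_gV. Qed.

Lemma rel_gU : g^-1 * U ^- m * g = U ^- m * V.
Proof. by have [_ ->] := rel; rewrite !mulgA mulVg mul1g. Qed.

Lemma rel_gUm : g^-1 * U ^+ m * g = V^-1 * U ^+ m.
Proof. by apply: invg_inj; rewrite !invgM !invgK !mulgA rel_gU. Qed.

(** As U commutes with its powers, the longitude is U^-m (V^-l U) U^m (U^-1 V^l), where both
    brackets are conjugates by g. Once g has been moved to the front, the same device works with V
    and the powers of U. *)
Lemma longitude_comm : longitude * g = g * longitude.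
Proof.
have UU : U * U ^+ m = U ^+ m * U by rewrite -expgS -expgSr.
have E : longitude = U ^- m * (V ^- l * U) * U ^+ m * (U^-1 * V ^+ l).
  rewrite /longitude -[X in X = _]mulgA -[X in _ = X]mulgA !mulgA.
  by rewrite -(mulgA _ U) UU !mulgA mulgK.
rewrite {1}E -rel_gV -rel_gVl.
have -> : U ^- m * (g * V ^- l * g^-1) * U ^+ m * (g * V ^+ l * g^-1) * g =
    g * (g^-1 * U ^- m * g) * V ^- l * (g^-1 * U ^+ m * g) * V ^+ l.
  by rewrite !mulgA mulgVK mulgV mul1g.
have VV : V * V ^- l = V ^- l * V.
  exact: commuteV (commuteX l (commute_refl V)).
by rewrite rel_gU rel_gUm /longitude !mulgA -(mulgA _ V) VV !mulgA mulgK.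
Qed.

End GroupIdentities.

(** * Gauges near the knot *)

Lemma half_lt_norm (R : realType) (x : R) : x ^+ 2 = 2^-1 -> 2^-1 < `|x|.
Proof.
move=> x2; rewrite ltNge; apply/negP => h.
have : `|x| * `|x| <= 2^-1 * 2^-1 by apply: ler_pM.
by rewrite -expr2 real_normK ?num_real// x2; lra.
Qed.

Section NearKnot.
Variables (R : realType) (G : groupType).
Local Notation V4 := 'rV[R]_4.
Implicit Types (v : V4) (c : V4 -> V4 -> G).
Variables (m l : nat).
Hypotheses (m_gt0 : (0 < m)%N) (l_gt0 : (0 < l)%N).
Local Notation n := (2 * m)%N.
Local Notation k := (2 * l)%N.
Local Notation X := (@knot_compl R n k).
Local Notation K := (double_twist R n k).

Let en : ~~ odd n := even_n m.
Let ek : ~~ odd k := even_n l.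

(** After untwisting, the strands sit at x = 1/sqrt 2 and x = -1/sqrt 2, so nearby the sign of
    [cx (ret j v)] names the strand. *)
Lemma core_near (j : nat) k0 : ~~ odd j -> @S3 R k0 -> core j k0 ->
  [/\ cx (ret j k0) != 0,
    \forall v \near k0, 2^-1 < rad v &
    \forall v \near k0, (0 < cx (ret j v)) = (0 < cx (ret j k0)) /\
      cx (ret j v) != 0].
Proof.
move=> ej Sk [r2 e0].
have r12 : 2^-1 < rad k0.
  rewrite -(@ltr_pXn2r _ 2) ?nnegrE ?invr_ge0 ?rad_ge0// r2 expr2; lra.
have x0 : cx (ret j k0) != 0.
  have tE : twa k0 = ang k0 by rewrite /twa chi1 ?mulr1// ltW.
  rewrite retE tE cE -sqrf_eq0.
  have := rot_sqr (cx k0) (ch k0) (cos2Dsin2 (j%:R * ang k0)).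
  by rewrite e0 (S3_rad Sk) r2 expr0n addr0 => ->; apply/eqP; lra.
have crad := continuous_cont_on (A := setT) (@rad_cont R).
have cxr : cont_on setT (fun v => cx (ret j v)).
  apply: (cont_on_comp (B := setT)) => //; first exact: ret_cont.
  exact/continuous_cont_on/cx_cont.
split=> //.
  by apply: filterS (near_gt crad I r12) => v; exact.
have [xp|xn|/eqP] := ltgtP (cx (ret j k0)) 0; last by rewrite (negPf x0).
  by apply: filterS (near_lt cxr I xp) => v /(_ I) h; rewrite ltNge (ltW h) lt_eqF.
by apply: filterS (near_gt cxr I xn) => v /(_ I) h; rewrite h gt_eqF.
Qed.

(* v lies on the separating sphere near one of the four crossing points of the
   knot with it. *)
Lemma ret_equator (j : nat) v : ~~ odd j -> cw v = 0 -> 2^-1 < rad v ->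
  cx (ret j v) = cx v /\ (0 <= cy v \/ cy v <= - 2^-1).
Proof.
move=> ej w0; rewrite /rad w0 expr0n addr0 sqrtr_sqr.
have [y0|y0] := leP 0 (cy v); first by move=> _; rewrite ret_fix//; auto.
rewrite ltr0_norm// => y1; have y2 : cy v <= - 2^-1 by lra.
by rewrite ret_far// cE; auto.
Qed.

Section Glue.
Variables (c : V4 -> V4 -> G) (mp mm fi fo : V4 -> G) (g gB1 U V : G).
Hypothesis lc : locsys X c.
Hypothesis fiQ : forall Q v, subgroup Q -> lower n v ->
  (ch (ret n v) = 0 -> 0 < cx (ret n v) -> Q g) ->
  (ch (ret n v) = 0 -> cx (ret n v) < 0 -> Q gB1) ->
  red_at (lower n) c Q fi v.
Hypothesis foQ : forall Q v, subgroup Q -> lower k (flip v) ->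
  (ch (ret k (flip v)) = 0 -> 0 < cx (ret k (flip v)) -> Q g) ->
  (ch (ret k (flip v)) = 0 -> cx (ret k (flip v)) < 0 -> Q (V * g^-1)%g) ->
  red_at (lower k \o @flip R) c Q fo v.
Hypothesis fiE : forall v, sphere4 v ->
  [/\ 0 <= cy v -> fi v = if 0 <= ch v then mp v else mm v,
      cy v <= - 2^-1 -> 0 <= ch v -> fi v = (U ^- m * mp v)%g &
      cy v <= - 2^-1 -> ch v < 0 -> fi v = (g^-1 * U ^- m * g * mm v)%g].
Hypothesis foE : forall v, sphere4 v ->
  [/\ 0 <= cx v -> fo v = if 0 <= ch v then mp v else (g * mm v)%g,
      cx v <= - 2^-1 -> 0 <= ch v -> fo v = (V ^- l * mp v)%g &
      cx v <= - 2^-1 -> ch v < 0 -> fo v = (g * V ^- l * mm v)%g].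

(** One strand of each region keeps its gauge and the other is translated; [k1] and [k2] are to make
    the four gauges fit where the strands meet. *)
Definition glued (k1 k2 : G) v : G :=
  if cw v <= 0 then (if 0 < cx (ret n v) then fi v else k1 * fi v)%g
  else (if 0 < cx (ret k (flip v)) then fo v else k2 * fo v)%g.

Lemma near_glued (Q : set G) k1 k2 k0 : subgroup Q -> K k0 ->
  Q g -> Q (k1 * gB1 * k1^-1)%g -> Q (k2 * (V * g^-1) * k2^-1)%g ->
  (cw k0 = 0 -> cx k0 < 0 -> 0 < cy k0 ->
     Q (k1 * V ^+ l)%g /\ Q (k1 * V ^+ l * g^-1)%g) ->
  (cw k0 = 0 -> cx k0 < 0 -> cy k0 < 0 ->
     Q (k1 * U ^- m * V ^+ l * k2^-1)%g /\
     Q (k1 * (g^-1 * U ^- m * g) * V ^+ l * g^-1 * k2^-1)%g) ->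
  (cw k0 = 0 -> 0 < cx k0 -> cy k0 < 0 ->
     Q (U ^- m * k2^-1)%g /\ Q (g^-1 * U ^- m * g * g^-1 * k2^-1)%g) ->
  \forall v \near k0, X v -> red_at X c Q (glued k1 k2) v.
Proof.
move=> sQ Kk Qg Q1 Q2 Smp Smm Spm; have [Qe QM QV] := sQ.
have Sk : @S3 R k0 by exact: double_twist_S3 Kk.
have ccw := continuous_cont_on (A := setT) (@cw_cont R).
have sw1 : \forall v \near k0, (cw k0 < 0 -> cw v < 0) /\ (0 < cw k0 -> 0 < cw v).
  have [w0|w0|w0] := ltgtP (cw k0) 0.
  - by apply: filterS (near_lt ccw I w0) => v /(_ I).
  - by apply: filterS (near_gt ccw I w0) => v /(_ I).
  - by near=> v; split.
have lowP : cw k0 <= 0 -> \forall v \near k0,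
    [/\ 2^-1 < rad v, cx (ret n v) != 0 &
    (0 < cx (ret n v)) = (0 < cx (ret n k0))].
  move=> w0; have [_ h1 h2] := core_near en Sk ((double_twist_lower en ek Sk w0).1 Kk).
  by apply: filterS2 h1 h2 => v ? [].
have upP : 0 <= cw k0 -> \forall v \near k0,
    [/\ 2^-1 < rad (flip v), cx (ret k (flip v)) != 0 &
    (0 < cx (ret k (flip v))) = (0 < cx (ret k (flip k0)))].
  move=> w0.
  have Kf : double_twist R k n (flip k0) by apply/double_twist_flip.
  have w1 : cw (flip k0) <= 0 by rewrite flipE cE oppr_le0.
  have [_ h1 h2] := core_near ek (flip_S3 Sk)
    ((double_twist_lower ek en (flip_S3 Sk) w1).1 Kf).
  have cf := @flip_cont R setT k0 I.
  by apply: filterS2 (cf _ h1) (cf _ h2) => v /(_ I) ? /(_ I) [].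
have lowP' : \forall v \near k0, cw v <= 0 ->
    [/\ 2^-1 < rad v, cx (ret n v) != 0 &
    (0 < cx (ret n v)) = (0 < cx (ret n k0))].
  have [w0|w0] := leP (cw k0) 0; first by apply: filterS (lowP w0) => v ? _.
  by apply: filterS sw1 => v [_ /(_ w0)]; rewrite ltNge => /negPf ->.
have upP' : \forall v \near k0, 0 <= cw v ->
    [/\ 2^-1 < rad (flip v), cx (ret k (flip v)) != 0 &
    (0 < cx (ret k (flip v))) = (0 < cx (ret k (flip k0)))].
  have [w0|w0] := leP 0 (cw k0); first by apply: filterS (upP w0) => v ? _.
  by apply: filterS sw1 => v [/(_ w0)]; rewrite ltNge => /negPf ->.
near=> v => Xv; have [Sv _] := Xv.
have low_v : cw v <= 0 -> [/\ 2^-1 < rad v, cx (ret n v) != 0 &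
    (0 < cx (ret n v)) = (0 < cx (ret n k0))] by near: v.
have up_v : 0 <= cw v -> [/\ 2^-1 < rad (flip v), cx (ret k (flip v)) != 0 &
    (0 < cx (ret k (flip v))) = (0 < cx (ret k (flip k0)))] by near: v.
have low_w : \forall w \near v, cw w <= 0 -> [/\ 2^-1 < rad w, cx (ret n w) != 0 &
    (0 < cx (ret n w)) = (0 < cx (ret n k0))].
  by near: v; exact: (nbhs_interior lowP').
have up_w : \forall w \near v, 0 <= cw w -> [/\ 2^-1 < rad (flip w), cx (ret k (flip w)) != 0 &
    (0 < cx (ret k (flip w))) = (0 < cx (ret k (flip k0)))].
  by near: v; exact: (nbhs_interior upP').
have sw : (cw k0 < 0 -> cw v < 0) /\ (0 < cw k0 -> 0 < cw v) by near: v.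
(* Near [k0] the sign tests of [glued] are constant and can be frozen at [k0]. *)
pose F1 w := (if 0 < cx (ret n k0) then fi w else k1 * fi w)%g.
pose F2 w := (if 0 < cx (ret k (flip k0)) then fo w else k2 * fo w)%g.
apply: (red_at_glue (F1 := F1) (F2 := F2) sQ Xv).
- move=> w0; have [_ x0 xs] := low_v w0; have lv := compl_lower Xv w0.
  rewrite /F1 -xs; case xp: (0 < cx (ret n v)).
    by apply: fiQ => // _; rewrite ltNge ltW.
  by apply: red_at_conj; apply: fiQ => //; [exact: subgroup_conj|rewrite xp].
- move=> w0; have [_ x0 xs] := up_v w0; have lv := compl_upper Xv w0.
  rewrite /F2 -xs; case xp: (0 < cx (ret k (flip v))).
    by apply: foQ => // _; rewrite ltNge ltW.
  by apply: red_at_conj; apply: foQ => //; [exact: subgroup_conj|rewrite xp].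
- move=> w0.
  have wk0 : cw k0 = 0.
    have [a b] := sw; have [h|h|//] := ltgtP (cw k0) 0.
      by have := a h; rewrite w0 ltxx.
    by have := b h; rewrite w0 ltxx.
  have sv : sphere4 v.
    by apply: (lower_sphere4 en _ w0); apply: (compl_lower Xv); rewrite w0.
  have [r1 x1 s1] := low_v (eq_ind_r (fun z => z <= 0) (lexx 0) w0).
  have [r2 x2 s2] := up_v (eq_ind_r (fun z => 0 <= z) (lexx 0) w0).
  have fw0 : cw (flip v) = 0 by rewrite flipE cE w0 oppr0.
  have [e1 d1] := ret_equator en w0 r1.
  have [e2 d2] := ret_equator ek fw0 r2.
  have [e3 e4] : cx (flip v) = cy v /\ cy (flip v) = cx v by rewrite flipE !cE.
  rewrite e3 in e2; rewrite e4 in d2; rewrite e1 in x1 s1; rewrite e2 in x2 s2.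
  have wk1 : cw k0 <= 0 by rewrite wk0.
  have ck := (double_twist_lower en ek Sk wk1).1 Kk.
  have [ch0 xy] := (core_eq en Sk wk0).1 ck.
  have yk2 : cy k0 ^+ 2 = 2^-1.
    by have [+ _] := ck; rewrite rad2 wk0 expr0n addr0.
  have [xk _] : cx (ret n k0) = cx k0 /\ (0 <= cy k0 \/ cy k0 <= - 2^-1).
    apply: ret_equator => //; rewrite /rad wk0 expr0n addr0 sqrtr_sqr.
    exact: half_lt_norm.
  have [yk _] : cx (ret k (flip k0)) = cx (flip k0) /\
      (0 <= cy (flip k0) \/ cy (flip k0) <= - 2^-1).
    apply: ret_equator => //; first by rewrite flipE cE wk0 oppr0.
    rewrite /rad flipE !cE wk0 oppr0 expr0n addr0 sqrtr_sqr.
    by apply: half_lt_norm; rewrite xy.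
  have yk' : cx (flip k0) = cy k0 by rewrite flipE cE.
  have neg (x y : R) : x != 0 -> y ^+ 2 = 2^-1 -> (0 < x) = (0 < y) -> x <= 0 ->
      x < 0 /\ y < 0.
    move=> x0 y2 xyE xn; split; first by rewrite lt_neqAle x0.
    move: xyE; rewrite ltNge xn /= => /esym/negbT; rewrite -leNgt le_eqVlt.
    by case/orP=> // /eqP y0; move: y2; rewrite y0 expr0n => /eqP; rewrite eq_sym invr_eq0 pnatr_eq0.
  have [i1 i2 i3] := fiE sv; have [p1 p2 p3] := foE sv.
  rewrite xk in s1; rewrite yk yk' in s2.
  rewrite /F1 /F2 xk yk yk' -s1 -s2; have [xp|xn] := ltP 0 (cx v).
    rewrite s1 in xp; have xp' : 0 < cx v by rewrite s1.
    have {}p1 := p1 (ltW xp').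
    have [yp|yn] := ltP 0 (cy v).
      have {}i1 := i1 (ltW yp); rewrite i1 p1.
      case: ifP => _; first by rewrite mulgV.
      by rewrite invgM mulgA mulgV mul1g; exact: QV.
    have [yn' ykn] := neg _ _ x2 yk2 s2 yn.
    have y12 : cy v <= - 2^-1 by case: d1 => // /(lt_le_trans yn'); rewrite ltxx.
    have [q1 q2] := Spm wk0 xp ykn.
    rewrite p1; have [h0|h0] := leP 0 (ch v).
      by rewrite i2// invgM !mulgA mulgK.
    by rewrite i3// !invgM !mulgA mulgK.
  have [xn' xkn] := neg _ _ x1 (etrans xy yk2) s1 xn.
  have x12 : cx v <= - 2^-1 by case: d2 => // /(lt_le_trans xn'); rewrite ltxx.
  have [yp|yn] := ltP 0 (cy v).
    have ykp : 0 < cy k0 by rewrite -s2.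
    have {}i1 := i1 (ltW yp); have [q1 q2] := Smp wk0 xkn ykp.
    rewrite i1; have [h0|h0] := leP 0 (ch v).
      by rewrite p2// !invgM invgK !mulgA mulgK.
    by rewrite p3// !invgM invgK !mulgA mulgK.
  have [yn' ykn] := neg _ _ x2 yk2 s2 yn.
  have y12 : cy v <= - 2^-1 by case: d1 => // /(lt_le_trans yn'); rewrite ltxx.
  have [q1 q2] := Smm wk0 xkn ykn.
  have [h0|h0] := leP 0 (ch v).
    by rewrite i2// p2// !invgM invgK !mulgA mulgK.
  by rewrite i3// p3// !invgM invgK !mulgA mulgK; move: q2; rewrite !mulgA.
- apply: filterS2 low_w up_w => w hl hu Xw; rewrite /glued /F1 /F2.
  have [w0|w0] := leP (cw w) 0.
    by have [_ _ ->] := hl w0.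
  by have [_ _ ->] := hu (ltW w0).
Unshelve. all: by end_near. Qed.

End Glue.

End NearKnot.

Section PeripheralIdentities.
Variables (G : groupType) (m l : nat) (g U V : G).
Local Open Scope group_scope.
Hypothesis rel : rels m l g U V.
Local Notation L := (longitude m l U V).

Lemma longitude_fix : L * g * L^-1 = g.
Proof. by rewrite longitude_comm// mulgK. Qed.

Lemma longitudeV : V ^- l * U ^- m * V ^+ l * U ^+ m = L^-1.
Proof. by rewrite /longitude !invgM !invgK !mulgA. Qed.

Lemma rel_conj_V : U ^- m * (V * g^-1) * U ^+ m = g^-1.
Proof.
have [_ rV] := rel; rewrite [X in U ^- m * (X * _)]rV.
by rewrite !mulgA mulVg mul1g mulgK mulgVK.
Qed.

(** The fit demanded by the lower hemisphere at the corner x, y < 0; it rests on the longitude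
    commuting with g. *)
Lemma rel_conj_far :
  L * V ^- l * (g^-1 * U ^- m * g) * V ^+ l * g^-1 * U ^+ m = g^-1.
Proof.
have UU : U * U ^- m = U ^- m * U.
  exact: commuteV (commuteX m (commute_refl U)).
transitivity (L * (g^-1 * (g * V ^- l * g^-1)) * U ^- m *
    (g * V ^+ l * g^-1) * U ^+ m).
  by rewrite !mulgA mulgVK.
rewrite (rel_gV rel) (rel_gVl rel).
transitivity (L * g^-1 * (V ^- l * U ^- m * V ^+ l * U ^+ m)).
  by rewrite !mulgA -(mulgA _ U) UU !mulgA mulgK.
rewrite longitudeV; have := congr1 (fun x => x^-1) longitude_fix.
by move: (longitude m l U V) => x /=; rewrite !invgM invgK !mulgA => ->.
Qed.

End PeripheralIdentities.

(** * Reductions near the knot and on the whole complement *)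

Section Reductions.
Variables (R : realType) (G : groupType).
Local Notation V4 := 'rV[R]_4.
Implicit Types (v : V4) (c : V4 -> V4 -> G).
Variables (m l : nat).
Hypotheses (m_gt0 : (0 < m)%N) (l_gt0 : (0 < l)%N).
Local Notation n := (2 * m)%N.
Local Notation k := (2 * l)%N.
Local Notation X := (@knot_compl R n k).
Local Notation K := (double_twist R n k).

Let en : ~~ odd n := even_n m.
Let ek : ~~ odd k := even_n l.

Variables (c : V4 -> V4 -> G) (mp mm : V4 -> G) (gB1 V g : G).
Hypotheses (lc : locsys X c) (chc : charts c mp mm 1%g gB1 V g).
Local Notation U := (gB1 * g^-1)%g.

Lemma charts_rels : rels m l g U V.
Proof. by have [] := global_struct m_gt0 l_gt0 lc chc. Qed.

Lemma rel_gB1 : gB1 = (V ^+ l * g * V ^- l)%g.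
Proof.
have [rU _] := charts_rels.
by rewrite -[LHS](mulgVK g) rU mulgVK.
Qed.

(** The constants make the gauges fit, up to powers of g, at all corners but x < 0 < y, where the
    holonomy around the knot accumulates and the mismatch is the longitude. One gauge serves all
    [Q]. *)
Lemma near_knot : exists F : V4 -> G, forall Q k0, subgroup Q -> K k0 ->
  Q g -> Q (longitude m l U V) ->
  \forall v \near k0, X v -> red_at X c Q F v.
Proof.
have [rel [fi [fo [f1 f2 f3 f4]]]] := global_struct m_gt0 l_gt0 lc chc.
exists (glued m l fi fo (longitude m l U V * V ^- l)%g (U ^- m)%g).
move=> Q k0 sQ Kk Qg QL; have [Q1 QM QV] := sQ.
apply: (near_glued f1 f2 f3 f4) => //.
- rewrite {2}rel_gB1 invgM invgK !mulgA mulgVK mulgVK (longitude_fix rel).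
  exact: Qg.
- by rewrite invgK (rel_conj_V rel); exact: QV.
- by move=> _ _ _; rewrite mulgVK; split=> //; apply: QM => //; exact: QV.
- move=> _ _ _; rewrite invgK (rel_conj_far rel); split; last exact: QV.
  have -> : (longitude m l U V * V ^- l * U ^- m * V ^+ l * U ^+ m =
    longitude m l U V * (V ^- l * U ^- m * V ^+ l * U ^+ m))%g by rewrite !mulgA.
  by rewrite longitudeV mulgV.
- move=> _ _ _; rewrite invgK mulVg; split=> //.
  by rewrite mulgK mulgVK; exact: QV.
Qed.

(** The mismatch by the longitude can be moved away from any given point: the gauge of [near_knot]
    leaves it at x < 0 < y, and at that corner the choice [k1 = V ^- l] makes the gauges fit. *)
Lemma near_knot_point k0 : K k0 -> exists F : V4 -> G,
  forall Q, subgroup Q -> Q g -> \forall v \near k0, X v -> red_at X c Q F v.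
Proof.
move=> Kk; have [rel [fi [fo [f1 f2 f3 f4]]]] := global_struct m_gt0 l_gt0 lc chc.
have [d1|nd1] := pselect (cx k0 < 0 /\ 0 < cy k0).
  exists (glued m l fi fo (V ^- l)%g (U ^- m)%g) => Q sQ Qg; have [Q1 QM QV] := sQ.
  apply: (near_glued f1 f2 f3 f4) => //.
  - by rewrite rel_gB1 invgK !mulgA mulVg mul1g mulgVK.
  - by rewrite invgK (rel_conj_V rel); exact: QV.
  - by move=> _ _ _; rewrite mulVg mul1g; split=> //; exact: QV.
  - by move=> _ _ y0; case: d1 => _; rewrite ltNge (ltW y0).
  - by move=> _ x0; case: d1; rewrite ltNge (ltW x0).
exists (glued m l fi fo (longitude m l U V * V ^- l)%g (U ^- m)%g).
move=> Q sQ Qg; have [Q1 QM QV] := sQ.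
apply: (near_glued f1 f2 f3 f4) => //.
- rewrite {2}rel_gB1 invgM invgK !mulgA mulgVK mulgVK (longitude_fix rel).
  exact: Qg.
- by rewrite invgK (rel_conj_V rel); exact: QV.
- by move=> _ x0 y0; case: nd1.
- move=> _ _ _; rewrite invgK (rel_conj_far rel); split; last exact: QV.
  have -> : (longitude m l U V * V ^- l * U ^- m * V ^+ l * U ^+ m =
    longitude m l U V * (V ^- l * U ^- m * V ^+ l * U ^+ m))%g by rewrite !mulgA.
  by rewrite longitudeV mulgV.
- move=> _ _ _; rewrite invgK mulVg; split=> //.
  by rewrite mulgK mulgVK; exact: QV.
Qed.

(** On a hemisphere both gauges and the chart reduce to [Q] and differ at the pole by elements of
    [Q]; by [half_red2] they do so everywhere, hence the two sides fit along the whole sphere. *)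
Lemma red_compl : exists F : V4 -> G, forall Q, subgroup Q ->
  Q g -> Q U -> Q V -> red X c Q F.
Proof.
have [rel [fi [fo [f1 f2 f3 f4]]]] := global_struct m_gt0 l_gt0 lc chc.
exists (fun v => if cw v <= 0 then fi v else fo v) => Q sQ Qg QU QV'.
have [Q1 QM QV] := sQ; have [tp tm _] := chc.
have QB1 : Q gB1 by rewrite -[gB1](mulgVK g); exact: QM.
have r1 v : lower n v -> red_at (lower n) c Q fi v by move=> lv; exact: f1.
have r2 v : lower k (flip v) -> red_at (lower k \o @flip R) c Q fo v.
  by move=> lv; apply: f2 => // _ _; apply: QM => //; exact: QV.
have n1 : (-1) ^+ 2 = 1 :> R by rewrite sqrrN expr1n.
have p1 : 1 ^+ 2 = 1 :> R by rewrite expr1n.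
have hl e v : half e v -> lower n v by move=> [/(sphere4_lower en)].
have hu e v : half e v -> lower k (flip v).
  by move=> [/sphere4_flip /(sphere4_lower ek)].
have hr1 e : red (half e) c Q fi.
  by move=> v hv; apply: filterS (r1 v (hl e v hv)) => w h hw; exact: h (hl e w hw).
have hr2 e : red (half e) c Q fo.
  by move=> v hv; apply: filterS (r2 v (hu e v hv)) => w h hw; exact: h (hu e w hw).
have poleE (e : R) : e ^+ 2 = 1 -> half e (pole e).
  move=> e2; rewrite /pole; split; last by rewrite chE -expr2 e2.
  split; [by apply/S3E; rewrite !cE e2; ring|by rewrite cwE|].
  by rewrite !cE => -[e0 _]; rewrite e0 expr2 in e2; lra.
have half_eq (e : R) me f v : e ^+ 2 = 1 -> triv (half e) c me ->
    red (half e) c Q f -> Q (me (pole e) * (f (pole e))^-1)%g -> half e v ->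
    Q (me v * (f v)^-1)%g.
  move=> e2 te rf Q0 hv.
  have [|q1 [q2 [-> h2 ->]]] := half_red2 e2 (@subgroup1 G) sQ
    (fun _ h => h) _ te rf hv; first by move=> s s01; exact: contr_half.
  by rewrite mul1g; apply: QM.
have pole_s (e : R) : e ^+ 2 = 1 -> sphere4 (pole e).
  by move=> e2; case: (poleE e e2).
have seam v : sphere4 v -> Q (fi v * (fo v)^-1)%g.
  move=> sv.
  have [e [me [e2 te]]] : exists e me, [/\ e ^+ 2 = 1, triv (half e) c me,
      half e v & Q (me (pole e) * (fi (pole e))^-1)%g /\
      Q (me (pole e) * (fo (pole e))^-1)%g].
    have [h0|h0] := leP 0 (ch v).
      exists 1, mp; split=> //; first by split=> //; rewrite mul1r.
      have [h3 _ _] := f3 _ (pole_s 1 p1); have [h4 _ _] := f4 _ (pole_s 1 p1).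
      by rewrite h3 ?cyE// h4 ?cxE// chE ler01 mulgV.
    exists (-1), mm; split=> //; first by split=> //; rewrite mulN1r oppr_ge0 ltW.
    have [h3 _ _] := f3 _ (pole_s _ n1); have [h4 _ _] := f4 _ (pole_s _ n1).
    rewrite h3 ?cyE// h4 ?cxE// chE oppr_ge0 ler10 mulgV invgM mulgA mulgV mul1g.
    by split=> //; exact: QV.
  move=> hv [Qi Qo].
  have Hi := half_eq e me fi v e2 te (hr1 e) Qi hv.
  have Ho := half_eq e me fo v e2 te (hr2 e) Qo hv.
  have := QM _ _ (QV _ Hi) Ho.
  by rewrite invgM invgK !mulgA mulgVK.
move=> v Xv; apply: (red_at_glue (F1 := fi) (F2 := fo) sQ Xv).
- by move=> w0; apply: r1; exact: (compl_lower Xv w0).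
- by move=> w0; apply: r2; exact: (compl_upper Xv w0).
- move=> w0; apply: seam; apply: (lower_sphere4 en _ w0).
  by apply: (compl_lower Xv); rewrite w0.
- by near=> w.
Unshelve. all: by end_near. Qed.

End Reductions.

(** * Images of the longitude and of the meridian *)

Section Push.
Variables (R : realType) (G : groupType).
Local Notation V4 := 'rV[R]_4.
Local Notation itv a b := [set s : R | a <= s <= b].
Implicit Types (v : V4) (c : V4 -> V4 -> G).

(* z.1 is the distance from the strand s and z.2 the position along it. *)
Definition push (j : nat) (s : R) (z : R * R) : V4 :=
  let b := Num.sqrt ((1 - z.1 ^+ 2) / 2) in let t := z.2 in
  vec4 (s * b * cos (j%:R * t) + z.1 * sin (j%:R * t)) (b * cos t)
    (- (b * sin t)) (z.1 * cos (j%:R * t) - s * b * sin (j%:R * t)).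

Lemma push_cont j s (A : set (R * R)) : cont_on A (push j s).
Proof.
have c1 : cont_on A (fun z => z.1) by apply: continuous_cont_on => z; exact: cvg_fst.
have c2 : cont_on A (fun z => z.2) by apply: continuous_cont_on => z; exact: cvg_snd.
have cb : cont_on A (fun z => Num.sqrt ((1 - z.1 ^+ 2) / 2)).
  apply: cont_on_comp1; last exact: sqrt_continuous.
  apply: cont_onM; last exact: cont_on_cst.
  by apply: cont_onD; [exact: cont_on_cst|apply: cont_onN; exact: cont_on_sqr].
have cjt : cont_on A (fun z => j%:R * z.2) by apply: cont_onM => //; exact: cont_on_cst.
have cc := cont_on_comp1 cjt (@continuous_cos R).
have cs := cont_on_comp1 cjt (@continuous_sin R).
have csb : cont_on A (fun z => s * Num.sqrt ((1 - z.1 ^+ 2) / 2)).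
  by apply: cont_onM => //; exact: cont_on_cst.
apply: cont_on_vec4.
- by apply: cont_onD; exact: cont_onM.
- by apply: cont_onM => //; apply: cont_on_comp1 => //; exact: continuous_cos.
- apply: cont_onN; apply: cont_onM => //; apply: cont_on_comp1 => //; exact: continuous_sin.
- by apply: cont_onD; [|apply: cont_onN]; exact: cont_onM.
Qed.

Lemma push0 (j : nat) (s t : R) : 0 <= t <= pi -> s = 1 \/ s = -1 ->
  twist_region j (push j s (0, t)).
Proof.
move=> t0 s1; have mem : `[0, pi]%classic t by rewrite /= in_itv.
have -> : push j s (0, t) = strand j (- s) t.
  rewrite strandE /push /= expr0n subr0 div1r sqrtrV ?ler0n//.
  by congr vec4; ring.
by case: s1 => ->; rewrite ?opprK; [right|left]; exists t.
Qed.

Section Fixed.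
Variables (j : nat) (s e : R).
Hypotheses (ej : ~~ odd j) (s2 : s ^+ 2 = 1) (e0 : 0 < e) (e1 : e < 2^-1).
Local Notation b := (Num.sqrt ((1 - e ^+ 2) / 2)).

Lemma push_b : b ^+ 2 = (1 - e ^+ 2) / 2 /\ 2^-1 < b.
Proof.
have e2 : e ^+ 2 < 4^-1.
  by have := ltr_pM (ltW e0) (ltW e0) e1 e1; rewrite expr2; lra.
have bE : b ^+ 2 = (1 - e ^+ 2) / 2 by rewrite sqr_sqrtr; lra.
split=> //; rewrite -(@ltr_pXn2r _ 2) ?nnegrE ?invr_ge0 ?sqrtr_ge0// bE.
by rewrite (expr2 2^-1); lra.
Qed.

Lemma push_polar t : 0 <= t <= pi -> rad (push j s (e, t)) = b /\
  ang (push j s (e, t)) = t.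
Proof.
move=> t0; have [bE b12] := push_b.
apply: polar_uniq => //; last 2 first.
- by rewrite /push cyE.
- by rewrite /push cwE.
by apply: lt_trans b12; rewrite invr_gt0.
Qed.

(** The parallel stays in one fibre of [ret], at height e > 0 off the equator, so the inside gauge
    has no jump along it. *)
Lemma push_ret t : 0 <= t <= pi ->
  ret j (push j s (e, t)) = vec4 (s * b) b 0 e.
Proof.
move=> t0; have [bE b12] := push_b; have [er et] := push_polar t0.
have cs := cos2Dsin2 (j%:R * t).
rewrite retE er /twa er et chi1 ?mulr1; last exact: ltW.
rewrite /push !cE /=; set C := cos _ in cs *; set S := sin _ in cs *.
congr vec4.
  transitivity (s * b * (C ^+ 2 + S ^+ 2)); first by ring.
  by rewrite cs mulr1.
transitivity (e * (C ^+ 2 + S ^+ 2)); first by ring.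
by rewrite cs mulr1.
Qed.

Lemma push_lower t : 0 <= t <= pi -> lower j (push j s (e, t)).
Proof.
move=> t0; have [bE b12] := push_b; have [er et] := push_polar t0.
have cs := cos2Dsin2 (j%:R * t).
have sb : (s * b) ^+ 2 = (1 - e ^+ 2) / 2 by rewrite exprMn s2 mul1r bE.
split.
- apply/S3E; rewrite -addrA -addrA [_ + (cw _ ^+ 2 + _)]addrA.
  rewrite -rad2 er bE /push !cE /=.
  set C := cos _ in cs *; set S := sin _ in cs *.
  transitivity (((s * b) ^+ 2 + e ^+ 2) * (C ^+ 2 + S ^+ 2) + (1 - e ^+ 2) / 2).
    by ring.
  by rewrite sb cs; field.
- rewrite /push cE oppr_le0 mulr_ge0 ?sqrtr_ge0// sin_ge0_pi//.
- move=> [+ _]; rewrite er bE => /eqP.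
  by rewrite -[X in _ == X]mul1r (inj_eq (mulIf _)) ?invr_eq0 ?pnatr_eq0// subr_eq addrC -subr_eq subrr eq_sym sqrf_eq0 gt_eqF.
Qed.

Lemma push_ends : push j s (e, 0) = vec4 (s * b) b 0 e /\
  push j s (e, pi) = vec4 (s * b) (- b) 0 e.
Proof.
have [c1 s0] := @cos_sin_npi R j ej.
by rewrite /push /= mulr0 c1 s0 cos0 sin0 cospi sinpi; split; congr vec4; ring.
Qed.

Lemma push_red2 c Q f F : subgroup Q ->
  (forall t, 0 <= t <= pi -> red_at (lower j) c [set 1%g] f (push j s (e, t))) ->
  (forall t, 0 <= t <= pi -> red_at (lower j) c Q F (push j s (e, t))) ->
  let x := vec4 (s * b) b 0 e in let y := vec4 (s * b) (- b) 0 e in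
  Q ((f x * (F x)^-1)^-1 * (f y * (F y)^-1))%g.
Proof.
move=> sQ rf rF.
have pA t : itv 0 pi t -> lower j (push j s (e, t)) by move=> t0; exact: push_lower.
have cp : cont_on (itv 0 pi) (fun t => push j s (e, t)).
  apply: (cont_on_comp (B := setT)) => //; last exact: push_cont.
  apply: cont_on_pair; first exact: cont_on_cst.
  by apply: continuous_cont_on => t; exact: cvg_id.
have r1 : red (itv 0 pi) (fun t t' => c (push j s (e, t)) (push j s (e, t')))
    [set 1%g] (fun t => f (push j s (e, t))).
  by move=> t t0; apply: (red_at_pull pA cp) => //; exact: rf.
have r2 : red (itv 0 pi) (fun t t' => c (push j s (e, t)) (push j s (e, t')))
    Q (fun t => F (push j s (e, t))).
  by move=> t t0; apply: (red_at_pull pA cp) => //; exact: rF.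
have [q1 [q2 [-> h2]]] := itv_red2 (pi_ge0 R) (@subgroup1 G) sQ r1 r2.
by have [-> ->] := push_ends => E /=; rewrite E mul1g mulKg.
Qed.

End Fixed.

End Push.

Section PathFamilies.
Variables (R : realType) (G : groupType).
Local Notation V4 := 'rV[R]_4.
Local Notation itv a b := [set s : R | a <= s <= b].
Implicit Types (v : V4) (c : V4 -> V4 -> G).

(** The tube lemma: compactness of [[0, b]] makes the neighbourhoods along the limit path
    uniform. *)
Lemma path_family_near (p : R * R -> V4) (K : set V4) (W : V4 -> Prop) (b : R) :
  cont_on setT p -> (forall t, 0 <= t <= b -> K (p (0, t))) ->
  (forall x, K x -> \forall y \near x, W y) ->
  \forall e \near (0 : R), forall t, 0 <= t <= b -> W (p (e, t)).
Proof.
move=> cp Kp KW.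
have comp : compact [set` `[0, b]] by exact: segment_compact.
have H (t : R) : [set` `[0, b]] t ->
    \forall t' \near t & e \near (0 : R), W (p (e, t')).
  rewrite /= in_itv /= => t0.
  have [[/= P1 P2] [/= h1 h2] sub] := cp (0, t) I _ (KW _ (Kp t t0)).
  by exists (P2, P1) => // -[t' e'] [/= a1 a2]; exact: (sub (e', t')).
have H2 : \forall e \near (0 : R), [set` `[0, b]] `<=` (fun t => W (p (e, t))).
  exact: (compact_near_coveringP _).1 comp R (nbhs (0 : R))
    (fun e t => W (p (e, t))) _ H.
by apply: filterS H2 => e h t t0; apply: h; rewrite /= in_itv.
Qed.

Section Main.
Variables (m l : nat).
Hypotheses (m_gt0 : (0 < m)%N) (l_gt0 : (0 < l)%N).
Local Notation n := (2 * m)%N.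
Local Notation k := (2 * l)%N.
Local Notation X := (@knot_compl R n k).
Local Notation K := (double_twist R n k).

Let en : ~~ odd n := even_n m.
Let ek : ~~ odd k := even_n l.

Variables (c : V4 -> V4 -> G) (mp mm : V4 -> G) (gB1 V g : G).
Hypotheses (lc : locsys X c) (chc : charts c mp mm 1%g gB1 V g).
Local Notation U := (gB1 * g^-1)%g.

(** Along each of the four pushed-off strands the flat gauge is compared with [F]. The strands join
    at the points (b, b), (b, -b), (-b, -b), (-b, b) at height e and form a closed parallel. *)
Lemma extract_longitude Q F : subgroup Q ->
  (forall k0, K k0 -> \forall v \near k0, X v -> red_at X c Q F v) ->
  exists h, Q (h^-1 * longitude m l U V * h)%g.
Proof.
move=> sQ HF; have [Q1 QM QV] := sQ.
have [rel [fi [fo [f1 f2 f3 f4]]]] := global_struct m_gt0 l_gt0 lc chc.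
have [p1 n1] : (1 : R) ^+ 2 = 1 /\ (-1 : R) ^+ 2 = 1 by rewrite sqrrN expr1n.
have inK s : s = 1 \/ s = -1 -> \forall e \near (0 : R), forall t,
    0 <= t <= pi -> X (push n s (e, t)) -> red_at X c Q F (push n s (e, t)).
  move=> s1; apply: (path_family_near (K := K) (W := fun x => X x -> red_at X c Q F x)).
  - exact: push_cont.
  - by move=> t t0; left; exact: push0.
  - exact: HF.
have outK s : s = 1 \/ s = -1 -> \forall e \near (0 : R), forall t,
    0 <= t <= pi -> X (flip (push k s (e, t))) ->
    red_at X c Q F (flip (push k s (e, t))).
  move=> s1; apply: (path_family_near (K := K) (p := fun z => flip (push k s z))
    (W := fun x => X x -> red_at X c Q F x)).
  - by apply: (cont_on_comp (B := setT)) => //; [exact: push_cont|exact: flip_cont].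
  - by move=> t t0; right; exists (push k s (0, t)) => //; exact: push0.
  - exact: HF.
have [d d0 hd] : exists2 d : R, 0 < d & forall e, 0 < e -> e < d ->
   forall s t, s = 1 \/ s = -1 -> 0 <= t <= pi ->
   (X (push n s (e, t)) -> red_at X c Q F (push n s (e, t))) /\
   (X (flip (push k s (e, t))) -> red_at X c Q F (flip (push k s (e, t)))).
  have : \forall e \near (0 : R), forall s t, s = 1 \/ s = -1 -> 0 <= t <= pi ->
     (X (push n s (e, t)) -> red_at X c Q F (push n s (e, t))) /\
     (X (flip (push k s (e, t))) -> red_at X c Q F (flip (push k s (e, t)))).
    near=> e => s t [] -> t0; split; move: t t0; near: e;
      by [apply: inK; auto|apply: outK; auto].
  move=> /nbhs_ballP[/= d d0 hd]; exists d => // e e0 ed.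
  by apply: hd; rewrite /ball /= sub0r normrN gtr0_norm.
pose e := Num.min (d / 2) 4^-1.
have e0 : 0 < e by rewrite lt_min divr_gt0//= invr_gt0.
have ed : e < d by rewrite gt_min ltr_pdivrMr// mulr_natr mulr2n ltrDl d0.
have e12 : e < 2^-1 by rewrite gt_min ltf_pV2 ?posrE// ltr_nat orbT.
have {hd} hd := hd e e0 ed.
set b := Num.sqrt ((1 - e ^+ 2) / 2).
have [bE b12] := push_b e0 e12; rewrite -/b in bE b12.
have b0 : 0 < b by apply: lt_trans b12; rewrite invr_gt0.
have inX s t : s ^+ 2 = 1 -> 0 <= t <= pi -> lower n (push n s (e, t)).
  by move=> s2 t0; exact: push_lower.
have outX s t : s ^+ 2 = 1 -> 0 <= t <= pi -> lower k (push k s (e, t)).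
  by move=> s2 t0; exact: push_lower.
pose P (s1 s2 : R) : V4 := vec4 (s1 * b) (s2 * b) 0 e.
pose D s1 s2 := (mp (P s1 s2) * (F (P s1 s2))^-1)%g.
have sP s1 s2 : s1 ^+ 2 = 1 -> s2 ^+ 2 = 1 -> sphere4 (P s1 s2).
  move=> h1 h2; split; rewrite /P ?cwE//.
    by apply/S3E; rewrite !cE !exprMn h1 h2 bE; field.
  by rewrite chE => -[E]; move: e0; rewrite E ltxx.
have I_ s : s = 1 \/ s = -1 -> Q ((D s 1%R)^-1 * (U ^- m * D s (-1)%R))%g.
  move=> s1; have s2 : s ^+ 2 = 1 by case: s1 => ->.
  have := @push_red2 R G n s e en s2 e0 e12 c Q fi F sQ _ _; rewrite /= -/b.
  have -> : vec4 (s * b) b 0 e = P s 1 by rewrite /P mul1r.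
  have -> : vec4 (s * b) (- b) 0 e = P s (-1) by rewrite /P mulN1r.
  have -> : fi (P s 1) = mp (P s 1).
    have [h _ _] := f3 _ (sP s 1 s2 p1).
    by rewrite h ?cyE ?chE ?mul1r ltW.
  have -> : fi (P s (-1)) = (U ^- m * mp (P s (-1)%R))%g.
    have [_ h _] := f3 _ (sP s (-1) s2 n1).
    by rewrite h ?cyE ?chE ?mulN1r ?lerN2 ?ltW.
  rewrite -mulgA; apply.
    move=> t t0; apply: f1; [exact: subgroup1|exact: inX| |];
    by rewrite push_ret// chE => E; move: e0; rewrite E ltxx.
  move=> t t0; have lx := inX s t s2 t0.
  have [+ _] := hd s t s1 t0 => /(_ (@lower_compl R m l _ lx)).
  by apply: filterS => y hy ly; apply: hy; exact: lower_compl.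
have O_ s : s = 1 \/ s = -1 -> Q ((D 1%R s)^-1 * (V ^- l * D (-1)%R s))%g.
  move=> s1; have s2 : s ^+ 2 = 1 by case: s1 => ->.
  have := @push_red2 R G k s e ek s2 e0 e12 (fun u v => c (flip u) (flip v)) Q
    (fo \o @flip R) (F \o @flip R) sQ _ _; rewrite /= -/b.
  rewrite !flip_vec4 oppr0.
  have -> : vec4 b (s * b) 0 e = P 1 s by rewrite /P mul1r.
  have -> : vec4 (- b) (s * b) 0 e = P (-1) s by rewrite /P mulN1r.
  have -> : fo (P 1 s) = mp (P 1 s).
    have [h _ _] := f4 _ (sP 1 s p1 s2).
    by rewrite h ?cxE ?chE ?mul1r ltW.
  have -> : fo (P (-1) s) = (V ^- l * mp (P (-1)%R s))%g.
    have [_ h _] := f4 _ (sP (-1) s n1 s2).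
    by rewrite h ?cxE ?chE ?mulN1r ?lerN2 ?ltW.
  rewrite -mulgA; apply.
    move=> t t0; have lx := outX s t s2 t0.
    have r : red_at (lower k \o @flip R) c [set 1%g] fo (flip (push k s (e, t))).
      apply: f2; rewrite ?flipK//; first exact: subgroup1;
      by rewrite push_ret// chE => E; move: e0; rewrite E ltxx.
    apply: (red_at_pull (B := lower k \o @flip R) (f := @flip R)) => //.
      by move=> x /=; rewrite flipK.
    exact: flip_cont.
  move=> t t0; have lx := outX s t s2 t0.
  have [_ +] := hd s t s1 t0.
  have upX x : lower k x -> X (flip x).
    by move=> lx'; apply: upper_compl; rewrite flipK.
  move=> /(_ (upX _ lx)) r.
  exact: (red_at_pull (B := X) (f := @flip R) upX (@flip_cont R _) lx r).
clearbody D; exists (D 1 1).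
have i1 := I_ 1 (or_introl erefl); have i2 := I_ (-1) (or_intror erefl).
have j1 := O_ 1 (or_introl erefl); have j2 := O_ (-1) (or_intror erefl).
(* The parallel in order: inside with x > 0, outside with y < 0, then inside with x < 0 and outside
   with y > 0, both backwards. The comparisons [D] at the intermediate corners cancel. *)
have := QM _ _ (QM _ _ (QM _ _ i1 j2) (QV _ i2)) (QV _ j1).
by rewrite /longitude !invgM !invgK !mulgA !mulgK.
Unshelve. all: by end_near. Qed.

End Main.

End PathFamilies.

(** * Small meridians and the transverse loop *)

Section MeridianLoop.
Variables (R : realType) (G : groupType).
Local Notation V4 := 'rV[R]_4.
Local Notation itv a b := [set s : R | a <= s <= b].
Implicit Types (v : V4) (c : V4 -> V4 -> G).

(* The halves s = 1 and s = -1 of a small meridian of the point where the knot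
   crosses the sphere w = 0. *)
Definition mer (s : R) (z : R * R) : V4 :=
  let h := s * (z.1 * sin z.2) in let ph := pi / 4 + z.1 * cos z.2 in
  vec4 (Num.sqrt (1 - h ^+ 2) * cos ph) (Num.sqrt (1 - h ^+ 2) * sin ph) 0 h.

Lemma mer_cont s (A : set (R * R)) : cont_on A (mer s).
Proof.
have c1 : cont_on A (fun z => z.1) by apply: continuous_cont_on => z; exact: cvg_fst.
have c2 : cont_on A (fun z => z.2) by apply: continuous_cont_on => z; exact: cvg_snd.
have cc := cont_on_comp1 c2 (@continuous_cos R).
have cs := cont_on_comp1 c2 (@continuous_sin R).
have ch' : cont_on A (fun z => s * (z.1 * sin z.2)).
  by apply: cont_onM; [exact: cont_on_cst|exact: cont_onM].
have cph : cont_on A (fun z => pi / 4 + z.1 * cos z.2).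
  by apply: cont_onD; [exact: cont_on_cst|exact: cont_onM].
have csq : cont_on A (fun z => Num.sqrt (1 - (s * (z.1 * sin z.2)) ^+ 2)).
  apply: cont_on_comp1; last exact: sqrt_continuous.
  by apply: cont_onD; [exact: cont_on_cst|apply: cont_onN; exact: cont_on_sqr].
apply: cont_on_vec4 => //; last exact: cont_on_cst.
- by apply: cont_onM => //; apply: cont_on_comp1 => //; exact: continuous_cos.
- by apply: cont_onM => //; apply: cont_on_comp1 => //; exact: continuous_sin.
Qed.

Definition crossing : V4 := vec4 (cos (pi / 4)) (sin (pi / 4)) 0 0.

Lemma mer0 s t : mer s (0, t) = crossing.
Proof.
by rewrite /mer /= !mul0r mulr0 expr0n /= subr0 sqrtr1 !mul1r addr0.
Qed.

Lemma cos_sin_pi4 : cos (pi / 4) = sin (pi / 4) :> R.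
Proof.
transitivity (cos (pi / 2 - pi / 4) : R); first by congr cos; field.
by rewrite cosB cos_pihalf sin_pihalf; ring.
Qed.

Lemma crossing_knot (n k : nat) : ~~ odd n -> ~~ odd k ->
  double_twist R n k crossing.
Proof.
move=> en ek; have w0 : cw crossing = 0 by rewrite cwE.
have Sc : @S3 R crossing.
  by apply/S3E; rewrite !cE -[RHS](cos2Dsin2 (pi / 4)); ring.
apply/(double_twist_lower en ek Sc); first by rewrite w0.
apply/(core_eq en Sc w0); rewrite !cE; split=> //.
by rewrite cos_sin_pi4.
Qed.

Section Small.
Variables (e : R).
Hypotheses (e0 : 0 < e) (e1 : e < 2^-1).

Let e_lt1 : 2 * e < 1.
Proof. by rewrite -ltr_pdivlMl ?mulr1. Qed.

Let e2_gt0 : 0 < 2 * e.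
Proof. by rewrite mulr_gt0. Qed.

Lemma sin2e_gt0 : 0 < sin (2 * e).
Proof.
apply: sin_gt0_pi; rewrite e2_gt0 /=; apply: lt_le_trans (pi_ge2 R).
exact: lt_trans e_lt1 (ltr1n _ 2).
Qed.

(** The height vanishes only at the two ends, at the angles pi/4 + e and pi/4 - e of the equator;
    they are not punctures because cos^2 - sin^2 is there, up to sign, sin(2 e) > 0. *)
Lemma mer_half (s t : R) : s ^+ 2 = 1 -> 0 <= t <= pi -> half s (mer s (e, t)).
Proof.
move=> s2 t0; have [f0 f1] := (e0, e1); have st0 : 0 <= sin t by exact: sin_ge0_pi.
have [h hE] : exists h, h = s * (e * sin t) by exists (s * (e * sin t)).
have h2 : h ^+ 2 <= 4^-1.
  rewrite hE exprMn s2 mul1r.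
  have l1 : e * sin t <= 2^-1.
    have := sin_le1 t; have : 0 <= e * (1 - sin t) by rewrite mulr_ge0 ?subr_ge0 ?sin_le1 ?ltW.
    by lra.
  have l0 : 0 <= e * sin t by rewrite mulr_ge0// ltW.
  have -> : (4^-1 : R) = 2^-1 ^+ 2 by rewrite expr2; lra.
  by rewrite ler_pXn2r ?nnegrE ?invr_ge0.
split; last by rewrite /mer chE /= mulrA -expr2 s2 mul1r mulr_ge0// ltW.
split; rewrite /mer /=.
- apply/S3E; rewrite !cE -hE !exprMn sqr_sqrtr; last by rewrite subr_ge0 (le_trans h2)// invf_le1 ?ler1n.
  set q := pi / 4 + _.
  transitivity ((1 - h ^+ 2) * (cos q ^+ 2 + sin q ^+ 2) + h ^+ 2); first by ring.
  by rewrite cos2Dsin2; ring.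
- by rewrite cwE.
rewrite !cE -hE => -[/eqP]; rewrite [X in X == _]hE mulf_eq0 -sqrf_eq0 s2 oner_eq0 /=.
rewrite mulf_eq0 gt_eqF//= => /eqP s0.
have c2 : cos t ^+ 2 = 1 by rewrite -(cos2Dsin2 t) s0 expr0n addr0.
have h0 : h = 0 by rewrite hE s0 !mulr0.
rewrite h0 expr0n subr0 sqrtr1 !mul1r.
set q := pi / 4 + _ => qe.
have : cos (q + q) = 0 by rewrite cosD -!expr2 qe subrr.
have -> : q + q = pi / 2 + 2 * (e * cos t) by rewrite /q; field.
rewrite cosD cos_pihalf sin_pihalf mul0r mul1r sub0r => /eqP; rewrite oppr_eq0.
move/eqP: c2; rewrite sqrf_eq1 => /orP[] /eqP ->; rewrite ?mulr1 ?mulrN1 ?mulrN ?sinN ?oppr_eq0;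
  by rewrite gt_eqF// sin2e_gt0.
Qed.

Lemma mer_ends (s : R) :
  mer s (e, 0) = vec4 (cos (pi / 4 + e)) (sin (pi / 4 + e)) 0 0 /\
  mer s (e, pi) = vec4 (cos (pi / 4 - e)) (sin (pi / 4 - e)) 0 0.
Proof.
rewrite /mer /= sin0 sinpi !mulr0 expr0n subr0 sqrtr1 !mul1r cos0 cospi mulr1 mulrN1.
by [].
Qed.

Lemma mer_arcs : arcY 1 (vec4 (cos (pi / 4 + e)) (sin (pi / 4 + e)) 0 0 : V4) /\
  arcX 1 (vec4 (cos (pi / 4 - e)) (sin (pi / 4 - e)) 0 0 : V4).
Proof.
have [f0 f1] := (e0, e1); have [E1 E2] := mer_ends 1.
have p1 : (1 : R) ^+ 2 = 1 by rewrite expr1n.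
have pi2_ : 2 * 1 <= (pi : R) by rewrite mulr1; exact: pi_ge2.
have [s1 _] := mer_half (s := 1) (t := 0) p1 (introT andP (conj (lexx 0) (pi_ge0 R))).
have [s2 _] := mer_half (s := 1) (t := pi) p1 (introT andP (conj (pi_ge0 R) (lexx _))).
rewrite E1 in s1; rewrite E2 in s2.
have se : 0 < sin e.
  by apply: sin_gt0_pi; apply/andP; split=> //; apply: lt_le_trans (pi_ge2 R); lra.
have ce : 0 < cos e.
  apply: cos_gt0_pihalf; have pi2 : 2 * 1 <= (pi : R) := pi2_; apply/andP; split; lra.
have c4 : 0 < cos (pi / 4) :> R.
  by apply: cos_gt0_pihalf; have pi0 := pi_gt0 R; apply/andP; split; lra.
have tan_e : sin e < cos e.
  rewrite ltNge; apply/negP => h.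
  have : 0 < cos (2 * e).
    by apply: cos_gt0_pihalf; have pi2 : 2 * 1 <= (pi : R) := pi2_; apply/andP; split; lra.
  rewrite mulr_natl mulr2n cosD -!expr2; apply/negP; rewrite -leNgt subr_le0.
  by apply: lerXn2r; rewrite ?nnegrE ?(ltW se) ?(ltW ce).
have c4s := cos_sin_pi4.
split; split=> //; rewrite ?chE// !cE mul1r ltr_norml.
- rewrite cosD sinD -c4s; apply/andP; split; nra.
- rewrite cosB sinB -c4s; apply/andP; split; nra.
Qed.

Lemma mer_red2 c Q (s : R) me F : s ^+ 2 = 1 -> subgroup Q ->
  triv (half s) c me ->
  (forall t, 0 <= t <= pi -> red_at (half s) c Q F (mer s (e, t))) ->
  let x := vec4 (cos (pi / 4 + e)) (sin (pi / 4 + e)) 0 0 in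
  let y := vec4 (cos (pi / 4 - e)) (sin (pi / 4 - e)) 0 0 in
  Q ((me x * (F x)^-1)^-1 * (me y * (F y)^-1))%g.
Proof.
move=> s2 sQ te rF.
have pA t : itv 0 pi t -> half s (mer s (e, t)) by move=> t0; exact: mer_half.
have cp : cont_on (itv 0 pi) (fun t => mer s (e, t)).
  apply: (cont_on_comp (B := setT)) => //; last exact: mer_cont.
  apply: cont_on_pair; first exact: cont_on_cst.
  by apply: continuous_cont_on => t; exact: cvg_id.
have r2 : red (itv 0 pi) (fun t t' => c (mer s (e, t)) (mer s (e, t')))
    Q (fun t => F (mer s (e, t))).
  by move=> t t0; apply: (red_at_pull pA cp) => //; exact: rF.
have [q1 [q2 [->]]] := itv_red2 (pi_ge0 R) (@subgroup1 G) sQ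
  (red_pull pA cp te) r2; move=> /=; have [-> ->] := mer_ends s => h2 ->.
by rewrite mul1g mulKg.
Qed.

End Small.

Variables (m l : nat).
Local Notation n := (2 * m)%N.
Local Notation k := (2 * l)%N.
Local Notation X := (@knot_compl R n k).
Variables (c : V4 -> V4 -> G) (mp mm : V4 -> G) (gB1 V g : G).
Hypotheses (chc : charts c mp mm 1%g gB1 V g).

Let n1 : (-1) ^+ 2 = 1 :> R. Proof. by rewrite sqrrN expr1n. Qed.
Let p1 : 1 ^+ 2 = 1 :> R. Proof. by rewrite expr1n. Qed.

Let half_X s : @half R s `<=` X.
Proof. by move=> v [sv _]; apply: sphere4_compl. Qed.

(** The two halves of the meridian share an end on A1, where the charts agree, and an end on B2,
    where they differ by g. The quotient of the two comparisons with [F] is a conjugate of g. *)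
Lemma extract_meridian Q F : subgroup Q ->
  (\forall v \near crossing, X v -> red_at X c Q F v) ->
  exists h, Q (h^-1 * g * h)%g.
Proof.
move=> sQ HF; have [Q1 QM QV] := sQ; have [tp tm [cA1 _ _ cB2]] := chc.
have nearK s : \forall e \near (0 : R), forall t, 0 <= t <= pi ->
    X (mer s (e, t)) -> red_at X c Q F (mer s (e, t)).
  apply: (path_family_near (K := [set crossing])
    (W := fun x => X x -> red_at X c Q F x)).
  - exact: mer_cont.
  - by move=> t _; rewrite mer0.
  - by move=> _ ->.
have : \forall e \near (0 : R), forall s t, s = 1 \/ s = -1 -> 0 <= t <= pi ->
    X (mer s (e, t)) -> red_at X c Q F (mer s (e, t)).
  by near=> e => s t [] -> t0; move: t t0; near: e; exact: nearK.
move=> /nbhs_ballP[/= d d0 hd].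
pose e := Num.min (d / 2) 4^-1.
have e0 : 0 < e by rewrite lt_min divr_gt0//= invr_gt0.
have ed : e < d by rewrite gt_min ltr_pdivrMr// mulr_natr mulr2n ltrDl d0.
have e12 : e < 2^-1 by rewrite gt_min ltf_pV2 ?posrE// ltr_nat orbT.
have {}hd : forall s t, s = 1 \/ s = -1 -> 0 <= t <= pi ->
    X (mer s (e, t)) -> red_at X c Q F (mer s (e, t)).
  by apply: hd; rewrite /ball /= sub0r normrN gtr0_norm.
have hs s : s = 1 \/ s = -1 -> s ^+ 2 = 1 -> forall t, 0 <= t <= pi ->
    red_at (half s) c Q F (mer s (e, t)).
  move=> s1 s2 t t0; have hv := mer_half e0 e12 s2 t0.
  by apply: filterS (hd s t s1 t0 (half_X hv)) => y hy /half_X; exact: hy.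
have A := mer_red2 e0 e12 p1 sQ tp (hs 1 (or_introl erefl) p1).
have B := mer_red2 e0 e12 n1 sQ tm (hs (-1) (or_intror erefl) n1).
have [a1 a2] := mer_arcs e0 e12.
move: A B => /=; set x := vec4 _ _ _ _ in a1 *; set y := vec4 _ _ _ _ in a2 *.
rewrite (cA1 x a1) mul1g (cB2 y a2).
set D := (mm x * _)%g; clearbody D => A B; exists D.
have := QM _ _ A (QV _ B).
by rewrite !invgM !invgK !mulgA mulgVK mulgK.
Unshelve. all: by end_near. Qed.

(** The loop goes from pole to pole through the middles of A1 and A2, where the charts differ by 1
    and V. *)
Lemma extract_transverse Q F : subgroup Q -> red X c Q F ->
  exists h, Q (h^-1 * V * h)%g.
Proof.
move=> sQ HF; have [Q1 QM QV] := sQ; have [tp tm [cA1 _ cA2 _]] := chc.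
have key (s : R) me v : s ^+ 2 = 1 -> triv (half s) c me -> half s v ->
    Q ((me (pole s) * (F (pole s))^-1)^-1 * (me v * (F v)^-1))%g.
  move=> s2 te hv.
  have rF : red (half s) c Q F by exact: red_sub (half_X (s := s)) HF.
  have [|q1 [q2 [-> h2 ->]]] := half_red2 s2 (@subgroup1 G) sQ
    (fun _ h => h) _ te rF hv; first by move=> t t01; exact: contr_half.
  by rewrite mul1g mulKg.
pose x (s : R) : V4 := vec4 0 s 0 0.
have ax s : s ^+ 2 = 1 -> arcY s (x s).
  move=> s2; split; [split| |].
  - by apply/S3E; rewrite !cE s2; ring.
  - by rewrite cwE.
  - by rewrite !cE s2 expr0n => -[_ /eqP]; rewrite eq_sym oner_eq0.
  - by rewrite chE.
  - by rewrite !cE normr0 -expr2 s2.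
have hx (s f : R) : s ^+ 2 = 1 -> half f (x s).
  by move=> s2; have [sv h0 _] := ax s s2; split; rewrite ?h0 ?mulr0.
have A1 := key 1 mp (x 1) p1 tp (hx _ _ p1).
have A2 := key (1%R : R) mp (x (-1)%R) p1 tp (hx _ _ n1).
have B1 := key (-1)%R mm (x 1%R) n1 tm (hx _ _ p1).
have B2 := key (-1)%R mm (x (-1)%R) n1 tm (hx _ _ n1).
move: A1 A2 B1 B2; rewrite (cA1 _ (ax 1%R p1)) (cA2 _ (ax (-1)%R n1)) mul1g.
set D1 := (mm (x 1%R) * _)%g; set D2 := (mp (pole 1) * _)%g.
set D3 := (mm (pole _) * _)%g => A1 A2 B1 B2; exists D1.
have := QM _ _ (QM _ _ (QM _ _ (QV _ A1) A2) (QV _ B2)) B1.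
rewrite -(mulgA V); set D4 := (mm (x (-1)%R) * _)%g.
clearbody D1 D2 D3 D4.
by rewrite !invgM !invgK !mulgA !mulgK.
Qed.

End MeridianLoop.

(** * Existence of local systems *)

Section StepSystem.
Variables (R : realType) (G : groupType).
Local Notation V4 := 'rV[R]_4.
Implicit Types (v : V4) (c : V4 -> V4 -> G).

Section Step.
Variables gA1 gB1 gA2 gB2 : G.

Definition quadrant v : G :=
  if `|cx v| < cy v then gA1 else if `|cy v| < - cx v then gB1
  else if `|cx v| < - cy v then gA2 else gB2.

(** All holonomy is placed in the passage from h >= 0 to h < 0. The value 1 for the opposite passage
    is junk: a point with h < 0 has no neighbours with h >= 0. *)
Definition step_sys (x y : V4) : G :=
  if (0 <= ch x) && (ch y < 0) then quadrant x else 1%g.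

Definition step_chart v : G := if 0 <= ch v then (quadrant v)^-1%g else 1%g.

Lemma quadrant_arcs :
  [/\ forall v, arcY 1 v -> quadrant v = gA1,
      forall v, arcX (-1) v -> quadrant v = gB1,
      forall v, arcY (-1) v -> quadrant v = gA2 &
      forall v, arcX 1 v -> quadrant v = gB2].
Proof.
split=> v [_ _]; rewrite ?mul1r ?mulN1r /quadrant => h.
- by rewrite h.
- have -> : (`|cx v| < cy v) = false.
    by apply/negbTE; move: h; rewrite ltr_norml -leNgt ler_normr; lra.
  by rewrite h.
- have -> : (`|cx v| < cy v) = false.
    by apply/negbTE; move: h; rewrite ltr_norml -leNgt ler_normr; lra.
  have -> : (`|cy v| < - cx v) = false.
    by apply/negbTE; move: h; rewrite ltr_norml -leNgt ler_normr; lra.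
  by rewrite h.
- have -> : (`|cx v| < cy v) = false.
    by apply/negbTE; move: h; rewrite ltr_norml -leNgt ler_normr; lra.
  have -> : (`|cy v| < - cx v) = false.
    by apply/negbTE; move: h; rewrite ltr_norml -leNgt ler_normr; lra.
  have -> // : (`|cx v| < - cy v) = false.
  by apply/negbTE; move: h; rewrite ltr_norml -leNgt ler_normr; lra.
Qed.

Lemma arc_cases v : sphere4 v -> ch v = 0 ->
  [\/ arcY 1 v, arcX (-1) v, arcY (-1) v | arcX 1 v].
Proof.
move=> sv h0; have [_ _ nxy] := sv.
have ne : cx v ^+ 2 != cy v ^+ 2 by apply/eqP => e; apply: nxy.
have [x0|x0] := ltP 0 (cx v + cy v); have [y0|y0] := ltP 0 (cy v - cx v).
- by apply: Or41; split=> //; rewrite ltr_norml; lra.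
- apply: Or44; split=> //; rewrite ltr_norml.
  have : cy v - cx v != 0.
    by apply: contra_neq ne => e; rewrite -(subrK (cx v) (cy v)) e add0r.
  by rewrite neq_lt; lra.
- apply: Or42; split=> //; rewrite ltr_norml.
  have : cx v + cy v != 0.
    by apply: contra_neq ne => e; rewrite -(addrK (cy v) (cx v)) e sub0r sqrrN.
  by rewrite neq_lt; lra.
- apply: Or43; split=> //; rewrite ltr_norml.
  have : cx v + cy v != 0.
    by apply: contra_neq ne => e; rewrite -(addrK (cy v) (cx v)) e sub0r sqrrN.
  have : cy v - cx v != 0.
    by apply: contra_neq ne => e; rewrite -(subrK (cx v) (cy v)) e add0r.
  by rewrite !neq_lt; lra.
Qed.

Lemma quadrant_near x : sphere4 x -> ch x = 0 ->
  \forall y \near x, quadrant y = quadrant x.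
Proof.
move=> sx h0.
have cxc : cont_on setT (@cx R) by apply: continuous_cont_on; exact: cx_cont.
have cyc : cont_on setT (@cy R) by apply: continuous_cont_on; exact: cy_cont.
have cD : cont_on setT (fun v : V4 => cx v + cy v) by exact: cont_onD.
have cB : cont_on setT (fun v : V4 => cx v - cy v).
  by apply: cont_onD => //; exact: cont_onN.
have nD s : cx x + cy x < s -> \forall y \near x, cx y + cy y < s.
  by move=> h; apply: filterS (near_lt cD (I : setT x) h) => y; exact.
have nD' s : s < cx x + cy x -> \forall y \near x, s < cx y + cy y.
  by move=> h; apply: filterS (near_gt cD (I : setT x) h) => y; exact.
have nB s : cx x - cy x < s -> \forall y \near x, cx y - cy y < s.
  by move=> h; apply: filterS (near_lt cB (I : setT x) h) => y; exact.
have nB' s : s < cx x - cy x -> \forall y \near x, s < cx y - cy y.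
  by move=> h; apply: filterS (near_gt cB (I : setT x) h) => y; exact.
have [Y1 X1 Y2 X2] := quadrant_arcs.
case: (arc_cases sx h0) => ax.
- rewrite (Y1 _ ax); have [_ _] := ax; rewrite mul1r ltr_norml => h.
  have a : 0 < cx x + cy x by lra.
  have b : cx x - cy x < 0 by lra.
  apply: filterS2 (nD' _ a) (nB _ b) => y h1 h2.
  by rewrite /quadrant ifT// ltr_norml; lra.
- rewrite (X1 _ ax); have [_ _] := ax; rewrite mulN1r ltr_norml => h.
  have a : cx x + cy x < 0 by lra.
  have b : cx x - cy x < 0 by lra.
  apply: filterS2 (nD _ a) (nB _ b) => y h1 h2.
  rewrite /quadrant; case: ifP => [|_]; first by rewrite ltr_norml => ?; exfalso; lra.
  by case: ifP => [//|/negP[]]; rewrite ltr_norml; lra.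
- rewrite (Y2 _ ax); have [_ _] := ax; rewrite mulN1r ltr_norml => h.
  have a : cx x + cy x < 0 by lra.
  have b : 0 < cx x - cy x by lra.
  apply: filterS2 (nD _ a) (nB' _ b) => y h1 h2.
  rewrite /quadrant; case: ifP => [|_]; first by rewrite ltr_norml => ?; exfalso; lra.
  case: ifP => [|_]; first by rewrite ltr_norml => ?; exfalso; lra.
  by case: ifP => [//|/negP[]]; rewrite ltr_norml; lra.
- rewrite (X2 _ ax); have [_ _] := ax; rewrite mul1r ltr_norml => h.
  have a : 0 < cx x + cy x by lra.
  have b : 0 < cx x - cy x by lra.
  apply: filterS2 (nD' _ a) (nB' _ b) => y h1 h2.
  rewrite /quadrant; case: ifP => [|_]; first by rewrite ltr_norml => ?; exfalso; lra.
  case: ifP => [|_]; first by rewrite ltr_norml => ?; exfalso; lra.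
  by case: ifP => [|//]; rewrite ltr_norml => ?; exfalso; lra.
Qed.

Let chc (A : set V4) : cont_on A (@ch R).
Proof. by apply: continuous_cont_on; exact: ch_cont. Qed.

Let ch_lt x (s : R) : ch x < s -> \forall y \near x, ch y < s.
Proof. by move=> h; apply: filterS (near_lt (@chc setT) (I : setT x) h) => y; exact. Qed.

Let ch_gt x (s : R) : s < ch x -> \forall y \near x, s < ch y.
Proof. by move=> h; apply: filterS (near_gt (@chc setT) (I : setT x) h) => y; exact. Qed.

Lemma step_locsys : locsys (@sphere4 R) step_sys.
Proof.
move=> x sx; case: (ltgtP (ch x) 0) => [h0|h0|h0].
- exists (fun=> 1%g); apply: filterS (ch_lt h0) => y hy sy.
  by near=> z => _; rewrite /step_sys leNgt hy invg1 mulg1.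
- exists (fun=> 1%g); apply: filterS (ch_gt h0) => y hy sy.
  apply: filterS (ch_gt hy) => z hz _.
  by rewrite /step_sys [ch z < 0]ltNge (ltW hz) andbF invg1 mulg1.
exists (fun y => if 0 <= ch y then 1%g else quadrant x).
apply: filterS (quadrant_near sx h0) => y qy sy; rewrite /step_sys qy.
case: (ltgtP (ch y) 0) => [hy|hy|hy].
- apply: filterS (ch_lt hy) => z hz _.
  by rewrite [0 <= ch z]leNgt hz/= mulVg.
- apply: filterS (ch_gt hy) => z hz _.
  by rewrite [0 <= ch z]ltW// [ch z < 0]ltNge ltW//= invg1 mulg1.
by near=> z => _; case: (leP 0 (ch z)); rewrite ?hy ?lexx /= invg1 mul1g.
Unshelve. all: by end_near. Qed.

Lemma step_charts : charts step_sys (fun=> 1%g) step_chart gA1 gB1 gA2 gB2.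
Proof.
have [Y1 X1 Y2 X2] := quadrant_arcs.
split.
- apply: trivP => x [sx]; rewrite mul1r => hx.
  near=> y => -[sy]; rewrite mul1r => hy.
  by rewrite /step_sys [ch y < 0]ltNge hy andbF invg1 mulg1.
- apply: trivP => x [sx]; rewrite mulN1r oppr_ge0 le_eqVlt => /orP[/eqP h0|h0].
    apply: filterS (quadrant_near sx h0) => y qy [sy].
    rewrite mulN1r oppr_ge0 => hy.
    rewrite /step_sys /step_chart h0 lexx qy invgK /=.
    by case: (leP 0 (ch y)); rewrite ?mulgV ?mulg1.
  apply: filterS (ch_lt h0) => y hy _.
  by rewrite /step_sys /step_chart leNgt h0 leNgt hy /= invg1 mulg1.
split=> v av; have [_ h0 _] := av; rewrite /step_chart h0 lexx.
- by rewrite (Y1 _ av) mulgV.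
- by rewrite (X1 _ av) mulgV.
- by rewrite (Y2 _ av) mulgV.
- by rewrite (X2 _ av) mulgV.
Unshelve. all: by end_near. Qed.

End Step.

(* The half disk cy >= 0 of a hemisphere is connected, which makes the two charts
   proportional there. *)
Lemma half_normalise (e : R) c c' m : e ^+ 2 = 1 ->
  locsys (@sphere4 R) c' -> triv (half e) c m ->
  (forall u v, sphere4 u -> sphere4 v -> 0 <= cy u -> 0 <= cy v ->
    c' u v = c u v) ->
  exists m', triv (half e) c' m' /\
    forall v, half e v -> 0 <= cy v -> m' v = m v.
Proof.
move=> e2 lc' tm ec; have [m' tm'] := half_triv e2 lc'.
pose B : set V4 := [set v | half e v /\ 0 <= cy v].
have rm : red B c [set 1%g] m by apply: red_sub tm => v [].
have rm' : red B c [set 1%g] m'.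
  move=> x [hx x0]; apply: filterS (tm' x hx) => y h [hy y0].
  by rewrite -ec//; [exact: h|exact: hx.1|exact: hy.1].
pose k := (m (pole e) * (m' (pole e))^-1)%g.
exists (fun v => k * m' v)%g; split.
  apply: trivP => x hx; apply: filterS (trivE tm' hx) => y + hy => /(_ hy) ->.
  by rewrite mulVgM.
move=> v hv v0.
have BA : B `<=` half e by move=> u [].
have Bv s : 0 <= s <= 1 -> B (contr e (v, s)).
  move=> s01; split; first exact: contr_half.
  by rewrite /contr cyE mulr_ge0//; case/andP: s01.
have [q1 [q2 [-> ->]]] := half_red2 e2 (@subgroup1 G) (@subgroup1 G) BA Bv rm rm' hv.
rewrite mul1g mulg1 -/k => kE.
by rewrite -kE mulgVK.
Qed.

(** [twist_charts] used as a construction: the pull-back by [ret] extends over the inside piece, at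
    the price of a prescribed constant on A2. *)
Lemma twisted_charts (m : nat) c mp mm gA1 gB1 gA2 gB2 : (0 < m)%N ->
  locsys (@sphere4 R) c -> charts c mp mm gA1 gB1 gA2 gB2 ->
  locsys (lower (2 * m)) (fun u v => c (ret (2 * m) u) (ret (2 * m) v)) /\
  exists mup mum, charts (fun u v => c (ret (2 * m) u) (ret (2 * m) v)) mup mum
    gA1 gB1 ((gB1 * gB2^-1) ^+ m * gA1 * (gB2^-1 * gB1) ^- m)%g gB2.
Proof.
move=> m0 lc cc; have [tp tm _] := cc; set n := (2 * m)%N.
have en : ~~ odd n by exact: even_n.
have rS v : lower n v -> sphere4 (ret n v) by move=> /(ret_sphere4 en) [].
have lc1 : locsys (lower n) (fun u v => c (ret n u) (ret n v)).
  exact: (locsys_pull rS (@ret_cont _ _ _)).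
have lc' : locsys (@sphere4 R) (fun u v => c (ret n u) (ret n v)).
  by apply: locsys_sub lc1; exact: sphere4_lower.
have ec u v : sphere4 u -> sphere4 v -> 0 <= cy u -> 0 <= cy v ->
    c (ret n u) (ret n v) = c u v.
  by move=> [_ u0 _] [_ v0 _] yu yv; rewrite !ret_fix//; left.
have n1 : (-1) ^+ 2 = 1 :> R by rewrite sqrrN expr1n.
have p1 : 1 ^+ 2 = 1 :> R by rewrite expr1n.
have [mup [tup mupE]] := half_normalise p1 lc' tp ec.
have [mum [tum mumE]] := half_normalise n1 lc' tm ec.
by split=> //; exists mup, mum; exact: twist_charts cc tup tum mupE mumE.
Qed.

End StepSystem.

(** * Gluing the two sides *)

Section Existence.
Variables (R : realType) (G : groupType).
Local Notation V4 := 'rV[R]_4.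
Implicit Types (v : V4) (c : V4 -> V4 -> G).

(** Four equal constants mean gauge equivalent systems: the quotients of corresponding charts on the
    two hemispheres agree on the equator, since the constants cancel. *)
Lemma charts_gauge c c' mp mm mp' mm' (gA1 gB1 gA2 gB2 : G) :
  charts c mp mm gA1 gB1 gA2 gB2 -> charts c' mp' mm' gA1 gB1 gA2 gB2 ->
  exists ka : V4 -> G, forall x, sphere4 x ->
    \forall y \near x, sphere4 y -> (c x y * ka y = ka x * c' x y)%g.
Proof.
move=> [tp tm [Y1 X1 Y2 X2]] [tp' tm' [Y1' X1' Y2' X2']].
pose kp v := ((mp v)^-1 * mp' v)%g; pose km v := ((mm v)^-1 * mm' v)%g.
have pm v : sphere4 v -> ch v = 0 -> kp v = km v.
  move=> sv h0; rewrite /kp /km; case: (arc_cases sv h0) => av.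
  - by rewrite (Y1 _ av) (Y1' _ av) mulVgM.
  - by rewrite (X1 _ av) (X1' _ av) mulVgM.
  - by rewrite (Y2 _ av) (Y2' _ av) mulVgM.
  - by rewrite (X2 _ av) (X2' _ av) mulVgM.
exists (fun v => if 0 <= ch v then kp v else km v) => x sx.
have chx : cont_on setT (@ch R) by apply: continuous_cont_on; exact: ch_cont.
have P (y : V4) : sphere4 y -> 0 <= ch y -> half 1 y by move=> *; split; rewrite ?mul1r.
have N (y : V4) : sphere4 y -> ch y <= 0 -> half (-1) y.
  by move=> *; split; rewrite ?mulN1r ?oppr_ge0.
have kP (y : V4) :
    c x y = ((mp x)^-1 * mp y)%g -> c' x y = ((mp' x)^-1 * mp' y)%g ->
    (c x y * kp y = kp x * c' x y)%g.
  by move=> -> ->; rewrite /kp !mulgA !mulgK.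
have kN (y : V4) :
    c x y = ((mm x)^-1 * mm y)%g -> c' x y = ((mm' x)^-1 * mm' y)%g ->
    (c x y * km y = km x * c' x y)%g.
  by move=> -> ->; rewrite /km !mulgA !mulgK.
case: (leP 0 (ch x)) => h0; last first.
  have hx := N _ sx (ltW h0).
  apply: filterS3 (near_lt chx (I : setT x) h0) (trivE tm hx) (trivE tm' hx).
  move=> y /(_ I) hy e e' sy; rewrite leNgt hy /=.
  by have hy' := N _ sy (ltW hy); apply: kN; [exact: e|exact: e'].
have hx := P _ sx h0.
case: (leP (ch x) 0) => h0'; last first.
  apply: filterS3 (near_gt chx (I : setT x) h0') (trivE tp hx) (trivE tp' hx).
  move=> y /(_ I) hy e e' sy; rewrite (ltW hy).
  by have hy' := P _ sy (ltW hy); apply: kP; [exact: e|exact: e'].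
have hx' := N _ sx h0'.
apply: filterS2 (filterI (trivE tp hx) (trivE tp' hx))
  (filterI (trivE tm hx') (trivE tm' hx')) => y [e1 e1'] [e2 e2'] sy.
case: (leP 0 (ch y)) => hy.
  by have hy' := P _ sy hy; apply: kP; [exact: e1|exact: e1'].
have hy' := N _ sy (ltW hy).
have hx0 : ch x = 0 by apply: le_anti; rewrite h0 h0'.
rewrite (pm x sx hx0).
by apply: kN; [exact: e2|exact: e2'].
Qed.

Variables m l : nat.
Hypotheses (m_gt0 : (0 < m)%N) (l_gt0 : (0 < l)%N).
Local Notation n := (2 * m)%N.
Local Notation k := (2 * l)%N.
Local Notation X := (@knot_compl R n k).

Lemma glue_locsys c c' (ka : V4 -> G) :
  locsys (lower n) c -> locsys (lower k \o @flip R) c' ->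
  (forall x, sphere4 x ->
    \forall y \near x, sphere4 y -> (c x y * ka y = ka x * c' x y)%g) ->
  exists d, locsys X d /\ forall x y, cw x = 0 -> cw y = 0 -> d x y = c x y.
Proof.
move=> lc lc' hk.
(* Points of the sphere use the inside frame, and [ka x] converts it when the neighbour lies
   outside. *)
pose d x y := if cw x < 0 then c x y else if 0 < cw x then c' x y
  else if cw y <= 0 then c x y else (ka x * c' x y)%g.
exists d; split; last first.
  by move=> x y x0 y0; rewrite /d x0 y0 ltxx lexx.
have en : ~~ odd n by exact: even_n.
have cwx : cont_on setT (@cw R) by apply: continuous_cont_on; exact: cw_cont.
have lo y : X y -> cw y <= 0 -> lower n y by exact: compl_lower.
have up y : X y -> 0 <= cw y -> lower k (flip y) by exact: compl_upper.
have near0 (y : V4) : cw y < 0 -> \forall z \near y, cw z < 0.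
  by move=> h; apply: filterS (near_lt cwx (I : setT y) h) => z; exact.
have near0' (y : V4) : 0 < cw y -> \forall z \near y, 0 < cw z.
  by move=> h; apply: filterS (near_gt cwx (I : setT y) h) => z; exact.
move=> x Xx; case: (ltgtP (cw x) 0) => w0.
- have [M hM] := lc x (lo _ Xx (ltW w0)); exists M.
  apply: filterS2 (near0 _ w0) hM => y y0 + Xy => /(_ (lo _ Xy (ltW y0))) hy.
  apply: filterS2 (near0 _ y0) hy => z z0 + Xz => /(_ (lo _ Xz (ltW z0))) <-.
  by rewrite /d y0.
- have [M hM] := lc' x (up _ Xx (ltW w0)); exists M.
  apply: filterS2 (near0' _ w0) hM => y y0 + Xy => /(_ (up _ Xy (ltW y0))) hy.
  apply: filterS2 (near0' _ y0) hy => z z0 + Xz => /(_ (up _ Xz (ltW z0))) <-.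
  by rewrite /d ltNge (ltW y0) y0.
have le0 (y : V4) : cw y = 0 -> (cw y <= 0) /\ (0 <= cw y) by move=> ->; rewrite lexx.
have sX y : X y -> cw y = 0 -> sphere4 y.
  by move=> Xy y0; apply: (lower_sphere4 en _ y0); exact: lo Xy (proj1 (le0 _ y0)).
have [M hM] := lc x (lo _ Xx (proj1 (le0 _ w0))).
have [M' hM'] := lc' x (up _ Xx (proj2 (le0 _ w0))).
have h1 := nbhs_singleton hM (lo _ Xx (proj1 (le0 _ w0))).
have h1' := nbhs_singleton hM' (up _ Xx (proj2 (le0 _ w0))).
(* The left constant makes the outside potential continue the inside one through [x]. *)
exists (fun y => if cw y <= 0 then M y else M x * ka x * (M' x)^-1 * M' y)%g.
apply: filterS3 (filterI hM hM') (filterI h1 h1') (hk x (sX _ Xx w0)).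
move=> y [hy hy'] [xy xy'] ky Xy; case: (ltgtP (cw y) 0) => y0.
- have hz := hy (lo _ Xy (ltW y0)).
  apply: filterS2 (near0 _ y0) hz => z z0 + Xz => /(_ (lo _ Xz (ltW z0))) e.
  by rewrite /d y0 (ltW z0) e.
- have hz := hy' (up _ Xy (ltW y0)).
  apply: filterS2 (near0' _ y0) hz => z z0 + Xz => /(_ (up _ Xz (ltW z0))) e.
  by rewrite /d ltNge (ltW y0) y0 /= leNgt z0 /= mulVgM.
have sy := sX _ Xy y0; have [y1 y2] := le0 _ y0.
have {}xy := xy (lo _ Xy y1); have {}xy' := xy' (up _ Xy y2).
have kE : (ka y = (M y)^-1 * (M x * ka x * (M' x)^-1 * M' y))%g.
  apply: (mulgI (c x y)); rewrite (ky sy) xy xy' !mulgA mulgK mulVg mul1g.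
  by [].
apply: filterS2 (hy (lo _ Xy y1)) (hy' (up _ Xy y2)) => z e e' Xz.
rewrite /d y0 ltxx; case: (leP (cw z) 0) => z0.
  by rewrite e//; exact: lo.
rewrite kE e'; first by rewrite !mulgA mulgK.
exact: up Xz (ltW z0).
Qed.

(** The relations say that the step system with constants 1, U g, V, g keeps these constants under
    the pull-backs from both sides. The pull-backs are then gauge equivalent on the sphere and can
    be glued. *)
Lemma exists_locsys (g U V : G) : rels m l g U V ->
  exists c mp mm, locsys X c /\ charts c mp mm 1%g (U * g)%g V g.
Proof.
move=> [rU rV]; set gB1 := (U * g)%g.
have UE : (gB1 * g^-1 = U)%g by rewrite mulgK.
have gB1E : (gB1 = V ^+ l * g * V ^- l)%g by rewrite /gB1 {1}rU mulgVK.
have lcS := @step_locsys R G 1%g gB1 V g.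
have chS := @step_charts R G 1%g gB1 V g.
have [lc [mp [mm cc]]] := twisted_charts m_gt0 lcS chS.
have lcF := locsys_pull (@sphere4_flip R) (@flip_cont R _) lcS.
have [lc' [mp' [mm' cc']]] := twisted_charts l_gt0 lcF (charts_flip chS).
have e1 : ((gB1 * g^-1) ^+ m * 1 * (g^-1 * gB1) ^- m = V)%g.
  have -> : (g^-1 * gB1 = U ^ g)%g by rewrite conjgE /gB1 mulgA.
  by rewrite UE mulg1 -conjXg conjgE [RHS]rV !invgM invgK !mulgA.
have e2 : ((V * 1^-1) ^+ l * g * (1^-1 * V) ^- l = gB1)%g.
  by rewrite invg1 mulg1 mul1g gB1E.
rewrite e1 in cc; rewrite e2 in cc'.
have {}cc' := charts_flip cc'.
have [ka hk] := charts_gauge cc cc'.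
have lc2 := locsys_pull (A := lower k \o @flip R) (f := @flip R) (fun _ h => h)
  (@flip_cont R _) lc'.
have [d [ld dE]] := glue_locsys lc lc2 hk.
exists d, mp, mm; split=> //; have [tp tm ca] := cc.
have w0 e v : half e v -> cw v = 0 by move=> [[]].
split=> //.
- apply: trivP => x hx; apply: filterS (trivE tp hx) => y e hy.
  by rewrite dE ?(w0 _ _ hx) ?(w0 _ _ hy)//; exact: e.
- apply: trivP => x hx; apply: filterS (trivE tm hx) => y e hy.
  by rewrite dE ?(w0 _ _ hx) ?(w0 _ _ hy)//; exact: e.
Qed.

End Existence.

(** * The group of glide reflections *)

Section GlideType.
Variable C : numClosedFieldType.

(* (k, a, b) stands for z |-> a conj^k z + b.  Keeping k in int makes powers of a
   glide reflection distinguishable by k alone. *)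
Record glide := Glide { glide_val : int * C * C; _ : `|glide_val.1.2| == 1 }.
HB.instance Definition _ := [isSub for glide_val].
HB.instance Definition _ := [Choice of glide by <:].

Definition kconj (k : int) (z : C) : C := if odd `|k|%N then z^* else z.

Implicit Types (x y : glide) (k : int) (z : C).
Definition gk x := (val x).1.1.
Definition ga x := (val x).1.2.
Definition gb x := (val x).2.

Lemma ga_norm x : `|ga x| = 1. Proof. exact/eqP/(valP x). Qed.
Lemma ga_neq0 x : ga x != 0.
Proof. by rewrite -normr_eq0 ga_norm oner_eq0. Qed.
Lemma ga_conj x : (ga x)^* = (ga x)^-1.
Proof.
apply: (mulfI (ga_neq0 x)); rewrite -normCK ga_norm expr1n mulfV//.
exact: ga_neq0.
Qed.

Lemma glideP x y : gk x = gk y -> ga x = ga y -> gb x = gb y -> x = y.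
Proof.
rewrite /gk /ga /gb => h1 h2 h3; apply: val_inj.
by case: (val x) h1 h2 h3 => [[? ?] ?]; case: (val y) => [[? ?] ?] /= -> -> ->.
Qed.

Lemma kconjM k z t : kconj k (z * t) = kconj k z * kconj k t.
Proof. by rewrite /kconj; case: ifP; rewrite ?rmorphM. Qed.
Lemma kconjD k z t : kconj k (z + t) = kconj k z + kconj k t.
Proof. by rewrite /kconj; case: ifP; rewrite ?rmorphD. Qed.
Lemma kconjN k z : kconj k (- z) = - kconj k z.
Proof. by rewrite /kconj; case: ifP; rewrite ?rmorphN. Qed.
Lemma kconj0 k : kconj k 0 = 0.
Proof. by rewrite /kconj; case: ifP; rewrite ?rmorph0. Qed.
Lemma kconj1 k : kconj k 1 = 1.
Proof. by rewrite /kconj; case: ifP; rewrite ?rmorph1. Qed.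
Lemma kconj_norm k z : `|kconj k z| = `|z|.
Proof. by rewrite /kconj; case: ifP; rewrite ?norm_conjC. Qed.
Lemma kconj_add k k' z : kconj (k + k') z = kconj k (kconj k' z).
Proof.
rewrite /kconj; have -> : odd (absz (k + k')) = odd `|k|%N (+) odd `|k'|%N by lia.
by case: (odd `|k|%N); case: (odd `|k'|%N); rewrite /= ?conjCK.
Qed.
Lemma kconjK k z : kconj k (kconj k z) = z.
Proof. by rewrite /kconj; case: (odd `|k|%N); rewrite ?conjCK. Qed.
Lemma kconj_opp k z : kconj (- k) z = kconj k z.
Proof. by rewrite /kconj abszN. Qed.

Definition mkGlide (k : int) (a b : C) (h : `|a| = 1) : glide :=
  @Glide (k, a, b) (introT eqP h).

Lemma one_norm : `|1 : C| = 1. Proof. exact: normr1. Qed.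
Definition gone : glide := mkGlide 0 0 one_norm.

Lemma mul_norm x y : `|ga x * kconj (gk x) (ga y)| = 1.
Proof. by rewrite normrM kconj_norm !ga_norm mulr1. Qed.
Definition gmul x y : glide :=
  mkGlide (gk x + gk y) (gb x + ga x * kconj (gk x) (gb y)) (mul_norm x y).

Lemma inv_norm x : `|kconj (gk x) (ga x)^-1| = 1.
Proof. by rewrite kconj_norm normfV ga_norm invr1. Qed.
Definition ginv x : glide :=
  mkGlide (- gk x) (- kconj (gk x) ((ga x)^-1 * gb x)) (inv_norm x).

Lemma gmulA : associative gmul.
Proof.
move=> x y z; apply: glideP; rewrite /gmul /gk /ga /gb /= -?/(gk _) -?/(ga _) -?/(gb _).
- by rewrite addrA.
- by rewrite kconj_add kconjM mulrA.
- by rewrite kconj_add kconjD kconjM mulrDr !mulrA addrA.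
Qed.

Lemma gmul1 : left_id gone gmul.
Proof.
move=> x; apply: glideP; rewrite /gmul /gone /gk /ga /gb /= -?/(gk _) -?/(ga _) -?/(gb _).
- by rewrite add0r.
- by rewrite /kconj /= mul1r.
- by rewrite /kconj /= mul1r add0r.
Qed.

Lemma gmulr1 : right_id gone gmul.
Proof.
move=> x; apply: glideP; rewrite /gmul /gone /gk /ga /gb /= -?/(gk _) -?/(ga _) -?/(gb _).
- by rewrite addr0.
- by rewrite kconj1 mulr1.
- by rewrite kconj0 mulr0 addr0.
Qed.

Lemma gmulVx : left_inverse gone ginv gmul.
Proof.
move=> x; apply: glideP; rewrite /gmul /ginv /gone /gk /ga /gb /= -?/(gk _) -?/(ga _) -?/(gb _).
- by rewrite addNr.
- by rewrite kconj_opp -kconjM mulVf ?ga_neq0// kconj1.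
- by rewrite kconj_opp -kconjM addNr.
Qed.

Lemma gmulxV : right_inverse gone ginv gmul.
Proof.
move=> x; apply: glideP; rewrite /gmul /ginv /gone /gk /ga /gb /= -?/(gk _) -?/(ga _) -?/(gb _).
- by rewrite addrN.
- by rewrite kconjK mulfV ?ga_neq0.
- by rewrite kconjN kconjK mulrN mulrA mulfV ?ga_neq0// mul1r addrN.
Qed.

HB.instance Definition _ := isGroup.Build glide gmulA gmul1 gmulr1 gmulVx gmulxV.

End GlideType.

Section GlideRelations.
Variable C : numClosedFieldType.
Local Notation glide := (glide C).
Implicit Types (x y g U V : glide).

Lemma gkM x y : gk (x * y)%g = gk x + gk y. Proof. by []. Qed.
Lemma gaM x y : ga (x * y)%g = ga x * kconj (gk x) (ga y). Proof. by []. Qed.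
Lemma gbM x y : gb (x * y)%g = gb x + ga x * kconj (gk x) (gb y).
Proof. by []. Qed.
Lemma gkV x : gk (x^-1)%g = - gk x. Proof. by []. Qed.
Lemma gaV x : ga (x^-1)%g = kconj (gk x) (ga x)^-1. Proof. by []. Qed.
Lemma gbV x : gb (x^-1)%g = - kconj (gk x) ((ga x)^-1 * gb x). Proof. by []. Qed.
Lemma gkX x n : gk (x ^+ n)%g = gk x *+ n.
Proof. by elim: n => [//|n IH]; rewrite expgS gkM IH mulrS. Qed.

Lemma kconj_odd (k : int) (z : C) : odd `|k|%N -> kconj k z = z^*.
Proof. by rewrite /kconj => ->. Qed.
Lemma kconj_even (k : int) (z : C) : ~~ odd `|k|%N -> kconj k z = z.
Proof. by rewrite /kconj => /negPf ->. Qed.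
Lemma kconj_int0 (z : C) : kconj 0 z = z. Proof. by []. Qed.

Lemma gaX x n : gk x = 0 -> ga (x ^+ n)%g = ga x ^+ n.
Proof. by move=> k0; elim: n => [//|n IH]; rewrite expgS gaM k0 IH exprS. Qed.

(** The geometric sum, cleared of its denominator. *)
Lemma gbX x n : gk x = 0 ->
  (ga x - 1) * gb (x ^+ n)%g = (ga x ^+ n - 1) * gb x.
Proof.
move=> k0; elim: n => [|n IH]; first by rewrite expg0 expr0 subrr mul0r mulr0.
rewrite expgS gbM k0 kconj_int0 mulrDr mulrCA IH exprS; ring.
Qed.

Lemma gbX1 x n : gk x = 0 -> ga x = 1 -> gb (x ^+ n)%g = gb x *+ n.
Proof.
move=> k0 a1; elim: n => [//|n IH].
by rewrite expgS gbM k0 kconj_int0 a1 mul1r IH mulrS.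
Qed.

Lemma ga_conjg x y : ~~ odd `|gk x|%N -> ga (x ^ y)%g = kconj (gk y) (ga x).
Proof.
move=> ex; rewrite conjgE !gaM gaV gkV kconj_opp (kconj_even _ ex) -kconjM.
by congr kconj; rewrite mulrCA mulVf ?ga_neq0 ?mulr1.
Qed.

Lemma gb_conjg_norm x y : ~~ odd `|gk x|%N -> ga x = 1 ->
  `|gb (x ^ y)%g| = `|gb x|.
Proof.
move=> ex a1; rewrite conjgE !gbM gbV gaV gkV kconj_opp (kconj_even _ ex) a1.
rewrite mul1r -kconjM -kconjN -kconjD kconj_norm mulrDr addrCA addNr addr0.
by rewrite normrM normfV ga_norm invr1 mul1r.
Qed.

Lemma gb_inv_norm x : `|gb (x^-1)%g| = `|gb x|.
Proof. by rewrite gbV normrN kconj_norm normrM normfV ga_norm invr1 mul1r. Qed.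

Section Relations.
Variables (m l : nat).
Hypotheses (m_gt0 : (0 < m)%N) (l_gt0 : (0 < l)%N).

Lemma rels_eqs g U V : rels m l g U V <->
  (U * g * V ^+ l = V ^+ l * g)%g /\ (g * (U ^- m * V) = U ^- m * g)%g.
Proof.
split=> [[rU rV]|[E1 E2]].
  split; first by rewrite {1}rU mulgVK mulgVK.
  by rewrite {1}rV !mulgA mulgVK mulgV mul1g.
split.
  by rewrite -E1 !mulgK.
by rewrite -!mulgA -E2 mulKg mulVKg.
Qed.

Lemma rels_conj g U V h : rels m l g U V -> rels m l (g ^ h)%g (U ^ h)%g (V ^ h)%g.
Proof.
move=> [rU rV]; split.
  by rewrite {1}rU !conjMg !conjVg conjXg.
by rewrite {1}rV !conjMg !conjVg conjXg.
Qed.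

Lemma longitude_conj U V h :
  longitude m l (U ^ h)%g (V ^ h)%g = (longitude m l U V ^ h)%g.
Proof. by rewrite /longitude !conjMg !conjVg !conjXg. Qed.

Lemma rels_rot g U V : odd `|gk g|%N -> rels m l g U V ->
  [/\ gk U = 0, gk V = 0, ga U = ga V ^+ (2 * l) & ga V = ga U ^+ (2 * m)].
Proof.
move=> og /rels_eqs[E1 E2].
have kU : gk U = 0.
  have := congr1 (@gk C) E1; rewrite !gkM => E.
  by apply: (addIr (gk g + gk (V ^+ l)%g)); rewrite addrA E add0r addrC.
have kV : gk V = 0.
  have := congr1 (@gk C) E2; rewrite !gkM => E.
  by apply: (addrI (gk g + gk (U ^- m)%g)); rewrite -addrA E addr0 addrC.
split=> //.
  have := congr1 (@ga C) E1; rewrite !gaM gkM gkX kU kV mul0rn add0r !kconj_int0.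
  rewrite (kconj_odd _ og) gaX// rmorphXn /= ga_conj => e.
  have v0 : ga V ^+ l != 0 by rewrite expf_neq0 ?ga_neq0.
  have j0 := ga_neq0 g.
  rewrite mul2n -addnn exprD; apply: (mulIf j0); apply: (mulIf (invr_neq0 v0)).
  by rewrite -exprVn e exprVn; field.
have := congr1 (@ga C) E2; rewrite !gaM gkV gkX kU mul0rn oppr0 !kconj_int0.
rewrite (kconj_odd _ og) gaV gkX kU mul0rn kconj_int0 gaX// rmorphM fmorphV.
rewrite rmorphXn /= !ga_conj => e.
have u0 : ga U ^+ m != 0 by rewrite expf_neq0 ?ga_neq0.
have j0 := ga_neq0 g; have v0 := ga_neq0 V.
move: e; rewrite exprVn invrK => e.
have {}e : ga U ^+ m * (ga V)^-1 = (ga U ^+ m)^-1.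
  by apply: (mulfI j0); rewrite e mulrC.
rewrite mul2n -addnn exprD; apply: (mulIf (invr_neq0 v0)).
by rewrite mulfV// -mulrA e mulfV.
Qed.

Lemma longitude_rot g U V : odd `|gk g|%N -> rels m l g U V ->
  gk (longitude m l U V) = 0 /\ ga (longitude m l U V) = 1.
Proof.
move=> og /(rels_rot og)[kU kV _ _].
split; first by rewrite /longitude !gkM !gkV !gkX kU kV !mul0rn !oppr0 !addr0.
rewrite /longitude !gaM !gkM !gkV !gaV !gkX kU kV !mul0rn !oppr0 !addr0 !kconj_int0 !gaX//.
by field; rewrite !expf_neq0 ?ga_neq0.
Qed.

Lemma rels_order g U V : odd `|gk g|%N -> rels m l g U V ->
  ga U ^+ (4 * m * l - 1) = 1.
Proof.
move=> og /(rels_rot og)[_ _ uE vE].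
apply: (mulIf (ga_neq0 U)); rewrite mul1r -exprSr.
have -> : (4 * m * l - 1).+1 = (2 * m * (2 * l))%N by nia.
by rewrite exprM -vE -uE.
Qed.

Lemma square_glide g : odd `|gk g|%N ->
  [/\ ~~ odd `|gk (g * g)%g|%N, ga (g * g)%g = 1 & gb (g * g)%g = gb g + ga g * (gb g)^*].
Proof.
move=> og; rewrite gkM gaM gbM !(kconj_odd _ og) ga_conj mulfV ?ga_neq0//; split=> //.
by rewrite -mulr2n -[gk g *+ 2]mulr_natr abszM oddM andbF.
Qed.

(** U and V are then translations, by b and w say, and with the rotation part j of g the relations
    read b = l (w - j conj w) and w = m (b - j conj b). Hence w = 2 m b and b = 4 m l b, so that b =
    w = 0. *)
Lemma longitude_trivial g U V : odd `|gk g|%N -> rels m l g U V ->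
  ga U = 1 -> gb (longitude m l U V) = 0.
Proof.
move=> og rel u1; have [kU kV _ vE] := rels_rot og rel.
have v1 : ga V = 1 by rewrite vE u1 expr1n.
have [/(congr1 (@gb C)) E1 /(congr1 (@gb C)) E2] := (rels_eqs g U V).1 rel.
move: E1 E2; rewrite !gbM !gaM !gkM !gbV !gaV !gkV !gkX kU kV !mul0rn oppr0 !add0r.
rewrite !kconj_int0 !(kconj_odd _ og) !gaX// !gbX1// u1 v1 !expr1n invr1 !mul1r.
set b := gb U; set w := gb V; set s := gb g; set j := ga g => E1 E2.
have j0 : j != 0 by exact: ga_neq0.
have jc : j^* = j^-1 by exact: ga_conj.
have bE : b = (w - j * w^*) *+ l.
  move: E1; rewrite rmorphMn /= => E1.
  apply: (addIr (s + j * (w^* *+ l))); rewrite addrA E1 mulrnBl mulrnAr; ring.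
have wE : w = (b - j * b^*) *+ m.
  have : - (b *+ m) = j * (w - b *+ m)^*.
    by apply: (addrI s); rewrite [w - _]addrC E2 addrC.
  move/(congr1 (fun z => j * z^*)); rewrite rmorphM /= conjCK jc mulrA mulfV// mul1r.
  rewrite rmorphN rmorphMn /= mulrN mulrnAr mulrnBl => e.
  by apply: (addIr (- (b *+ m))); rewrite -e; ring.
have sb : j * b^* = - b.
  rewrite bE rmorphMn rmorphB rmorphM /= conjCK jc mulrnAr mulrBr mulrA mulfV// mul1r.
  by rewrite -mulNrn opprB.
have wb : w = b *+ (2 * m) by rewrite {1}wE sb opprK -mulr2n mulrnA.
have b0 : b = 0.
  have : b *+ (4 * m * l) = b *+ 1.
    rewrite mulr1n {2}bE wb rmorphMn /= mulrnAr sb -mulNrn opprK -mulrnDl -mulrnA.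
    by rewrite -mulr2n -mulrnA; congr (_ *+ _); nia.
  have -> : (4 * m * l = (4 * m * l - 1) + 1)%N by nia.
  rewrite mulrnDr -[RHS]add0r => /addIr /eqP; rewrite mulrn_eq0.
  by case/orP=> [|/eqP//]; nia.
have w0 : w = 0 by rewrite wb b0 mul0rn.
by rewrite b0 w0 !mul0rn !oppr0 !addr0.
Qed.

End Relations.
End GlideRelations.

Section LongitudeNorm.
Variable C : numClosedFieldType.
Local Notation glide := (glide C).
Implicit Types (x y g U V : glide).
Variables (m l : nat).
Hypotheses (m_gt0 : (0 < m)%N) (l_gt0 : (0 < l)%N).

Section Order.
Variable u : C.
Hypotheses (uN : u ^+ (4 * m * l - 1) = 1) (u1 : u != 1).

(** A divisor of N + 1 = 4 m l is prime to N, while the order of [u] divides N. *)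
Lemma odd_order_exp (d : nat) : (0 < d)%N -> (d %| 4 * m * l)%N -> u ^+ d != 1.
Proof.
move=> d0 /dvdnP[q qE]; apply: contra_neq u1 => ud.
have : u ^+ (4 * m * l) = 1 by rewrite qE mulnC exprM ud expr1n.
have -> : (4 * m * l = (4 * m * l - 1).+1)%N by nia.
by rewrite exprSr uN mul1r.
Qed.

(** Makes the two half-angle tangents of the ratio finite and nonzero. *)
Lemma eta_neq : [/\ u ^+ m != 1, u ^+ m + 1 != 0, u ^+ (2 * m * l) != 1 &
  u ^+ (2 * m * l) + 1 != 0].
Proof.
have sqN (z : C) : z + 1 = 0 -> z ^+ 2 = 1.
  by move/eqP; rewrite addr_eq0 => /eqP ->; rewrite sqrrN expr1n.
split.
- by apply: odd_order_exp => //; apply/dvdnP; exists (4 * l)%N; nia.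
- apply/eqP => /sqN; rewrite -exprM; apply/eqP/odd_order_exp; first by nia.
  by apply/dvdnP; exists (2 * l)%N; nia.
- by apply: odd_order_exp; [nia|apply/dvdnP; exists 2%N; nia].
- apply/eqP => /sqN; rewrite -exprM; apply/eqP/odd_order_exp; first by nia.
  by apply/dvdnP; exists 1%N; nia.
Qed.

Lemma xi_sqr : u ^+ (2 * m * l) ^+ 2 = u.
Proof.
rewrite -exprM; have -> : (2 * m * l * 2 = (4 * m * l - 1).+1)%N by nia.
by rewrite exprSr uN mul1r.
Qed.

End Order.

(** The value of |lam / tau| with denominators cleared: for z = exp(i x) the quotient |z - 1| / |z +
    1| is |tan(x/2)|. *)
Definition ratio_eq (u : C) (tau lam : C) : Prop :=
  `|lam| * (`|u ^+ m + 1| * `|u ^+ (2 * m * l) + 1|) =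
  `|tau| * (`|u ^+ m - 1| * `|u ^+ (2 * m * l) - 1|).

(** Once U fixes 0, the translation parts of the relations are linear in those of g and V and their
    conjugates. They are solved in terms of eta = u^m and xi = u^(2ml), where xi^2 = u. *)
Lemma longitude_norm g U V : odd `|gk g|%N -> rels m l g U V -> ga U != 1 ->
  ratio_eq (ga U) (gb (g * g)%g) (gb (longitude m l U V)).
Proof.
wlog b0 : g U V / gb U = 0 => [wl|] og rel u1.
  have [kU kV _ _] := rels_rot og rel.
  (* The fixed point of U; conjugating by the translation [h] moves it to 0. *)
  pose p := gb U / (1 - ga U).
  pose h : glide := mkGlide 0 p (one_norm C).
  have hE x : gk x = 0 -> ga (x ^ h)%g = ga x.
    by move=> kx; rewrite ga_conjg ?kx// kconj_int0.
  have bh : gb (U ^ h)%g = 0.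
    rewrite conjgE !gbM gbV gaV gkV kU !kconj_int0 /gb /ga /gk /= /kconj /=.
    rewrite invr1 !mul1r -/(gb U) -/(ga U) /p; by field; rewrite subr_eq0 eq_sym.
  have ogh : odd `|gk (g ^ h)%g|%N.
    by rewrite conjgE !gkM gkV; have -> : - gk h + (gk g + gk h) = gk g by ring.
  have [e1 e2 _] := square_glide og.
  have [kL aL] := longitude_rot og rel.
  have := wl _ _ _ bh ogh (rels_conj h rel); rewrite hE// => /(_ u1).
  rewrite longitude_conj -conjMg /ratio_eq !gb_conjg_norm//.
  by rewrite kL.
have [kU kV uE vE] := rels_rot og rel.
have uN := rels_order m_gt0 l_gt0 og rel.
have [n1 n2 n3 n4] := eta_neq uN u1; have xs := xi_sqr uN u1.
have [E1 E2] := (rels_eqs m l g U V).1 rel.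
have [_ _ tE] := square_glide og.
have E3 : (V ^+ l * (U ^+ m * longitude m l U V) = U ^+ m * V ^+ l)%g.
  by rewrite /longitude -!mulgA !mulVKg.
have [kL aL] := longitude_rot og rel.
set La := longitude _ _ _ _ in E3 kL aL *; clearbody La.
have bUm : gb (U ^+ m)%g = 0.
  by apply/eqP; have /eqP := gbX m kU; rewrite b0 mulr0 mulf_eq0 subr_eq0 (negPf u1).
have xiE : ga V ^+ l = ga U ^+ (2 * m * l) by rewrite vE -exprM.
have v2 : ga V = ga U ^+ m ^+ 2 by rewrite vE mulnC exprM.
have H0 := gbX l kV.
have {}E1 := congr1 (@gb C) E1; have {}E2 := congr1 (@gb C) E2.
have {}E3 := congr1 (@gb C) E3.
rewrite /ratio_eq tE; move: H0 E1 E2 E3.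
rewrite !gbM !gaM !gkM gbV gaV !gkV !gkX kU kV !mul0rn oppr0 !add0r.
rewrite !kconj_int0 !(kconj_odd _ og) !gaX// b0 bUm xiE v2 ?mulr0 ?oppr0 ?add0r ?addr0.
set eta := ga U ^+ m in n1 n2 *; set xi := ga U ^+ _ in n3 n4 xs *.
set s := gb g; set j := ga g; set w := gb V; set wl := gb _.
set lam := gb _; rewrite -[ga U]xs.
have j0 : j != 0 by exact: ga_neq0.
have jc : j^* = j^-1 by exact: ga_conj.
have e0 : eta != 0 by rewrite expf_neq0 ?ga_neq0.
have x0 : xi != 0 by rewrite expf_neq0 ?ga_neq0.
have ec : eta^* = eta^-1 by rewrite rmorphXn /= ga_conj exprVn.
have xc : xi^* = xi^-1 by rewrite rmorphXn /= ga_conj exprVn.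
clearbody eta xi s j w wl lam => H0 E1 E2 E3.
have E2c := congr1 (fun z => z^*) E2; move: E2c => /=.
rewrite !(rmorphD, rmorphM) /= !fmorphV /= !conjCK jc ec invrK => E2c.
have wE : w = (eta - 1) * eta * j * s^*.
  have e : j^-1 * (eta^-1 * w) = eta * s^* - s^*.
    by rewrite -E2c; ring.
  have -> : w = eta * j * (j^-1 * (eta^-1 * w)) by field; rewrite e0 j0.
  by rewrite e; ring.
have wlE : (eta + 1) * wl = (xi - 1) * eta * j * s^*.
  have d : eta - 1 != 0 by rewrite subr_eq0.
  by apply: (mulfI d); rewrite mulrA -subr_sqr_1 H0 wE; ring.
have wlc : (eta + 1) * wl^* = (xi^-1 - 1) * (j^-1 * s).
  have := congr1 (fun z => eta * z^*) wlE; rewrite !(rmorphD, rmorphM, rmorphB) /=.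
  rewrite rmorphN1 rmorph1 jc ec xc conjCK => e.
  have -> : (eta + 1) * wl^* = eta * ((eta^-1 + 1) * wl^*) by field.
  by rewrite e; field; rewrite x0 e0 j0.
(* The last relation ties the rotation part [j] of g to its translation part [s]; it is what makes
   the translation of g^2 equal to [s * (xi + 1)]. *)
have sE : xi * s = j * s^*.
  have d : (xi - 1) * eta != 0 by rewrite mulf_neq0// subr_eq0.
  apply: (mulfI d); rewrite [RHS]mulrA -wlE.
  have -> : (eta + 1) * wl = (eta + 1) * (xi ^+ 2 * s + xi ^+ 2 * j * wl^* - xi * s).
    by rewrite E1; ring.
  transitivity ((eta + 1) * (xi ^+ 2 * s - xi * s) + xi ^+ 2 * j * ((eta + 1) * wl^*)); last by ring.
  by rewrite wlc; field; rewrite x0 j0.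
have lamE : xi * eta * lam = (eta - 1) * wl.
  by rewrite mulrBl -E3; ring.
have e1n : `|eta| = 1.
  by apply/eqP; rewrite -sqrp_eq1 ?normr_ge0// normCK ec mulfV.
have x1n : `|xi| = 1.
  by apply/eqP; rewrite -sqrp_eq1 ?normr_ge0// normCK xc mulfV.
have j1n : `|j| = 1.
  by apply/eqP; rewrite -sqrp_eq1 ?normr_ge0// normCK jc mulfV.
have lamN : `|lam| = `|eta - 1| * `|wl|.
  by have := congr1 Num.norm lamE; rewrite !normrM e1n x1n !mul1r.
have wlN : `|eta + 1| * `|wl| = `|xi - 1| * `|s|.
  by have := congr1 Num.norm wlE; rewrite !normrM norm_conjC e1n j1n !mulr1.
have -> : s + j * s^* = s * (xi + 1) by rewrite -sE; ring.
rewrite normrM lamN.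
transitivity (`|eta - 1| * (`|eta + 1| * `|wl|) * `|xi + 1|); first by ring.
by rewrite wlN; ring.
Qed.

End LongitudeNorm.

(** * Cyclic and peripheral subgroups *)

Section Powers.
Variable G : groupType.
Local Open Scope group_scope.
Implicit Types (x y : G) (Q : set G).

(** The cyclic subgroup generated by [x]; two natural exponents stand for an integer. *)
Definition powers x : set G := [set y | exists i j, y = x ^+ i * x ^- j].

Lemma powers_comm x y z : x * y = y * x -> powers x z -> z * y = y * z.
Proof.
move=> xy [i [j ->]]; have c : commute y x by rewrite /commute xy.
have ci := commuteX i c; have cj := commuteV (commuteX j c).
by apply/esym; exact: commuteM.
Qed.

Lemma subgroup_powers x : subgroup (powers x).
Proof.
split.
- by exists 0%N, 0%N; rewrite !expg0 mulgV.
- move=> y z [i [j ->]] [i' [j' ->]]; exists (i + i')%N, (j' + j)%N.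
  have c : commute (x ^+ i') (x ^- j).
    by apply: commuteV; apply: commuteX; apply/commute_sym/commuteX/commute_refl.
  by rewrite !expgnDr invgM !mulgA; congr (_ * _); rewrite -!mulgA c.
- move=> y [i [j ->]]; exists j, i.
  by rewrite invgM invgK.
Qed.

Lemma subgroup_powers2 x y : x * y = y * x ->
  subgroup [set z | exists a b, [/\ powers x a, powers y b & z = a * b]].
Proof.
move=> xy; have [X1 XM XV] := subgroup_powers x; have [Y1 YM YV] := subgroup_powers y.
have ab a b : powers x a -> powers y b -> a * b = b * a.
  move=> ha hb; apply: (powers_comm (x := x)) ha.
  by apply/esym; apply: (powers_comm (x := y)) hb.
split.
- by exists 1, 1; split=> //; rewrite mulg1.
- move=> _ _ [a [b [ha hb ->]]] [a' [b' [ha' hb' ->]]].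
  exists (a * a'), (b * b'); split; [exact: XM|exact: YM|].
  by rewrite -!mulgA; congr (_ * _); rewrite !mulgA (ab _ _ ha' hb).
- move=> _ [a [b [ha hb ->]]]; exists (a^-1), (b^-1); split; [exact: XV|exact: YV|].
  by rewrite invgM (ab _ _ (XV _ ha) (YV _ hb)).
Qed.

Lemma powers_id x : powers x x.
Proof. by exists 1%N, 0%N; rewrite expg0 expg1 invg1 mulg1. Qed.

End Powers.

(** * Model triples and the comparison of their invariants *)

Section Model.
Variable C : numClosedFieldType.
Local Notation glide := (glide C).
Implicit Types (x y g U V : glide).

Lemma gk_powers g x : powers g x ->
  exists i j : nat, x = (g ^+ i * g ^- j)%g /\ gk x = gk g * (i%:Z - j%:Z).
Proof.
move=> [i [j ->]]; exists i, j; split=> //.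
by rewrite gkM gkV !gkX -(mulr_natr _ i) -(mulr_natr _ j) !natz -mulrBr.
Qed.

(** For N > 0, the elements whose linear part lies in a dihedral group of order 2N: the N-th roots
    of unity and, on the orientation-reversing elements, their products with the factor of [g]. Used
    to bound the order of the rotation part of V. *)
Definition rotations (N : nat) g : set glide := [set x |
  if odd `|gk x|%N then (ga x / ga g) ^+ N = 1 else ga x ^+ N = 1].

Lemma subgroup_rotations N g : subgroup (rotations N g).
Proof.
have a0 := ga_neq0; have ac := ga_conj.
have oD (k k' : int) : odd (absz (k + k')) = odd `|k|%N (+) odd `|k'|%N by lia.
have j0 := ga_neq0 g.
split.
- by rewrite /rotations /= /ga /= expr1n.
- move=> x y; rewrite /rotations /= gkM gaM oD /kconj.
  case: (odd `|gk x|%N); case: (odd `|gk y|%N) => /= hx hy.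
  + have -> : ga x * (ga y)^* = (ga x / ga g) * ((ga y / ga g)^-1).
      by rewrite ac invf_div; field; rewrite j0 a0.
    by rewrite exprMn hx exprVn hy invr1 mulr1.
  + have -> : ga x * (ga y)^* / ga g = (ga x / ga g) / ga y.
      by rewrite ac; field; rewrite j0 a0.
    by rewrite exprMn hx exprVn hy invr1 mulr1.
  + by rewrite -mulrA exprMn hx hy mulr1.
  + by rewrite exprMn hx hy mulr1.
- move=> x; rewrite /rotations /= gkV gaV abszN /kconj.
  case: (odd `|gk x|%N) => /= hx; last by rewrite exprVn hx invr1.
  by rewrite fmorphV /= ac invrK.
Qed.

Section Rels.
Variables (m l : nat).
Hypotheses (m_gt0 : (0 < m)%N) (l_gt0 : (0 < l)%N).
Local Notation N := (4 * m * l - 1)%N.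

(** The solution found in [longitude_norm], normalised by [gb U = 0] and [gb g = 1]: then [ga g] is
    xi, [gb V] is eta (eta - 1) xi, and g^2 translates by 1 + xi. *)
Lemma exists_model (u : C) : u ^+ N = 1 -> u != 1 ->
  exists g U V, [/\ rels m l g U V, gk g = 1, ga U = u & gb (g * g)%g != 0].
Proof.
move=> uN u1; have N0 : (0 < N)%N by nia.
have un : `|u| = 1.
  by apply/eqP; rewrite -(pexpr_eq1 N0) ?normr_ge0// -normrX uN normr1.
have [n1 n2 n3 n4] := eta_neq m_gt0 l_gt0 uN u1; have xs := xi_sqr m_gt0 l_gt0 uN u1.
have en : `|u ^+ m| = 1 by rewrite normrX un expr1n.
have xn : `|u ^+ (2 * m * l)| = 1 by rewrite normrX un expr1n.
have exE : u ^+ m ^+ (2 * l) = u ^+ (2 * m * l) by rewrite -exprM; congr (_ ^+ _); nia.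
set eta := u ^+ m in n1 n2 en exE; set xi := u ^+ (2 * m * l) in n3 n4 xs xn exE.
have vn : `|eta ^+ 2| = 1 by rewrite normrX en expr1n.
pose g := mkGlide 1 1 xn; pose U := mkGlide 0 0 un.
pose V := mkGlide 0 (eta * (eta - 1) * xi) vn.
have aU : ga U = u by [].
have aV : ga V = eta ^+ 2 by [].
have ag : ga g = xi by [].
have bU : gb U = 0 by [].
have bV : gb V = eta * (eta - 1) * xi by [].
have bg : gb g = 1 by [].
have kU : gk U = 0 by [].
have kV : gk V = 0 by [].
have kg : gk g = 1 by [].
have og : odd `|gk g|%N by [].
have e0 : eta != 0 by rewrite -normr_eq0 en oner_eq0.
have x0 : xi != 0 by rewrite -normr_eq0 xn oner_eq0.
have ec : eta^* = eta^-1 by apply: (mulfI e0); rewrite -normCK en expr1n mulfV.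
have xc : xi^* = xi^-1 by apply: (mulfI x0); rewrite -normCK xn expr1n mulfV.
have bUm : gb (U ^+ m)%g = 0.
  by apply/eqP; have /eqP := gbX m kU; rewrite bU mulr0 mulf_eq0 subr_eq0 aU (negPf u1).
have aVl : ga (V ^+ l)%g = xi by rewrite gaX// aV -exprM.
have wE : (eta + 1) * gb (V ^+ l)%g = (xi - 1) * eta * xi.
  have d : eta - 1 != 0 by rewrite subr_eq0.
  apply: (mulfI d); rewrite mulrA -subr_sqr_1.
  by have := gbX l kV; rewrite aV -exprM exE bV => ->; ring.
have wc : (eta + 1) * (gb (V ^+ l)%g)^* = (xi^-1 - 1) * xi^-1.
  have := congr1 (fun z => eta * z^*) wE; rewrite !(rmorphD, rmorphM, rmorphB) /=.
  rewrite rmorphN1 rmorph1 ec xc => e.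
  have -> : (eta + 1) * (gb (V ^+ l)%g)^* = eta * ((eta^-1 + 1) * (gb (V ^+ l)%g)^*) by field.
  by rewrite e; field; rewrite x0 e0.
clearbody g U V.
exists g, U, V; split=> //.
- apply/rels_eqs; split; apply: glideP.
  + by rewrite !gkM gkX kU kV kg mul0rn.
  + rewrite !gaM gkM gkX kU kV kg mul0rn kconj_int0 (kconj_odd _ (_ : odd `|0 + 1|%N))//.
    by rewrite aVl aU ag xc -xs; field.
  + rewrite !gbM !gaM gkM gkX kU kV kg mul0rn !kconj_int0 (kconj_odd _ (_ : odd `|0 + 1|%N))//.
    rewrite aVl aU ag bU bg add0r mulr1 -xs.
    apply: (mulfI n2); rewrite [RHS]mulrDr wE.
    transitivity (xi ^+ 2 * (eta + 1) + xi ^+ 3 * ((eta + 1) * (gb (V ^+ l)%g)^*)); first by ring.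
    by rewrite wc; field.
  + by rewrite !gkM gkV gkX kU kV kg mul0rn.
  + rewrite !gaM !gaV !gkV !gkX kU kg mul0rn oppr0 !kconj_int0 (kconj_odd _ (_ : odd `|1|%N))//.
    rewrite gaX// aU aV ag -/eta rmorphM fmorphV rmorphXn /= ec.
    by field.
  + rewrite !gbM !gbV !gaV !gkV !gkX kU kg mul0rn oppr0 !kconj_int0 (kconj_odd _ (_ : odd `|1|%N))//.
    rewrite gaX// aU bUm mulr0 oppr0 !add0r ag bg bV -/eta !(rmorphM, rmorphB) fmorphV rmorph1 /= ec xc.
    by field; rewrite e0.
- have [_ _ ->] := square_glide og.
  by rewrite bg ag rmorph1 mulr1 addrC.
Qed.

End Rels.

Lemma mulz_eq1 (a b : int) : a * b = 1 -> (a = 1 /\ b = 1) \/ (a = -1 /\ b = -1).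
Proof.
move=> ab; have := congr1 absz ab; rewrite abszM => /eqP; rewrite muln_eq1 => /andP[/eqP a1 /eqP b1].
have [[aE|aE] [bE|bE]] : (a = 1 \/ a = -1) /\ (b = 1 \/ b = -1) by lia.
- by left.
- by move: ab; rewrite aE bE.
- by move: ab; rewrite aE bE.
- by right.
Qed.

(** Conjugation preserves [gk]. So a conjugate of g that is a power of g' must be g' or its inverse,
    and the squares have the same translation length. In the conjugate of the longitude the power of
    g' has [gk] zero, hence is 1, and a power of the other longitude remains; it multiplies the
    length by [d], which is not 0 because the longitude is not trivial. *)
Lemma glide_compare (m l m' l' : nat) g U V g' U' V' :
  (0 < m)%N -> (0 < l)%N -> (0 < m')%N -> (0 < l')%N ->
  rels m l g U V -> gk g = 1 -> ga U != 1 -> gb (g * g)%g != 0 ->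
  rels m' l' g' U' V' ->
  (exists h, powers g' (h^-1 * g * h)%g) ->
  (exists h, exists a b, [/\ powers g' a, powers (longitude m' l' U' V') b &
     (h^-1 * longitude m l U V * h = a * b)%g]) ->
  (forall N, rotations N g' U' -> rotations N g' V' ->
     exists h, rotations N g' (h^-1 * V * h)%g) ->
  let u := ga U in
  u ^+ (2 * m) ^+ (4 * m' * l' - 1) = 1 /\
  exists u' (d : nat), [/\ u' ^+ (4 * m' * l' - 1) = 1, u' != 1, (0 < d)%N &
    (`|u ^+ m - 1| * `|u ^+ (2 * m * l) - 1|) *
      (`|u' ^+ m' + 1| * `|u' ^+ (2 * m' * l') + 1|) =
    d%:R * (`|u' ^+ m' - 1| * `|u' ^+ (2 * m' * l') - 1|) *
      (`|u ^+ m + 1| * `|u ^+ (2 * m * l) + 1|)].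
Proof.
move=> m0 l0 m0' l0' rel kg u1 tau0 rel' [h1 P1] [h2 [a2 [b2 [Pa Pb E2]]]] P3 /=.
have cE (h x : glide) : (h^-1 * x * h = x ^ h)%g by rewrite conjgE mulgA.
have kc x h : gk (x ^ h)%g = gk x by rewrite conjgE !gkM gkV; ring.
have og : odd `|gk g|%N by rewrite kg.
have [kU kV uE vE] := rels_rot og rel.
have uN := rels_order m0 l0 og rel.
have [kL aL] := longitude_rot og rel.
have [i [j [e1 ke1]]] := gk_powers P1.
rewrite !cE in e1 ke1 E2 *; rewrite kc kg in ke1.
have kg'1 := mulz_eq1 (esym ke1).
have og' : odd `|gk g'|%N by case: kg'1 => -[-> _].
have [kU' kV' uE' vE'] := rels_rot og' rel'.
have uN' := rels_order m0' l0' og' rel'.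
have [kL' aL'] := longitude_rot og' rel'.
have [k2 a2' _] := square_glide og; have [k2' a2'' _] := square_glide og'.
have tauE : `|gb (g * g)%g| = `|gb (g' * g')%g|.
  rewrite -(gb_conjg_norm (x := (g * g)%g) h1 k2 a2') conjMg.
  case: kg'1 => -[_ ij].
    have -> : (g ^ h1 = g')%g.
      have iE : i = j.+1 by lia.
      rewrite e1 iE expgSr -mulgA.
      have -> : (g' * g' ^- j = g' ^- j * g')%g by apply: commuteV; apply: commuteX; exact: commute_refl.
      by rewrite mulgA mulgV mul1g.
    by [].
  have -> : (g ^ h1 = g'^-1)%g.
    have jE : j = i.+1 by lia.
    by rewrite e1 jE expgS invgM mulgA mulgV mul1g.
  by rewrite -invgM gb_inv_norm.
have [i2 [j2 [ea kea]]] := gk_powers Pa; have [i3 [j3 [eb keb]]] := gk_powers Pb.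
have a21 : a2 = 1%g.
  have : gk (longitude m l U V ^ h2)%g = 0 by rewrite kc.
  rewrite E2 gkM kea keb kL' mul0r addr0 => /eqP.
  rewrite mulf_eq0 => /orP[/eqP g0|/eqP ij]; first by rewrite g0 in og'.
  have ij' : i2 = j2 by lia.
  by rewrite ea ij'; exact: mulgV.
have lamE : `|gb (longitude m l U V)| =
    `|i3%:Z - j3%:Z|%:~R * `|gb (longitude m' l' U' V')|.
  rewrite -(gb_conjg_norm h2 _ aL) ?kL// E2 a21 mul1g eb.
  rewrite gbM gbV !gkX kL' !mul0rn !kconj_int0 !gaX// aL' !expr1n invr1 !mul1r !gbX1//.
  have -> : (`|i3%:Z - j3%:Z|%:~R : C) = `|i3%:R - j3%:R|.
    by rewrite intr_norm rmorphB.
  by rewrite -[_ *+ i3]mulr_natl -[_ *+ j3]mulr_natl -mulrBl normrM.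
have lam0 : gb (longitude m l U V) != 0.
  have := longitude_norm m0 l0 og rel u1; rewrite /ratio_eq => e.
  have [n1 n2 n3 n4] := eta_neq m0 l0 uN u1.
  apply: contra_eq_neq e => ->; rewrite normr0 mul0r eq_sym.
  by rewrite !mulf_neq0// normr_eq0 ?subr_eq0.
have d0 : (0 < `|i3%:Z - j3%:Z|)%N.
  by rewrite lt0n; apply: contraNneq lam0 => e; rewrite -normr_eq0 lamE -abszE e mul0r.
have lam0' : gb (longitude m' l' U' V') != 0.
  by apply: contraNneq lam0 => e; rewrite -normr_eq0 lamE e normr0 mulr0.
(* Otherwise the second longitude would be trivial by [longitude_trivial]. *)
have u1' : ga U' != 1.
  by apply: contraNneq lam0' => e; rewrite (longitude_trivial m0' l0' og' rel' e).
split.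
  have hU' : rotations (4 * m' * l' - 1) g' U' by rewrite /rotations /= kU'.
  have hV' : rotations (4 * m' * l' - 1) g' V'.
    by rewrite /rotations /= kV' vE' exprAC uN' expr1n.
  have [h] := P3 _ hU' hV'; rewrite cE /rotations /= kc kV /=.
  rewrite ga_conjg ?kV// vE /kconj; case: ifP => // _ /(congr1 (fun z => z^*)).
  by rewrite rmorph1 -rmorphXn /= conjCK.
exists (ga U'), `|i3%:Z - j3%:Z|%N; split=> //.
have R1 := longitude_norm m0 l0 og rel u1.
have R2 := longitude_norm m0' l0' og' rel' u1'.
move: R1 R2; rewrite /ratio_eq tauE lamE.
set A := _ * `|ga U ^+ (2 * m * l) - 1|; set B := _ * `|ga U ^+ (2 * m * l) + 1|.
set A' := _ * `|ga U' ^+ (2 * m' * l') - 1|; set B' := _ * `|ga U' ^+ (2 * m' * l') + 1|.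
have t0 : `|gb (g' * g')%g| != 0 by rewrite -tauE normr_eq0.
rewrite -[_%:R]/(_%:R) => R1 R2.
apply: (mulfI t0); rewrite mulrA -R1.
transitivity (`|i3%:Z - j3%:Z|%N%:R * (`|gb (longitude m' l' U' V')| * B') * B).
  by rewrite pmulrn; ring.
by rewrite R2; ring.
Qed.

End Model.

(** * Comparison of two knots *)

Section Transport.
Variables (R : realType) (G : groupType).
Local Notation V4 := 'rV[R]_4.
Variables (m l m' l' : nat).
Hypotheses (m_gt0 : (0 < m)%N) (l_gt0 : (0 < l)%N).
Hypotheses (m'_gt0 : (0 < m')%N) (l'_gt0 : (0 < l')%N).
Local Notation K := (double_twist R (2 * m)%N (2 * l)%N).
Local Notation K' := (double_twist R (2 * m')%N (2 * l')%N).
Local Notation X := (@knot_compl R (2 * m) (2 * l)).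
Local Notation X' := (@knot_compl R (2 * m') (2 * l')).

(** The system realising (g, U, V) is carried over to the other complement, where its charts define
    (g', U', V'). Reductions found there are pulled back along [f]; being conditions on
    neighbourhoods of the knot or of its points, they survive a mere homeomorphism. *)
Lemma transport (f : V4 -> V4) : homeo_on (@S3 R) f -> f @` K = K' ->
  forall g U V : G, rels m l g U V -> exists g' U' V',
  [/\ rels m' l' g' U' V',
      forall Q, subgroup Q -> Q g' -> exists h, Q (h^-1 * g * h)%g,
      forall Q, subgroup Q -> Q g' -> Q (longitude m' l' U' V') ->
        exists h, Q (h^-1 * longitude m l U V * h)%g &
      forall Q, subgroup Q -> Q g' -> Q U' -> Q V' -> exists h, Q (h^-1 * V * h)%g].
Proof.
move=> [f' [fS f'S fK f'K [cf cf']]] fKK g U V rel.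
have {}cf : cont_on (@S3 R) f by apply/cont_onP; apply/subspace_continuousP.
have {}cf' : cont_on (@S3 R) f' by apply/cont_onP; apply/subspace_continuousP.
have {}fK v : S3 v -> f' (f v) = v by move=> sv; apply: fK; exact/mem_set.
have {}f'K v : S3 v -> f (f' v) = v by move=> sv; apply: f'K; exact/mem_set.
have fX v : X v -> X' (f v).
  move=> [sv nk]; split; first exact: fS.
  rewrite -fKK => -[k kK e]; apply: nk.
  by rewrite -(fK _ sv) -e fK//; exact: double_twist_S3 kK.
have f'X v : X' v -> X (f' v).
  move=> [sv nk]; split; first exact: f'S.
  by move=> kK; apply: nk; rewrite -fKK; exists (f' v) => //; rewrite f'K.
have XS : X `<=` @S3 R by move=> v [].
have X'S : X' `<=` @S3 R by move=> v [].
have cfX := cont_on_sub XS cf; have cfX' := cont_on_sub X'S cf'.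
have [c [mp [mm [lc cc]]]] := exists_locsys R m_gt0 l_gt0 rel.
pose c' x y := c (f' x) (f' y).
have lc' : locsys X' c' := locsys_pull f'X cfX' lc.
have [mp' [mm' [gB1' [V' [g' cc']]]]] := charts_exist (locsys_sub (@sphere4_compl R m' l') lc').
have rel' := charts_rels m'_gt0 l'_gt0 lc' cc'.
have red_back Q F' v : X v -> red_at X' c' Q F' (f v) -> red_at X c Q (F' \o f) v.
  move=> Xv /(red_at_pull fX cfX Xv); apply: filterS => y h Xy; move: (h Xy).
  by rewrite /c' !fK//; exact: XS.
have near_back Q F' k : K k ->
    (\forall v \near f k, X' v -> red_at X' c' Q F' v) ->
    \forall v \near k, X v -> red_at X c Q (F' \o f) v.
  move=> kK h; apply: filterS (cf _ (double_twist_S3 kK) _ h) => v hv Xv.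
  by apply: red_back => //; apply: hv; [exact: XS|exact: fX].
have fKK' k : K k -> K' (f k) by rewrite -fKK => kK; exists k.
exists g', (gB1' * g'^-1)%g, V'; split=> //.
- move=> Q sQ Qg'.
  have cK : K (crossing R) by apply: crossing_knot; exact: even_n.
  have [F' hF'] := near_knot_point m'_gt0 l'_gt0 lc' cc' (fKK' _ cK).
  exact: (extract_meridian cc sQ (near_back _ _ _ cK (hF' Q sQ Qg'))).
- move=> Q sQ Qg' QL.
  have [F' hF'] := near_knot m'_gt0 l'_gt0 lc' cc'.
  have := extract_longitude m_gt0 l_gt0 lc cc (Q := Q) (F := F' \o f) sQ.
  rewrite mulgK; apply=> k kK; apply: near_back => //.
  by apply: hF' => //; exact: fKK'.
- move=> Q sQ Qg' QU QV.
  have [F' hF'] := red_compl m'_gt0 l'_gt0 lc' cc'.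
  apply: (extract_transverse cc (F := F' \o f) sQ) => v Xv; apply: red_back => //.
  by apply: hF' => //; exact: fX.
Qed.

End Transport.

(** * The least ratio *)

Section Trig.
Variable R : realType.
Implicit Types x y : R.

Lemma derive_ge0_le (f df : R -> R) x : 0 <= x ->
  (forall y, is_derive y 1 f (df y)) ->
  (forall y, 0 <= y <= x -> 0 <= df y) -> f 0 <= f x.
Proof.
move=> x0 fd df0; have [<-//|x_neq0] := eqVneq 0 x.
have xgt0 : 0 < x by rewrite lt_neqAle x_neq0.
have [c cx e] := @MVT R f df 0 x xgt0 (fun y _ => fd y)
  (derivable_within_continuous (fun y _ => @ex_derive _ _ _ _ _ _ _ (fd y))).
have /df0 h : 0 <= c <= x by move: cx; rewrite in_itv /= => /andP[/ltW -> /ltW ->].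
by rewrite -subr_ge0 e subr0 mulr_ge0.
Qed.

Lemma sin_le_id x : 0 <= x -> sin x <= x.
Proof.
move=> x0; have := @derive_ge0_le (fun y => y - sin y) (fun y => 1 - cos y) x x0.
rewrite sin0 subr0 subr_ge0; apply=> y.
by rewrite subr_ge0 cos_le1.
Qed.

Lemma cos_ge_quadratic x : 0 <= x -> 1 - x ^+ 2 / 2 <= cos x.
Proof.
move=> x0; have := @derive_ge0_le (fun y => cos y + 2^-1 * y ^+ 2) (fun y => y - sin y) x x0.
rewrite cos0 expr0n mulr0 addr0 lerBlDr mulrC; apply=> y; last first.
  by move=> /andP[y0 _]; rewrite subr_ge0 sin_le_id.
have h : is_derive y 1 (cos + 2^-1 \*: (id ^+ 2) : R -> R) (y - sin y).
  by apply: is_derive_eq; rewrite /GRing.scale /= expr1; field.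
exact: h.
Qed.

Lemma cos_mul_le_sin x : 0 <= x <= pi -> x * cos x <= sin x.
Proof.
move=> /andP[x0 xpi].
have := @derive_ge0_le (fun y => sin y - y * cos y) (fun y => y * sin y) x x0.
rewrite sin0 mul0r subr0 subr_ge0; apply=> y; last first.
  by move=> /andP[y0 yx]; rewrite mulr_ge0// sin_ge0_pi// y0 (le_trans yx).
have h : is_derive y 1 (sin - id * cos : R -> R) (y * sin y).
  by apply: is_derive_eq; rewrite /GRing.scale /=; ring.
exact: h.
Qed.

(** * Roots of unity and half-angles *)

Definition cis x : R[i] := Complex (cos x) (sin x).

Lemma cisD x y : cis (x + y) = cis x * cis y.
Proof.
rewrite /cis cosD sinD; apply/eqP; rewrite eq_complex /= eqxx /=; apply/eqP; ring.
Qed.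

Lemma cis0 : cis 0 = 1.
Proof. by rewrite /cis cos0 sin0. Qed.

Lemma cis_2pi : cis (pi *+ 2) = 1.
Proof.
rewrite mulr2n cisD /cis cospi sinpi; apply/eqP; rewrite eq_complex /=.
by apply/andP; split; apply/eqP; ring.
Qed.

Lemma cisX x n : cis x ^+ n = cis (n%:R * x).
Proof.
elim: n => [|n IH]; first by rewrite mul0r cis0.
by rewrite exprS IH -cisD -[n.+1]add1n natrD mulrDl mul1r.
Qed.

Lemma norm_cis_sub1 x : `|cis (x *+ 2) - 1| = (2 * `|sin x|)%:C%C.
Proof.
rewrite normc_def /= mulr2n cosD sinD; congr (_%:C%C).
have -> : (cos x * cos x - sin x * sin x - 1) ^+ 2 + (sin x * cos x + cos x * sin x - 0) ^+ 2
   = (2 * sin x) ^+ 2.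
  have -> : cos x * cos x = 1 - sin x ^+ 2 by rewrite -(cos2Dsin2 x); ring.
  have c2 : cos x ^+ 2 = 1 - sin x ^+ 2 by rewrite -(cos2Dsin2 x); ring.
  transitivity (4 * sin x ^+ 4 + 4 * sin x ^+ 2 * cos x ^+ 2); first by ring.
  by rewrite c2; ring.
by rewrite sqrtr_sqr normrM ger0_norm.
Qed.

Lemma norm_cis_add1 x : `|cis (x *+ 2) + 1| = (2 * `|cos x|)%:C%C.
Proof.
rewrite normc_def /= mulr2n cosD sinD; congr (_%:C%C).
have -> : (cos x * cos x - sin x * sin x + 1) ^+ 2 + (sin x * cos x + cos x * sin x + 0) ^+ 2
   = (2 * cos x) ^+ 2.
  have -> : sin x * sin x = 1 - cos x ^+ 2 by rewrite -(cos2Dsin2 x); ring.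
  have c2 : sin x ^+ 2 = 1 - cos x ^+ 2 by rewrite -(cos2Dsin2 x); ring.
  transitivity (4 * cos x ^+ 4 + 4 * cos x ^+ 2 * sin x ^+ 2); first by ring.
  by rewrite c2; ring.
by rewrite sqrtr_sqr normrM ger0_norm.
Qed.

Section Root.
Variable N : nat.
Hypothesis N_gt0 : (0 < N)%N.
Let x : R := pi / N%:R.
Definition zeta : R[i] := cis (x *+ 2).

Let Nx : N%:R * x = pi.
Proof. by rewrite /x mulrC divfK// pnatr_eq0 -lt0n. Qed.

Let x_gt0 : 0 < x.
Proof. by rewrite divr_gt0 ?pi_gt0 ?ltr0n. Qed.

Lemma zetaX b : zeta ^+ b = cis ((b%:R * x) *+ 2).
Proof. by rewrite cisX mulrnAr. Qed.

Lemma zeta_primitive : N.-primitive_root zeta.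
Proof.
have zN : zeta ^+ N = 1.
  by rewrite zetaX Nx cis_2pi.
rewrite /primitive_root_of_unity N_gt0; apply/forallP => i; rewrite unity_rootE.
have [e|ne] := eqVneq i.+1 N; first by rewrite e zN eqxx.
have iN : (i.+1 < N)%N by rewrite ltn_neqAle ne ltn_ord.
rewrite eqbF_neg; apply/negP => /eqP; rewrite zetaX => e.
have := norm_cis_sub1 (i.+1%:R * x); rewrite e subrr normr0 => /esym /eqP.
rewrite eq_complex /= eqxx andbT mulf_eq0 pnatr_eq0 /= normr_eq0 => /eqP s0.
have : 0 < sin (i.+1%:R * x).
  by apply: sin_gt0_pi; rewrite mulr_gt0 ?ltr0n//= -Nx ltr_pM2r// ltr_nat.
by rewrite s0 ltxx.
Qed.

(** As N is odd, [w] is the b-th power of [zeta] or the inverse of it with 0 < b < N/2. The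
    half-angle b pi / N is then acute, so sine and cosine appear without absolute values. *)
Lemma unity_rootP (w : R[i]) : odd N -> w ^+ N = 1 -> w != 1 ->
  exists b : nat, [/\ (0 < b)%N, (b.*2 < N)%N,
    w = zeta ^+ b \/ w * zeta ^+ b = 1,
    `|w - 1| = (2 * sin (b%:R * x))%:C%C &
    `|w + 1| = (2 * cos (b%:R * x))%:C%C].
Proof.
move=> oN wN w1; have [[r rN] /= wE] := prim_rootP zeta_primitive wN.
have r0 : (0 < r)%N by rewrite lt0n; apply: contra_neq w1 => r0; rewrite wE r0.
have pos (b : nat) : (b.*2 < N)%N -> 0 <= sin (b%:R * x) /\ 0 <= cos (b%:R * x).
  move=> bN; have bx0 : 0 <= b%:R * x by rewrite mulr_ge0// ltW.
  have bx : b%:R * x <= pi / 2.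
    rewrite -Nx ler_pdivlMr// mulrAC ler_pM2r// -natrM ler_nat muln2; exact: ltnW.
  have p0 := pi_gt0 R.
  split; first by apply: sin_ge0_pi; rewrite bx0 /=; lra.
  by apply: cos_ge0_pihalf; rewrite bx andbT; lra.
have [lt|ge] := ltnP r.*2 N.
  have [s0 c0] := pos r lt.
  exists r; split=> //; first by left.
    by rewrite wE zetaX norm_cis_sub1 ger0_norm.
  by rewrite wE zetaX norm_cis_add1 ger0_norm.
have neq : r.*2 != N by apply: contraTneq oN => <-; rewrite odd_double.
have b2 : ((N - r).*2 < N)%N by lia.
have [s0 c0] := pos _ b2.
have rx : r%:R * x = pi - (N - r)%:R * x.
  by rewrite natrB ?(ltnW rN)// mulrBl Nx; ring.
have sE : sin (r%:R * x) = sin ((N - r)%:R * x).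
  by rewrite rx sinB sinpi cospi mul0r sub0r mulN1r opprK.
have cE : cos (r%:R * x) = - cos ((N - r)%:R * x).
  by rewrite rx cosB sinpi cospi mul0r addr0 mulN1r.
exists (N - r)%N; split=> //.
- by rewrite subn_gt0.
- right; rewrite wE -exprD subnKC ?(ltnW rN)//; exact: prim_expr_order zeta_primitive.
- by rewrite wE zetaX norm_cis_sub1 sE ger0_norm.
- by rewrite wE zetaX norm_cis_add1 cE normrN ger0_norm.
Qed.

End Root.
End Trig.

(** * Bounds for exponents and for products of tangents *)

Section Arithmetic.

(** Both y and 2 p x are below N/2, so being congruent up to sign they are equal, and x y = 2 p
    x^2. *)
Lemma small_multiple_bound (N t p x y : nat) : (t <= p)%N -> (0 < x)%N ->
  (0 < y)%N -> (y.*2 < N)%N -> (4 * p * x < N)%N ->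
  y = (2 * p * x)%N %[mod N] \/ (N %| y + 2 * p * x)%N -> (2 * t <= x * y)%N.
Proof.
move=> tp x0; have -> : (4 * p * x = 2 * (2 * p * x))%N by rewrite !mulnA.
move: (erefl (2 * p * x)%N); move: {1 3 4 5}(2 * p * x)%N => z zE y0 yN zN h.
have yz : y = z.
  case: h => [|/dvdnP[[|q] qE]]; [by rewrite !modn_small; lia|lia|].
  by rewrite mulSn in qE; lia.
rewrite yz zE mulnCA -mulnA leq_mul2l/= (leq_trans tp)//.
by rewrite -[leqLHS]muln1 leq_mul2l muln_gt0 x0 orbT.
Qed.

Lemma mul_lower (p q c : nat) :
  (4 * p * q - 1 <= 4 * p * c)%N -> (0 < p)%N -> (q <= c)%N.
Proof.
move=> h p0; rewrite leqNgt; apply/negP => cq.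
have : (p * c.+1 <= p * q)%N by rewrite leq_mul2l cq orbT.
by rewrite mulnS; move: h; rewrite -!mulnA; lia.
Qed.

(** If 4 m a or 4 l b is below N, [small_multiple_bound] applies. Otherwise a >= l and b >= m, and a
    b >= m l >= 2 t because t >= 2. *)
Lemma lattice_bound (m l t a b N : nat) : (1 < t)%N -> (t <= m)%N -> (t <= l)%N ->
  N = (4 * m * l - 1)%N ->
  (0 < a)%N -> (0 < b)%N -> (a.*2 < N)%N -> (b.*2 < N)%N ->
  b = (2 * m * a)%N %[mod N] \/ (N %| b + 2 * m * a)%N ->
  a = (2 * l * b)%N %[mod N] \/ (N %| a + 2 * l * b)%N ->
  (2 * t <= a * b)%N.
Proof.
move=> t1 tm tl NE a0 b0 aN bN hb ha.
have [am|am] := ltnP (4 * m * a) N; first exact: small_multiple_bound hb.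
have [bl|bl] := ltnP (4 * l * b) N; first by rewrite (mulnC a); exact: small_multiple_bound ha.
have m0 : (0 < m)%N by apply: leq_trans tm; exact: ltnW.
have l0 : (0 < l)%N by apply: leq_trans tl; exact: ltnW.
rewrite NE in am bl.
have la : (l <= a)%N by exact: mul_lower am m0.
have mb : (m <= b)%N.
  by apply: (mul_lower _ l0); rewrite mulnAC.
rewrite (mulnC a); apply: leq_trans (leq_mul mb la).
by rewrite mulnC; apply: leq_mul => //; exact: leq_trans tl.
Qed.

Variable R : realType.
Implicit Types x y : R.

Lemma pi_le4 : (pi : R) <= 4.
Proof. by have := pihalf_lt2 R; lra. Qed.

(** This is tan x tan(2 (t - 1) x) < 2 t x^2. From sin y <= y and cos y >= 1 - y^2/2 it follows once
    x^2 (1/2 + 2 (t - 1)^2) t < 1, which the bound on x gives. *)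
Lemma tan_small_lt (t : nat) x : (1 < t)%N -> 0 < x ->
  x * (4 * t%:R ^+ 2 - 1) <= 4 ->
  sin x * sin ((2 * t.-1)%N%:R * x) <
    (2 * t)%N%:R * x ^+ 2 * (cos x * cos ((2 * t.-1)%N%:R * x)).
Proof.
move=> t1 x0 xt; set s := (2 * t.-1)%N%:R * x.
have tR : 2 <= t%:R :> R by rewrite ler_nat.
set T := t%:R in tR xt.
have sE : s = 2 * (T - 1) * x.
  by rewrite /s natrM -subn1 natrB ?(ltnW t1).
have s0 : 0 < s by rewrite sE !mulr_gt0//; lra.
have D0 : 0 < 4 * T ^+ 2 - 1 by rewrite expr2; nra.
have x2 : x ^+ 2 * (4 * T ^+ 2 - 1) ^+ 2 <= 16.
  rewrite -exprMn; have -> : 16 = 4 ^+ 2 :> R by ring.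
  by apply: lerXn2r; rewrite ?nnegrE ?(mulr_ge0 (ltW x0) (ltW D0)).
have key : x ^+ 2 * (2^-1 + 2 * (T - 1) ^+ 2) * T < 1.
  have D2 : 0 < (4 * T ^+ 2 - 1) ^+ 2 by rewrite exprn_gt0.
  rewrite -(ltr_pM2r D2) mul1r.
  have h : 16 * ((2^-1 + 2 * (T - 1) ^+ 2) * T) < (4 * T ^+ 2 - 1) ^+ 2.
    rewrite -subr_gt0.
    have -> : (4 * T ^+ 2 - 1) ^+ 2 - 16 * ((2^-1 + 2 * (T - 1) ^+ 2) * T) =
      16 * (T * (T - 1)) ^+ 2 + 40 * (T * (T - 1)) + 1 by field.
    rewrite !addr_gt0 ?mulr_gt0 ?exprn_gt0 ?mulr_gt0//; lra.
  apply: le_lt_trans h.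
  have -> : x ^+ 2 * (2^-1 + 2 * (T - 1) ^+ 2) * T * (4 * T ^+ 2 - 1) ^+ 2 =
    x ^+ 2 * (4 * T ^+ 2 - 1) ^+ 2 * ((2^-1 + 2 * (T - 1) ^+ 2) * T) by ring.
  rewrite ler_wpM2r// mulr_ge0 ?addr_ge0 ?mulr_ge0 ?sqr_ge0//; lra.
have c1 := cos_ge_quadratic (ltW x0); have c2 := cos_ge_quadratic (ltW s0).
have cc : 1 - x ^+ 2 * (2^-1 + 2 * (T - 1) ^+ 2) <= (1 - x ^+ 2 / 2) * (1 - s ^+ 2 / 2).
  rewrite sE -subr_ge0.
  have -> : (1 - x ^+ 2 / 2) * (1 - (2 * (T - 1) * x) ^+ 2 / 2) -
    (1 - x ^+ 2 * (2^-1 + 2 * (T - 1) ^+ 2)) = (x ^+ 2 * (T - 1)) ^+ 2 by field.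
  exact: sqr_ge0.
have k2 : x ^+ 2 * (2^-1 + 2 * (T - 1) ^+ 2) < 2^-1.
  have q0 : 0 <= x ^+ 2 * (2^-1 + 2 * (T - 1) ^+ 2).
    by rewrite mulr_ge0 ?addr_ge0 ?mulr_ge0 ?sqr_ge0//; lra.
  by nra.
have xs2 : x ^+ 2 / 2 + s ^+ 2 / 2 = x ^+ 2 * (2^-1 + 2 * (T - 1) ^+ 2).
  by rewrite sE; field.
have px := sqr_ge0 x; have ps := sqr_ge0 s.
have d1 : 0 < 1 - x ^+ 2 / 2 by lra.
have d2 : 0 < 1 - s ^+ 2 / 2 by lra.
have ccc : (1 - x ^+ 2 / 2) * (1 - s ^+ 2 / 2) <= cos x * cos s.
  by apply: ler_pM => //; exact: ltW.
have sx := sin_le_id (ltW x0); have ss := sin_le_id (ltW s0).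
have ss0 : sin x * sin s <= x * s.
  have [h|h] := leP 0 (sin s); have [h'|h'] := leP 0 (sin x).
  - by apply: ler_pM.
  - apply: le_trans (_ : 0 <= _); first by rewrite mulr_le0_ge0// ltW.
    by rewrite mulr_ge0 ?ltW.
  - apply: le_trans (_ : 0 <= _); first by rewrite mulr_ge0_le0// ltW.
    by rewrite mulr_ge0 ?ltW.
  - have x2p : 1 - x ^+ 2 / 2 <= 1 by lra.
    by exfalso; have := sin_gt0_pi (x := x); rewrite x0 /=; move: h' d1 (pi_ge2 R); nra.
apply: le_lt_trans ss0 _.
have -> : x * s = 2 * x ^+ 2 * (T - 1) by rewrite sE; ring.
rewrite natrM -/T.
apply: lt_le_trans (_ : 2 * T * x ^+ 2 * (1 - x ^+ 2 * (2^-1 + 2 * (T - 1) ^+ 2)) <= _).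
  have p : 0 < 2 * x ^+ 2 by rewrite mulr_gt0 ?exprn_gt0.
  have -> : 2 * T * x ^+ 2 * (1 - x ^+ 2 * (2^-1 + 2 * (T - 1) ^+ 2)) =
    2 * x ^+ 2 * (T - x ^+ 2 * (2^-1 + 2 * (T - 1) ^+ 2) * T) by ring.
  by rewrite ltr_pM2l// ltrD2l ltrN2.
have c0 : 0 <= 2 * T * x ^+ 2 by rewrite mulr_ge0//; lra.
by rewrite ler_wpM2l//; exact: le_trans cc ccc.
Qed.

(** y <= tan y in both factors, multiplied out so as to match [tan_small_lt]. *)
Lemma tan_large_ge (a b : nat) x : 0 < x -> a%:R * x < pi / 2 -> b%:R * x < pi / 2 ->
  (a * b)%N%:R * x ^+ 2 * (cos (a%:R * x) * cos (b%:R * x)) <=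
  sin (a%:R * x) * sin (b%:R * x).
Proof.
move=> x0 ax bx; have p0 := pi_gt0 R.
have a0 : 0 <= a%:R * x by rewrite mulr_ge0// ltW.
have b0 : 0 <= b%:R * x by rewrite mulr_ge0// ltW.
have ca : 0 <= cos (a%:R * x) by apply: cos_ge0_pihalf; lra.
have cb : 0 <= cos (b%:R * x) by apply: cos_ge0_pihalf; lra.
have ha := cos_mul_le_sin (x := a%:R * x); have hb := cos_mul_le_sin (x := b%:R * x).
have -> : (a * b)%N%:R * x ^+ 2 * (cos (a%:R * x) * cos (b%:R * x)) =
  (a%:R * x * cos (a%:R * x)) * (b%:R * x * cos (b%:R * x)) by rewrite natrM; ring.
have {}ha := ha ltac:(lra); have {}hb := hb ltac:(lra).
by apply: ler_pM ha hb; exact: mulr_ge0.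
Qed.

End Arithmetic.

(** * The two numerical invariants of the knot *)

Section Compare.
Variable R : realType.
Local Notation V4 := 'rV[R]_4.
Local Notation K m l := (double_twist R (2 * m)%N (2 * l)%N).

(** Three choices of [Q] enter: the cyclic group of g', the peripheral group generated by g' and its
    longitude, and [rotations]. *)
Lemma knots_compare (C : numClosedFieldType) (m l m' l' : nat) (f : V4 -> V4) :
  (0 < m)%N -> (0 < l)%N -> (0 < m')%N -> (0 < l')%N ->
  homeo_on (@S3 R) f -> f @` K m l = K m' l' ->
  forall u : C, u ^+ (4 * m * l - 1) = 1 -> u != 1 ->
  u ^+ (2 * m) ^+ (4 * m' * l' - 1) = 1 /\
  exists u' (d : nat), [/\ u' ^+ (4 * m' * l' - 1) = 1, u' != 1, (0 < d)%N &
    (`|u ^+ m - 1| * `|u ^+ (2 * m * l) - 1|) *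
      (`|u' ^+ m' + 1| * `|u' ^+ (2 * m' * l') + 1|) =
    d%:R * (`|u' ^+ m' - 1| * `|u' ^+ (2 * m' * l') - 1|) *
      (`|u ^+ m + 1| * `|u ^+ (2 * m * l) + 1|)].
Proof.
move=> m0 l0 m0' l0' hf fK u uN u1.
have [g [U [V [rel kg aU tau]]]] := exists_model m0 l0 uN u1.
have [g' [U' [V' [rel' P1 P2 P3]]]] := transport m0 l0 m0' l0' hf fK rel.
rewrite -aU; apply: (glide_compare m0 l0 m0' l0' rel kg _ tau rel') => //.
- by rewrite aU.
- by apply: P1; [exact: subgroup_powers|exact: powers_id].
- have lc := longitude_comm rel'.
  have [Q1 _ _] := subgroup_powers g'.
  have [Q1' _ _] := subgroup_powers (longitude m' l' U' V').
  apply: P2 (subgroup_powers2 (esym lc)) _ _.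
    by exists g', 1%g; split; rewrite ?mulg1//; exact: powers_id.
  by exists 1%g, (longitude m' l' U' V'); split; rewrite ?mul1g//; exact: powers_id.
- move=> N hU hV; apply: P3 => //; first exact: subgroup_rotations.
  rewrite /rotations /= divff ?ga_neq0// expr1n.
  case: ifP => // /negbT eg.
  (* If [gk g'] were even, g' might fail to lie in [rotations]; but a conjugate of g, with [gk]
     equal to 1, is a power of g'. *)
  exfalso; have [h] := P1 _ (subgroup_powers g') (powers_id g').
  move=> /gk_powers[i [j [_]]]; have -> : gk (h^-1 * g * h)%g = 1.
    by rewrite !gkM gkV kg; ring.
  by move=> /esym /mulz_eq1 [] [e _]; move: eg; rewrite e.
Qed.

(** For a primitive N-th root the comparison says that N divides 2 m N', and 2 m divides N + 1,
    hence is prime to N. *)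
Lemma order_dvd (m l m' l' : nat) (f : V4 -> V4) :
  (0 < m)%N -> (0 < l)%N -> (0 < m')%N -> (0 < l')%N ->
  homeo_on (@S3 R) f -> f @` K m l = K m' l' ->
  (4 * m * l - 1 %| 4 * m' * l' - 1)%N.
Proof.
move=> m0 l0 m0' l0' hf fK; set N := (4 * m * l - 1)%N.
have ml0 : (0 < m * l)%N by rewrite muln_gt0 m0.
have NE : (4 * m * l = N.+1)%N by rewrite /N -mulnA; lia.
have N2 : (1 < N)%N by rewrite /N -mulnA; lia.
have zp := zeta_primitive R (ltnW N2).
have zN := prim_expr_order zp.
have z1 : zeta R N != 1.
  rewrite -[zeta R N]expr1 -(prim_order_dvd zp) dvdn1; lia.
have [h _] := knots_compare m0 l0 m0' l0' hf fK zN z1.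
move/eqP: h; rewrite -exprM -(prim_order_dvd zp) Gauss_dvdr//.
have : coprime N (4 * m * l) by rewrite NE coprimenS.
rewrite (_ : (4 * m * l = 2 * m * (2 * l))%N); last by ring.
by rewrite coprimeMr => /andP[].
Qed.

(** [unity_rootP] yields exponents only up to inversion of the root, so a power relation becomes a
    congruence up to sign. *)
Lemma pm_power (N a b k : nat) (z x y : R[i]) : N.-primitive_root z ->
  y = x ^+ k -> x = z ^+ a \/ x * z ^+ a = 1 -> y = z ^+ b \/ y * z ^+ b = 1 ->
  b = (k * a)%N %[mod N] \/ (N %| b + k * a)%N.
Proof.
move=> zp yx [xa|xa] [yb|yb].
- by left; apply/eqP; rewrite -(eq_prim_root_expr zp) mulnC exprM -xa -yx yb.
- by right; rewrite (prim_order_dvd zp) addnC exprD mulnC exprM -xa -yx yb.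
- right; rewrite (prim_order_dvd zp) exprD -yb yx mulnC exprM -exprMn xa.
  by rewrite expr1n.
- left; apply/eqP; rewrite -(eq_prim_root_expr zp); apply/eqP.
  have y0 : y != 0.
    by apply: contra_eq_neq yb => ->; rewrite mul0r eq_sym oner_eq0.
  by apply: (mulfI y0); rewrite yb yx mulnC exprM -exprMn xa expr1n.
Qed.

(** Let t = min(m, l) + 1 and x = pi / N. The first knot has the ratio tan x tan(2 (t - 1) x) < 2 t
    x^2. If m', l' >= t, every ratio tan(a x) tan(b x) of the second is at least a b x^2 >= 2 t x^2,
    and the factor d >= 1 cannot lower it. *)
Lemma min_not_lt (m l m' l' : nat) (f : V4 -> V4) :
  (0 < m)%N -> (0 < l)%N -> (0 < m')%N -> (0 < l')%N ->
  homeo_on (@S3 R) f -> f @` K m l = K m' l' -> (m * l = m' * l')%N ->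
  (minn m' l' <= minn m l)%N.
Proof.
move=> m0 l0 m0' l0' hf fK mlE; rewrite leqNgt; apply/negP => lt.
set t := (minn m l).+1 in lt.
have tm : (t <= m')%N by apply: leq_trans lt (geq_minl _ _).
have tl : (t <= l')%N by apply: leq_trans lt (geq_minr _ _).
have t1 : (1 < t)%N by rewrite ltnS leq_min m0.
pose N := (4 * m * l - 1)%N.
have ml0 : (0 < m * l)%N by rewrite muln_gt0 m0.
have NE : (4 * m * l = N.+1)%N by rewrite /N -mulnA; lia.
have NE' : (4 * m' * l' - 1 = N)%N by rewrite /N -!mulnA mlE.
have N2 : (1 < N)%N by rewrite /N -mulnA; lia.
have oN : odd N by move: (congr1 odd NE); rewrite !oddM /= => /esym/negbFE.
have zp := zeta_primitive R (ltnW N2); set z := zeta R N in zp.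
have zN := prim_expr_order zp.
have z1 : z != 1 by rewrite -[z]expr1 -(prim_order_dvd zp) dvdn1; lia.
have tt : (t * t <= m' * l')%N by exact: leq_mul.
pose x : R := pi / N%:R.
have NR : 0 < N%:R :> R by rewrite ltr0n ltnW.
have x0 : 0 < x by rewrite divr_gt0 ?pi_gt0.
have Nx : N%:R * x = pi by rewrite /x mulrC divfK// gt_eqF.
have half_lt (a : nat) : (a.*2 < N)%N -> a%:R * x < pi / 2.
  by move=> aN; rewrite -Nx ltr_pdivlMr// mulrAC ltr_pM2r// -natrM ltr_nat muln2.
have p0 := pi_gt0 R.
have cpos (a : nat) : (a.*2 < N)%N -> 0 < cos (a%:R * x).
  move=> /half_lt h; have h0 : 0 <= a%:R * x by rewrite mulr_ge0// ltW.
  by apply: cos_gt0_pihalf; lra.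
have spos (a : nat) : (a.*2 < N)%N -> 0 <= sin (a%:R * x).
  move=> /half_lt h; have h0 : 0 <= a%:R * x by rewrite mulr_ge0// ltW.
  by apply: sin_ge0_pi; lra.
set s := (2 * t.-1)%N.
have sN : (s.*2 < N)%N.
  have : (t * 2 <= t * t)%N by rewrite leq_mul2l t1 orbT.
  by rewrite /s /N -mulnA mlE; lia.
have N12 : (1.*2 < N)%N by apply: leq_trans sN; rewrite /s; lia.
have nz b : (b.*2 < N)%N -> `|z ^+ b - 1| = (2 * sin (b%:R * x))%:C%C /\
    `|z ^+ b + 1| = (2 * cos (b%:R * x))%:C%C.
  move=> bN; rewrite /z zetaX norm_cis_sub1 norm_cis_add1 -/x.
  by rewrite !ger0_norm// ?(ltW (cpos _ bN)) ?spos.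
(* The root realising the least ratio, found from z^(4ml) = z: it is z^2 for m <= l and z^(4l) for l
   < m, and s = 2 min(m, l). *)
have [u [uN u1 uE]] : exists u, [/\ u ^+ N = 1, u != 1 &
    (u ^+ m = z /\ u ^+ (2 * m * l) = z ^+ s) \/
    (u ^+ m = z ^+ s /\ u ^+ (2 * m * l) = z)].
  have zml : z ^+ (4 * m * l) = z by rewrite NE exprS zN mulr1.
  have [ml|lm] := leqP m l.
    have sE : s = (2 * m)%N by rewrite /s /t (minn_idPl ml).
    have e : z ^+ 2 ^+ (2 * m * l) = z by rewrite -exprM -[RHS]zml; congr (_ ^+ _); ring.
    exists (z ^+ 2); split.
    - by rewrite exprAC zN expr1n.
    - by apply: contra_neq z1 => z2; rewrite -e z2 expr1n.
    - by right; split=> //; rewrite -exprM sE.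
  have sE : s = (2 * l)%N by rewrite /s /t (minn_idPr (ltnW lm)).
  have e : z ^+ (4 * l) ^+ m = z.
    by rewrite -exprM -[RHS]zml; congr (_ ^+ _); ring.
  exists (z ^+ (4 * l)); split.
  - by rewrite exprAC zN expr1n.
  - by apply: contra_neq z1 => z2; rewrite -e z2 expr1n.
  - left; split=> //; rewrite (_ : (2 * m * l = m * (2 * l))%N); last by ring.
    by rewrite exprM e sE.
have [_ [u' [d [uN' u1' d0 E]]]] := knots_compare m0 l0 m0' l0' hf fK uN u1.
have [n1 n2 n3 n4] := eta_neq m0' l0' uN' u1'.
rewrite NE' in uN'.
have [b [b0 bN bz b1 b2]] : exists b : nat, [/\ (0 < b)%N, (b.*2 < N)%N,
    u' ^+ m' = z ^+ b \/ u' ^+ m' * z ^+ b = 1,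
    `|u' ^+ m' - 1| = (2 * sin (b%:R * x))%:C%C &
    `|u' ^+ m' + 1| = (2 * cos (b%:R * x))%:C%C].
  by apply: (unity_rootP (ltnW N2)) => //; rewrite exprAC uN' expr1n.
have [a [a0 aN az a1 a2]] : exists b : nat, [/\ (0 < b)%N, (b.*2 < N)%N,
    u' ^+ (2 * m' * l') = z ^+ b \/ u' ^+ (2 * m' * l') * z ^+ b = 1,
    `|u' ^+ (2 * m' * l') - 1| = (2 * sin (b%:R * x))%:C%C &
    `|u' ^+ (2 * m' * l') + 1| = (2 * cos (b%:R * x))%:C%C].
  by apply: (unity_rootP (ltnW N2)) => //; rewrite exprAC uN' expr1n.
have u'E : u' ^+ (4 * m' * l') = u'.
  have -> : (4 * m' * l' = N.+1)%N by rewrite -NE -!mulnA mlE.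
  by rewrite exprS uN' mulr1.
(* The two numbers entering the ratio are powers of each other, with exponents 2 m' and 2 l'; these
   are the two congruences of [lattice_bound]. *)
have h1 : u' ^+ m' = u' ^+ (2 * m' * l') ^+ (2 * m').
  rewrite -{1}u'E -!exprM; congr (_ ^+ _); ring.
have h2 : u' ^+ (2 * m' * l') = u' ^+ m' ^+ (2 * l').
  rewrite -!exprM; congr (_ ^+ _); ring.
have lat := lattice_bound t1 tm tl (esym NE') a0 b0 aN bN
  (pm_power zp h1 az bz) (pm_power zp h2 bz az).
have [A1 A2] := nz _ N12; have [B1 B2] := nz _ sN.
rewrite expr1 mul1r in A1 A2.
have {}E : sin x * sin (s%:R * x) * (cos (a%:R * x) * cos (b%:R * x)) =
    d%:R * (sin (a%:R * x) * sin (b%:R * x)) * (cos x * cos (s%:R * x)).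
  have E' : (2 * sin x * (2 * sin (s%:R * x)) * (2 * cos (b%:R * x) * (2 * cos (a%:R * x))))%:C%C =
      (d%:R * (2 * sin (b%:R * x) * (2 * sin (a%:R * x))) * (2 * cos x * (2 * cos (s%:R * x))))%:C%C.
    rewrite !(rmorphM (real_complex R)) /= !(rmorph_nat (real_complex R)) in b1 b2 a1 a2 A1 A2 B1 B2 *.
    move: E; rewrite b1 b2 a1 a2; case: uE => -[-> ->].
      by rewrite A1 A2 B1 B2.
    by rewrite A1 A2 B1 B2 => e; rewrite [X in X * _ = _]mulrC e; congr (_ * _); exact: mulrC.
  have := complexI E' => e16.
  have s0 : 16 != 0 :> R by rewrite pnatr_eq0.
  apply: (mulfI s0); transitivity (2 * sin x * (2 * sin (s%:R * x)) *
     (2 * cos (b%:R * x) * (2 * cos (a%:R * x)))); first by ring.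
  by rewrite e16; ring.
(* From pi <= 4 and N = 4 m' l' - 1 >= 4 t^2 - 1. *)
have xt : x * (4 * t%:R ^+ 2 - 1) <= 4.
  apply: le_trans (pi_le4 R); rewrite -Nx mulrC ler_pM2r//.
  rewrite lerBlDr natr1 -NE -natrX -natrM ler_nat -mulnA leq_mul2l /= mlE.
  by rewrite expnS expn1.
have L1 := tan_small_lt t1 x0 xt; rewrite -/s in L1.
have L2 := tan_large_ge x0 (half_lt _ aN) (half_lt _ bN).
have ca := cpos _ aN; have cb := cpos _ bN; have cs := cpos _ sN.
have c1 : 0 < cos x by have := cpos _ N12; rewrite mul1r.
have cab : 0 < cos (a%:R * x) * cos (b%:R * x) by rewrite mulr_gt0.
have c1s : 0 < cos x * cos (s%:R * x) by rewrite mulr_gt0.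
have {}L1 : sin x * sin (s%:R * x) * (cos (a%:R * x) * cos (b%:R * x)) <
   (2 * t)%N%:R * x ^+ 2 * (cos x * cos (s%:R * x)) * (cos (a%:R * x) * cos (b%:R * x)).
  by rewrite ltr_pM2r.
have L3 : (2 * t)%N%:R * x ^+ 2 * (cos (a%:R * x) * cos (b%:R * x)) <=
    sin (a%:R * x) * sin (b%:R * x).
  apply: le_trans L2; rewrite ler_pM2r// ler_pM2r ?exprn_gt0//.
  by rewrite ler_nat.
have S0 : 0 <= sin (a%:R * x) * sin (b%:R * x) by rewrite mulr_ge0 ?spos.
have L4 : sin (a%:R * x) * sin (b%:R * x) <= d%:R * (sin (a%:R * x) * sin (b%:R * x)).
  by rewrite ler_peMl// ler1n.
move: L1; rewrite E [ltRHS]mulrAC ltr_pM2r// => L1.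
by have := lt_le_trans L1 (le_trans L3 L4); rewrite ltxx.
Qed.

Lemma homeo_on_inv (f : V4 -> V4) (A B : set V4) : homeo_on (@S3 R) f ->
  A `<=` @S3 R -> f @` A = B ->
  exists f', homeo_on (@S3 R) f' /\ f' @` B = A.
Proof.
move=> [f' [fS f'S fK f'K [cf cf']]] AS <-; exists f'; split; first by exists f.
rewrite eqEsubset; split=> [_ [_ [v Av <-] <-]|v Av].
  by rewrite fK//; apply/mem_set/AS.
by exists (f v); [exists v|rewrite fK//; apply/mem_set/AS].
Qed.

(** Divisibility in both directions gives equal products, [min_not_lt] in both directions equal
    minima, and together they fix the unordered pair. *)
Lemma double_twist_unique (m l m' l' : nat) :
  (0 < m)%N -> (0 < l)%N -> (0 < m')%N -> (0 < l')%N ->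
  ambient_isotopic (K m l) (K m' l') ->
  (m = m' /\ l = l') \/ (m = l' /\ l = m').
Proof.
move=> m0 l0 m0' l0' [H [_ Hh _ HK]].
have hf : homeo_on (@S3 R) (H 1) by apply: Hh; rewrite in_itv /= ler01 lexx.
have [f' [hf' fK']] := homeo_on_inv hf (@double_twist_S3 _ _ _) HK.
have d1 := order_dvd m0 l0 m0' l0' hf HK.
have d2 := order_dvd m0' l0' m0 l0 hf' fK'.
have ml0 : (0 < m * l)%N by rewrite muln_gt0 m0.
have ml0' : (0 < m' * l')%N by rewrite muln_gt0 m0'.
have mlE : (m * l = m' * l')%N.
  have /eqP : (4 * m * l - 1 == 4 * m' * l' - 1)%N by rewrite eqn_dvd d1.
  by rewrite -!mulnA; lia.
have i1 := min_not_lt m0 l0 m0' l0' hf HK mlE.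
have i2 := min_not_lt m0' l0' m0 l0 hf' fK' (esym mlE).
have /eqP : minn m l == minn m' l' by rewrite eqn_leq i1 i2.
have [h|h] := leqP m l; have [h'|h'] := leqP m' l' => e.
- by left; split=> //; apply/eqP; rewrite -(eqn_pmul2l m0) mlE e.
- right; split=> //; apply/eqP; rewrite -(eqn_pmul2l m0) mlE e mulnC.
  by [].
- right; split=> //; apply/eqP; rewrite -(eqn_pmul2r l0) mlE e mulnC.
  by [].
- by left; split=> //; apply/eqP; rewrite -(eqn_pmul2r l0) mlE e.
Qed.

End Compare.

(** * The rotation exchanging inside and outside *)

Section FlipIsotopy.
Variable R : realType.
Local Notation V4 := 'rV[R]_4.
Implicit Types (v : V4) (c s t : R).
Let r : R := Num.sqrt 2.

(* Rotation about the axis of flip: it fixes x + y and h and turns the plane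
   of the orthogonal coordinates (x - y) / sqrt 2 and w. *)
Definition turn c s v : V4 :=
  vec4 ((cx v + cy v + (c * (cx v - cy v) - s * r * cw v)) / 2)
       ((cx v + cy v - (c * (cx v - cy v) - s * r * cw v)) / 2)
       (s * (cx v - cy v) / r + c * cw v) (ch v).

Let r_neq0 : r != 0. Proof. by rewrite gt_eqF// sqrtr_gt0. Qed.
Let r2 : r ^+ 2 = 2. Proof. by rewrite sqr_sqrtr. Qed.

Lemma turn_S3 c s v : c ^+ 2 + s ^+ 2 = 1 -> @S3 R v -> @S3 R (turn c s v).
Proof.
move=> cs /S3E Sv; apply/S3E; rewrite !cE -[RHS]Sv.
set D := cx v - cy v.
(* For [field] the root [r] is a free symbol; the multiple of r^2 - 2 collects what vanishes by r^2
   = 2. *)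
transitivity (((cx v + cy v) ^+ 2 + (c ^+ 2 + s ^+ 2) * D ^+ 2) / 2 +
   (c ^+ 2 + s ^+ 2) * cw v ^+ 2 + ch v ^+ 2 +
   (r ^+ 2 - 2) * (s ^+ 2 * cw v ^+ 2 / 2 - s ^+ 2 * D ^+ 2 / (2 * r ^+ 2) -
     s * c * D * cw v / r)).
  by field.
by rewrite r2 subrr mul0r addr0 cs /D; field.
Qed.

Lemma turnK c s : c ^+ 2 + s ^+ 2 = 1 -> cancel (turn c s) (turn c (- s)).
Proof.
move=> cs v; apply: vec4P; rewrite !cE //.
- transitivity ((cx v + cy v + (c ^+ 2 + s ^+ 2) * (cx v - cy v)) / 2); first by field.
  by rewrite cs; field.
- transitivity ((cx v + cy v - (c ^+ 2 + s ^+ 2) * (cx v - cy v)) / 2); first by field.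
  by rewrite cs; field.
transitivity ((c ^+ 2 + s ^+ 2) * cw v); first by field.
by rewrite cs mul1r.
Qed.

Lemma turn_cont (T : topologicalType) (A : set T) (c s : T -> R) (f : T -> V4) :
  cont_on A c -> cont_on A s -> cont_on A f ->
  cont_on A (fun z => turn (c z) (s z) (f z)).
Proof.
move=> hc hs hf.
have coord (g : V4 -> R) : continuous g -> cont_on A (fun z => g (f z)).
  by move=> hg; apply: (cont_on_comp (B := setT)) => //; exact: continuous_cont_on.
have [X Y] := (coord _ (@cx_cont R), coord _ (@cy_cont R)).
have [W H] := (coord _ (@cw_cont R), coord _ (@ch_cont R)).
have D : cont_on A (fun z => cx (f z) - cy (f z)) by apply: cont_onD => //; exact: cont_onN.
have S : cont_on A (fun z => cx (f z) + cy (f z)) by exact: cont_onD.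
have k (a : R) : cont_on A (fun=> a) by exact: cont_on_cst.
have E : cont_on A (fun z => c z * (cx (f z) - cy (f z)) - s z * r * cw (f z)).
  apply: cont_onD; first exact: cont_onM.
  by apply: cont_onN; apply: cont_onM => //; exact: cont_onM.
apply: cont_on_vec4 => //.
- by apply: cont_onM => //; exact: cont_onD.
- by apply: cont_onM => //; apply: cont_onD => //; exact: cont_onN.
- apply: cont_onD; last exact: cont_onM.
  by apply: cont_onM => //; exact: cont_onM.
Qed.

(** The rotation by the angle pi t about the axis of [flip] is the identity at t = 0 and [flip] at t
    = 1, which exchanges the two twist regions. *)
Lemma flip_isotopy (p q : int) :
  ambient_isotopic (double_twist R p q) (double_twist R q p).
Proof.
pose H (t : R) (v : V4) := turn (cos (pi * t)) (sin (pi * t)) v.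
have cs (t : R) : cos t ^+ 2 + sin t ^+ 2 = 1 by exact: cos2Dsin2.
have cont (a : R) (A : set V4) : {within A, continuous (turn (cos a) (sin a))}.
  apply: continuous_subspaceT; apply: cont_on_continuous; apply: turn_cont.
  - exact: cont_on_cst.
  - exact: cont_on_cst.
  - by apply: continuous_cont_on => v; exact: cvg_id.
exists H; split.
- apply: continuous_subspaceT; apply: cont_on_continuous.
  have c1 : cont_on setT (fun z : R * V4 => pi * z.1).
    by apply: cont_onM; [exact: cont_on_cst|apply: continuous_cont_on => z; exact: cvg_fst].
  apply: turn_cont.
  + by apply: cont_on_comp1 => //; exact: continuous_cos.
  + by apply: cont_on_comp1 => //; exact: continuous_sin.
  + by apply: continuous_cont_on => z; exact: cvg_snd.
- move=> t _; exists (turn (cos (- (pi * t))) (sin (- (pi * t)))); split.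
  + by move=> v; exact: turn_S3.
  + by move=> v; exact: turn_S3.
  + by move=> v _; rewrite cosN sinN; exact: turnK.
  + move=> v _; rewrite /H cosN sinN -{1}[sin (pi * t)]opprK; apply: turnK.
    by rewrite sqrrN.
  + by split; exact: cont.
- move=> v _; rewrite /H mulr0 cos0 sin0; apply: vec4P; rewrite !cE; by field.
have H1 v : H 1 v = flip v.
  rewrite /H mulr1 cospi sinpi flipE; apply: vec4P; rewrite !cE //; by field.
rewrite eqEsubset; split=> [_ [v Kv <-]|v Kv].
  by rewrite H1; apply/double_twist_flip.
by exists (flip v); [apply/double_twist_flip|rewrite H1 flipK].
Qed.

Lemma isotopic_refl (K : set V4) : ambient_isotopic K K.
Proof.
exists (fun _ v => v); split=> //.
- by apply: continuous_subspaceT => z; exact: cvg_snd.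
- move=> t _; exists id; split=> //.
  by split; apply: continuous_subspaceT => z; exact: cvg_id.
- by rewrite image_id.
Qed.

End FlipIsotopy.

Lemma even_pos_int (p : int) : 0 < p -> (2 %| p)%Z ->
  exists m : nat, (0 < m)%N /\ p = (2 * m)%N.
Proof.
case: p => [n|n] //; rewrite dvdzE /= => n0 /dvdnP[m e]; exists m.
by rewrite mulnC -e; split=> //; move: n0; rewrite e; case: m {e}.
Qed.

Theorem theorem3p11 (R : realType) (p q a b : int)
    (p_gt0 : 0 < p) (q_gt0 : 0 < q) (a_gt0 : 0 < a) (b_gt0 : 0 < b)
    (p_even : (2 %| p)%Z) (q_even : (2 %| q)%Z)
    (a_even : (2 %| a)%Z) (b_even : (2 %| b)%Z) :
  ambient_isotopic (double_twist R p q) (double_twist R a b) <->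
  [set p; q] = [set a; b].
Proof.
split=> [iso|e].
  have [m [m0 pE]] := even_pos_int p_gt0 p_even.
  have [l [l0 qE]] := even_pos_int q_gt0 q_even.
  have [m' [m0' aE]] := even_pos_int a_gt0 a_even.
  have [l' [l0' bE]] := even_pos_int b_gt0 b_even.
  rewrite pE qE aE bE in iso *.
  have [[-> ->] //|[-> ->]] := double_twist_unique m0 l0 m0' l0' iso.
  exact: setUC.
have pab : [set a; b] p by rewrite -e; left.
have qab : [set a; b] q by rewrite -e; right.
have apq : [set p; q] a by rewrite e; left.
have bpq : [set p; q] b by rewrite e; right.
have [[-> ->]|[-> ->]] : (p = a /\ q = b) \/ (p = b /\ q = a).
- by case: pab qab apq bpq => /= -> [] /= -> [] /= ? [] /= ?; subst; auto.
- exact: isotopic_refl.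
- exact: flip_isotopy.
Qed.
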